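(* Let $D\subset\mathbb{R}^d$ be a connected, bounded $C^{1,\alpha}$-domain, where $\alpha>0$. Let $\Lambda,\beta>0$, $\kappa\ne0$, and let $G:\mathbb{R}_+\to\mathbb{R}_+$ be locally Lipschitz with $G(0)=0$, $z\mapsto G(z)/z$ increasing on $(0,\infty)$, and $G(z)\le\Lambda z^{1+\beta}$ for all $z>0$. Let $\{W_t,\ t\ge0\}$ be a standard one-dimensional Brownian motion, let $f:D\to\mathbb{R}_+$ be of class $C^2$ and not identically zero, let $\{S_t,\ t\ge0\}$ be the semigroup of the Dirichlet Laplacian on $D$, let $\lambda_1$ be the first Dirichlet eigenvalue and $\psi>0$ the corresponding eigenfunction normalized by $\int_D\psi(x)^2\,dx=1$, and let $c>0$ be a constant for which the two-sided heat kernel bound given in the context holds. Suppose that for some $\eta>0$ and $K>0$, $$f(y)\le K\,S_\eta\psi(y),\qquad y\in D,$$ and consider any path of $W$ for which $$\int_0^\infty e^{\kappa\beta W_r-(\lambda_1+\kappa^2/2)\beta r}\,dr<\frac{e^{\lambda_1\beta\eta}}{\Lambda\beta\Big[K(1+c)\big(\sup_{x\in D}\psi(x)\big)^2\int_D\psi(y)\,dy\Big]^\beta}.$$ Then, for this path, the solution $v$ of $$v(t,x)=e^{-\kappa^2t/2}S_tf(x)+\int_0^te^{-\kappa^2(t-r)/2}S_{t-r}\Big(e^{-\kappa W_r}G\big(e^{\kappa W_r}v(r,\cdot)\big)\Big)(x)\,dr$$ is global, i.e. it exists for all $t\ge0$ without blowing up in finite time.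
   Context: The semigroup $\{S_t\}$ is that of $d$-dimensional Brownian motion killed at $\partial D$, normalized so that its generator is $\Delta$ with Dirichlet boundary condition; $p_t(x,y)$, $t>0$, denotes its transition kernel (Dirichlet heat kernel). Let $\lambda_1<\lambda_2$ be the first two Dirichlet eigenvalues of $-\Delta$ on $D$. The constant $c>0$ is such that for all $t>0$ $$\max\Big\{1,\frac1c t^{-(d+2)/2}\Big\}\le e^{\lambda_1t}\sup_{x,y\in D}\frac{p_t(x,y)}{\psi(x)\psi(y)}\le1+c\,(1\wedge t)^{-(d+2)/2}e^{-(\lambda_2-\lambda_1)t}.$$ Such a constant exists by a known theorem of Ouhabaz and Wang for connected bounded $C^{1,\alpha}$-domains. The integral equation is understood trajectorywise (for fixed paths of $W$); it is the mild form of $\partial_tv=\Delta v-\frac{\kappa^2}{2}v+e^{-\kappa W_t}G(e^{\kappa W_t}v)$ on $D$ with $v(0,\cdot)=f$ and zero Dirichlet boundary condition, and its nonnegative solution is considered up to eventual blowup. *)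

(* Defs.v *)
From HB Require Import structures.
From mathcomp Require Import all_boot all_order all_algebra.
From mathcomp Require Import all_classical all_reals all_analysis.

Set Implicit Arguments.
Unset Strict Implicit.
Unset Printing Implicit Defensive.

Import Order.TTheory GRing.Theory Num.Def Num.Theory.
Import numFieldNormedType.Exports.

Local Open Scope classical_set_scope.
Local Open Scope ring_scope.

(* Row vectors carry the product sigma-algebra, generated by the coordinates
   (for R it is the Borel sigma-algebra of R^n), as n.-tuple T does. *)
Section measurable_rV.
Context {d} {T : sigmaRingType d}.
Variable n : nat.

Let coord : 'I_n -> 'rV[T]_n -> T := fun i x => x ord0 i.

Let rV_set0 : g_sigma_preimage coord set0.
Proof. exact: sigma_algebra0. Qed.

Let rV_setC A : g_sigma_preimage coord A -> g_sigma_preimage coord (~` A).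
Proof. exact: sigma_algebraC. Qed.

Let rV_bigcup (F : _^nat) : (forall i, g_sigma_preimage coord (F i)) ->
  g_sigma_preimage coord (\bigcup_i (F i)).
Proof. exact: sigma_algebra_bigcup. Qed.

HB.instance Definition _ := @isMeasurable.Build (measure_tuple_display d)
  'rV[T]_n (g_sigma_preimage coord) rV_set0 rV_setC rV_bigcup.

End measurable_rV.

Lemma measurable_coord_rV d (T : sigmaRingType d) n (i : 'I_n) :
  measurable_fun [set: 'rV[T]_n] (fun x : 'rV[T]_n => x ord0 i).
Proof.
move=> _ Y mY; rewrite setTI; apply: sub_sigma_algebra => /=.
rewrite -bigcup_seq/=; exists i => /=; first by rewrite mem_index_enum.
by exists Y => //; rewrite setTI.
Qed.


Lemma measurable_fun_rV d1 d2 (T1 : measurableType d1) (T2 : measurableType d2)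
    n (f : T1 -> 'rV[T2]_n) :
  (forall i, measurable_fun [set: T1] (fun x => f x ord0 i)) ->
  measurable_fun [set: T1] f.
Proof.
move=> mf _ A mA; rewrite setTI.
have prefS : g_sigma_preimage (fun i => (fun x : 'rV_n => x ord0 i) \o f)
    `<=` measurable.
  apply: smallest_sub; first exact: sigma_algebra_measurable.
  case: n => [|n] in f mf A mA *; first by rewrite big_ord0.
  rewrite -bigcup_mkord_ord; apply: bigcup_sub => i Ii.
  by move=> B [C mC <-]; exact: mf.
apply: prefS; rewrite g_sigma_preimage_comp.
by exists A => //; rewrite setTI.
Qed.

Section lebesgue_rV.
Context {R : realType}.

Definition cons_rV n (z : R * 'rV[R]_n) : 'rV[R]_n.+1 :=
  row_mx (z.1)%:M z.2 : 'rV[R]_(1 + n).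

Definition uncons_rV n (x : 'rV[R]_n.+1) : R * 'rV[R]_n :=
  (x ord0 ord0, rsubmx (x : 'rV[R]_(1 + n))).

Lemma measurable_cons_rV n : measurable_fun [set: R * 'rV[R]_n] (@cons_rV n).
Proof.
apply: measurable_fun_rV => i; rewrite /cons_rV.
case: (@splitP 1 n i) => j ij.
  rewrite (_ : (fun _ => _) = fst)//; apply/funext => z.
  have -> : i = @lshift 1 n j by exact/val_inj.
  by rewrite (@row_mxEl _ 1 1 n) mxE !ord1.
rewrite (_ : (fun _ => _) = (fun x : 'rV[R]_n => x ord0 j) \o snd).
  apply: measurableT_comp => //; exact: measurable_coord_rV.
apply/funext => z.
have -> : i = @rshift 1 n j by exact/val_inj.
by rewrite /= (@row_mxEr _ 1 1 n).
Qed.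

Lemma measurable_uncons_rV n :
  measurable_fun [set: 'rV[R]_n.+1] (@uncons_rV n).
Proof.
apply/measurable_fun_pairP; split; first exact: measurable_coord_rV.
apply: measurable_fun_rV => i.
rewrite (_ : (fun _ => _) = (fun x : 'rV[R]_n.+1 => x ord0 (rshift 1 i))).
  exact: measurable_coord_rV.
by apply/funext => x /=; rewrite mxE.
Qed.

Lemma cons_rVK n : cancel (@cons_rV n) (@uncons_rV n).
Proof.
move=> [a x]; rewrite /uncons_rV/cons_rV/= row_mxKr; congr pair.
transitivity (row_mx (a%:M : 'M[R]_1) x ord0 (@lshift 1 n ord0)).
  by congr fun_of_matrix; exact: val_inj.
by rewrite row_mxEl mxE.
Qed.

Section cons_measure.
Variables (n : nat) (m : {sigma_finite_measure set 'rV[R]_n -> \bar R}).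

Definition cons_measure (A : set 'rV[R]_n.+1) : \bar R :=
  pushforward (lebesgue_measure \x m)%E (@cons_rV n) A.

Let m0 : cons_measure set0 = 0%E.
Proof. by rewrite /cons_measure /pushforward preimage_set0 measure0. Qed.

Let m_ge0 A : (0 <= cons_measure A)%E.
Proof. by rewrite /cons_measure /pushforward measure_ge0. Qed.

Let m_sigma_additive : semi_sigma_additive cons_measure.
Proof.
move=> F mF tF mUF; rewrite /cons_measure /pushforward preimage_bigcup.
apply: measure_semi_sigma_additive.
- by move=> k; rewrite -[X in measurable X]setTI; exact: measurable_cons_rV.
- apply/trivIsetP => /= i j _ _ ij; rewrite -preimage_setI.
  by move/trivIsetP : tF => /(_ _ _ _ _ ij) ->//; rewrite preimage_set0.
- rewrite -preimage_bigcup -[X in measurable X]setTI.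
  exact: measurable_cons_rV.
Qed.

HB.instance Definition _ := isMeasure.Build _ _ _ cons_measure
  m0 m_ge0 m_sigma_additive.

Let m_sigma_finite : sigma_finite setT cons_measure.
Proof.
have /sigma_finiteP[F [FT ndF Foo]] := sigma_finiteT (@lebesgue_measure R).
have /sigma_finiteP[G [GT ndG Goo]] := sigma_finiteT m.
exists (fun k => @uncons_rV n @^-1` (F k `*` G k)).
  rewrite -preimage_bigcup -(preimage_setT (@uncons_rV n)); congr (_ @^-1` _).
  rewrite -setXTT FT GT predeqE => -[x y]; split.
    move=> [/= [i _ Fix] [k _ Gky]]; exists (maxn i k) => //; split.
    - by move: x Fix; exact/subsetPset/ndF/leq_maxl.
    - by move: y Gky; exact/subsetPset/ndG/leq_maxr.
  by move=> [i _ []/= ? ?]; split; exists i.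
move=> k; have [? ?] := Foo k; have [? ?] := Goo k; split.
  rewrite -[X in measurable X]setTI; apply: measurable_uncons_rV => //.
  exact: measurableX.
rewrite /cons_measure /pushforward -comp_preimage (_ : _ \o _ = id).
  by rewrite preimage_id product_measure1E// lte_mul_pinfty// ge0_fin_numE.
by apply/funext => z; rewrite /= cons_rVK.
Qed.

HB.instance Definition _ := Measure_isSigmaFinite.Build _ _ _ cons_measure
  m_sigma_finite.

End cons_measure.

Fixpoint lebesgue_rV n : {sigma_finite_measure set 'rV[R]_n -> \bar R} :=
  match n with
  | 0 => \d_(0 : 'rV[R]_0)
  | k.+1 => cons_measure (lebesgue_rV k)
  end.

End lebesgue_rV.

Section domains.
Context {R : realType} {d : nat}.
Implicit Types (D A : set 'rV[R]_d) (u g : 'rV[R]_d -> R).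

Definition partial (i : 'I_d) u : 'rV[R]_d -> R :=
  'D_(delta_mx ord0 i : 'rV[R]_d) u.

Definition has_partial (i : 'I_d) u (x : 'rV[R]_d) : Prop :=
  derivable u x (delta_mx ord0 i : 'rV[R]_d).

Definition C1_holder (alpha : R) A g : Prop :=
  (forall x, A x -> differentiable g x) /\
  exists C : R, forall i x y, A x -> A y ->
    `|partial i g x - partial i g y| <= C * `|x - y| `^ alpha.

(* Near each boundary point D is, up to the choice of the axis i and of its
   orientation, the strict epigraph of a C^{1,alpha} function g of the other
   coordinates; g is encoded as a function on R^d not depending on the i-th
   coordinate. Balls are for the sup norm, and D is open in all uses, so that
   closure D `\` D is its boundary. *)
Definition C1_holder_boundary (alpha : R) D : Prop :=
  forall z, (closure D `\` D) z ->
  exists r : R, exists i : 'I_d, exists b : bool, exists g : 'rV[R]_d -> R,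
    [/\ 0 < r,
        forall x y : 'rV[R]_d, (forall j, j != i -> x ord0 j = y ord0 j) ->
          g x = g y,
        C1_holder alpha (ball z r) g &
        forall x, ball z r x -> (D x <-> g x < (-1) ^+ b * x ord0 i)].

Definition bounded_C1_holder_domain (alpha : R) D : Prop :=
  [/\ D !=set0, open D, connected D, bounded_set D &
      C1_holder_boundary alpha D].

Definition C2_on D u : Prop :=
  forall x, D x ->
  [/\ {for x, continuous u},
      forall i, has_partial i u x /\ {for x, continuous (partial i u)} &
      forall i j, has_partial j (partial i u) x /\
                  {for x, continuous (partial j (partial i u))}].

Definition laplacian u (x : 'rV[R]_d) : R :=
  \sum_(i < d) partial i (partial i u) x.

Definition dirichlet_eigenfunction D (lam : R) u : Prop :=
  [/\ C2_on D u,
      {within closure D, continuous u},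
      forall x, (closure D `\` D) x -> u x = 0,
      forall x, D x -> - laplacian u x = lam * u x &
      exists2 x, D x & u x != 0].

Definition dirichlet_eigenvalue D (lam : R) : Prop :=
  exists u, dirichlet_eigenfunction D lam u.

Definition first_two_dirichlet_eigenvalues D (lam1 lam2 : R) : Prop :=
  [/\ dirichlet_eigenvalue D lam1, dirichlet_eigenvalue D lam2, lam1 < lam2 &
      forall mu, dirichlet_eigenvalue D mu -> mu = lam1 \/ lam2 <= mu].

End domains.

Section brownian_motion.
Context {R : realType} {dO : measure_display} {Omega : measurableType dO}.
Variable P : probability Omega R.

(* Subfamilies are covered by taking A i = setT for the other indices. *)
Definition mutually_independent (I : finType) (X : I -> Omega -> R) : Prop :=
  forall A : I -> set R, (forall i, measurable (A i)) ->
    P (\bigcap_(i in [set: I]) (X i @^-1` A i)) =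
    (\prod_(i : I) P (X i @^-1` A i))%E.

(* Standard d-dimensional Brownian motion started at 0, with every path
   continuous. Joint independence of the increments over both coordinates and
   consecutive time intervals says at once that increments are independent and
   that their coordinates are. *)
Definition brownian_motion (d : nat) (B : R -> Omega -> 'rV[R]_d) : Prop :=
  [/\ forall t : R, 0 <= t -> measurable_fun [set: Omega] (B t),
      forall w, B 0 w = 0,
      forall w, {within `[0, +oo[%classic, continuous (fun t => B t w)},
      forall (i : 'I_d) (s t : R) (A : set R), 0 <= s -> s < t -> measurable A ->
        P [set w | A ((B t w - B s w) ord0 i)] =
        normal_prob 0 (Num.sqrt (t - s)) A &
      forall (n : nat) (t : nat -> R), 0 <= t 0%N ->
        (forall k, t k < t k.+1) ->
        mutually_independent (fun (ik : 'I_d * 'I_n) w =>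
          (B (t ik.2.+1) w - B (t ik.2) w) ord0 ik.1)].

Context {d : nat}.
Variables (B : R -> Omega -> 'rV[R]_d) (D : set 'rV[R]_d).

(* The factor sqrt 2 makes the generator Delta instead of Delta / 2. *)
Definition position (x : 'rV[R]_d) (t : R) (w : Omega) : 'rV[R]_d :=
  x + Num.sqrt 2 *: B t w.

(* The event that the motion started at x is not yet killed at time t. *)
Definition alive (x : 'rV[R]_d) (t : R) : set Omega :=
  [set w | forall s : R, 0 <= s <= t -> D (position x s w)].

(* Used for u >= 0 on D only, whence the value in [0, +oo]. *)
Definition killed_semigroup (t : R) (u : 'rV[R]_d -> R) (x : 'rV[R]_d) :
    \bar R :=
  (\int[P]_(w in alive x t) (u (position x t w))%:E)%E.

(* Densities are only determined almost everywhere: p is the jointly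
   continuous version. *)
Definition dirichlet_heat_kernel
    (p : R -> 'rV[R]_d -> 'rV[R]_d -> R) : Prop :=
  [/\ forall (t : R) x y, 0 < t -> D x -> D y -> 0 <= p t x y,
      {within [set z : R * 'rV[R]_d * 'rV[R]_d |
                [/\ 0 < z.1.1, D z.1.2 & D z.2]],
        continuous (fun z : R * 'rV[R]_d * 'rV[R]_d => p z.1.1 z.1.2 z.2)} &
      forall (t : R) x (A : set 'rV[R]_d), 0 < t -> D x -> measurable A -> A `<=` D ->
        P (alive x t `&` [set w | A (position x t w)]) =
        (\int[lebesgue_rV d]_(y in A) (p t x y)%:E)%E].

Definition heat_kernel_bound (p : R -> 'rV[R]_d -> 'rV[R]_d -> R)
    (psi : 'rV[R]_d -> R) (lam1 lam2 c : R) : Prop :=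
  forall t : R, 0 < t ->
    let M := ((expR (lam1 * t))%:E * ereal_sup
      [set r | exists x, exists y,
        [/\ D x, D y & r = (p t x y / (psi x * psi y))%:E]])%E in
    ((Num.max 1 (c^-1 * t `^ (- (d%:R + 2) / 2)))%:E <= M)%E /\
    (M <= (1 + c * (Num.min 1 t) `^ (- (d%:R + 2) / 2) *
             expR (- (lam2 - lam1) * t))%:E)%E.

(* Nonnegative solution of the mild equation on [0, T) x D, with 0 < T <= +oo,
   bounded on [0, s] x D for every s < T: a finite T past which such a solution
   cannot be continued is a blowup time. W is a fixed real path. *)
Definition mild_solution (kappa : R) (G : R -> R) (W : R -> R)
    (f : 'rV[R]_d -> R) (T : \bar R) (v : R -> 'rV[R]_d -> R) : Prop :=
  [/\ forall (t : R) x, 0 <= t -> (t%:E < T)%E -> D x -> 0 <= v t x,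
      measurable_fun [set z : R * 'rV[R]_d |
          [/\ 0 <= z.1, (z.1%:E < T)%E & D z.2]]
        (fun z : R * 'rV[R]_d => v z.1 z.2),
      forall s : R, (s%:E < T)%E ->
        exists C : R, forall (t : R) x, 0 <= t <= s -> D x -> v t x <= C &
      forall (t : R) x, 0 <= t -> (t%:E < T)%E -> D x ->
        (v t x)%:E =
        ((expR (- (kappa ^+ 2 * t / 2)))%:E * killed_semigroup t f x +
         \int[lebesgue_measure]_(r in `[0%R, t])
           ((expR (- (kappa ^+ 2 * (t - r) / 2)))%:E *
            killed_semigroup (t - r)
              (fun y => expR (- kappa * W r) * G (expR (kappa * W r) * v r y))%R
              x))%E].

End brownian_motion.

(* Main.v *)
From HB Require Import structures.
Require Import Defs.
From mathcomp Require Import all_boot all_order all_algebra.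
From mathcomp Require Import all_classical all_reals all_analysis.
From mathcomp Require Import measurable_realfun ring lra.

Import Order.TTheory GRing.Theory Num.Def Num.Theory.
Import numFieldNormedType.Exports.

(** The solution is compared with an explicit supersolution.

    Write m = lam1 + kappa^2 / 2. As psi is a positive eigenfunction,
    S_t psi <= exp (- lam1 t) psi on D, so that exp (- m t) psi is a
    supersolution of the linear part of the equation. Insert
    phi(t) A exp (- m t) psi into the whole equation, bound G z by
    Lambda z^(1 + beta), and bound the excess factor psi^beta by (sup psi)^beta:
    what remains to be satisfied is the Bernoulli equation

      phi' = c0 rho phi^(1 + beta),  phi(0) = 1,
      rho(r) = exp (kappa beta W_r - m beta r),  c0 = Lambda (A sup psi)^beta.

    Its solution (1 - beta c0 int_0^t rho)^(- 1 / beta) exists for all times and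
    is bounded as soon as beta c0 int_0^oo rho < 1. With A = K exp (- lam1 eta)
    the initial datum is below A psi, because f <= K S_eta psi <= A psi, and the
    condition on the path makes the integral small enough:
    1 = int psi^2 <= sup psi int psi shows that sup psi is at most
    (1 + c) (sup psi)^2 int psi ([noise_threshold]). This is the [barrier]; that
    it is a supersolution is [barrier_supersolution]. As G is nondecreasing, the
    Picard iterates started at 0 increase; they stay below the barrier, and their
    limit is a global solution ([picard_limit_mild_solution]).

    A solution on [0, T) is bounded on the shorter intervals, where G is
    Lipschitz with some constant L. In the norm weighted by exp (- 2 L t) the
    right-hand side of the equation is then a contraction ([mild_contraction]),
    so that a solution on [0, T) coincides with the global one.

    The decay of S_t psi ([killed_semigroup_decay]) is obtained by discretizing
    time. Let psi_n be psi truncated to the n-th set of an exhaustion of D by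
    compact sets. Taylor's formula and the moments of the Brownian increments
    give E psi_n (y + sqrt 2 dB) <= psi y + h (Laplacian psi) y + o(h) for y in
    that set ([one_step]), and the right-hand side is (1 - lam1 h + o(h)) psi y.
    By independence of the increments this estimate can be iterated along a grid
    of times ([survival_step], [discrete_decay]) for the paths that remain in the
    compact set; then h tends to 0 and n to infinity. *)

Set Implicit Arguments.
Unset Strict Implicit.
Unset Printing Implicit Defensive.

Local Open Scope classical_set_scope.
Local Open Scope ring_scope.


(** * Borel sets and exhaustions of open sets in R^d *)

Section rV_borel.
Context {R : realType} {d : nat}.
Implicit Types (x y : 'rV[R]_d) (A D : set 'rV[R]_d).

(** The condition 0 < e is only a separate one when d = 0. *)
Lemma ball_rVP x y e :
  ball x e y <-> 0 < e /\ forall j, `|x ord0 j - y ord0 j| < e.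
Proof.
split=> [[e0 xy]|[e0 xy]]; split=> //; first by move=> j; exact: xy.
by move=> i j; rewrite ord1; exact: xy.
Qed.

Lemma measurable_ball_rV x e : measurable (ball x e).
Proof.
have [e0|e0] := ltP 0 e; last first.
  rewrite (_ : ball x e = set0)//; apply/seteqP; split=> // y.
  by move=> /ball_rVP[]; rewrite ltNge e0.
rewrite (_ : ball x e = \bigcap_(j in [set: 'I_d])
    ((fun y : 'rV[R]_d => y ord0 j) @^-1` [set r | `|x ord0 j - r| < e])).
  apply: fin_bigcap_measurable => // j _; rewrite -[X in measurable X]setTI.
  apply: measurable_coord_rV => //; apply: open_measurable.
  have -> : [set r | `|x ord0 j - r| < e] = ball (x ord0 j) e by [].
  exact: ball_open.
apply/seteqP; split=> y; first by move=> /ball_rVP[_ h] j _; exact: h.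
by move=> h; apply/ball_rVP; split=> // j; exact: (h j).
Qed.

(** The balls with rational centres and radii form a countable base of the
    topology, so that the product sigma-algebra contains all open sets. *)
Lemma open_measurable_rV A : open A -> measurable A.
Proof.
move=> oA.
pose c (q : 'rV[rat]_d) : 'rV[R]_d := map_mx ratr q.
pose F (p : 'rV[rat]_d * nat) : set 'rV[R]_d :=
  if `[< ball (c p.1) p.2.+1%:R^-1 `<=` A >] then
    ball (c p.1) p.2.+1%:R^-1 else set0.
rewrite (_ : A = \bigcup_p F p).
  apply: countable_bigcupT_measurable => //.
  by move=> p; rewrite /F; case: asboolP => // _; exact: measurable_ball_rV.
apply/seteqP; split=> [x Ax|x [p _]]; last first.
  by rewrite /F; case: asboolP => // FA /FA.
have /nbhs_ballP[e /= e0 xeA] : nbhs x A by apply: open_nbhs_nbhs; split.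
have e2 : 0 < e / 2 by rewrite divr_gt0.
have [n _ /= ne] := near_infty_natSinv_lt (PosNum e2).
have n0 : 0 < n.+1%:R^-1 :> R by rewrite invr_gt0.
have qx j : exists q : rat, `|ratr q - x ord0 j| < n.+1%:R^-1.
  have /rat_in_itvoo[q] : x ord0 j < x ord0 j + n.+1%:R^-1 by rewrite ltrDl.
  rewrite in_itv/= => /andP[q1 q2]; exists q.
  by rewrite ger0_norm ?subr_ge0 1?ltW// ltrBlDl.
have [g gx] := choice qx.
have cx : ball (c (\row_j g j)) n.+1%:R^-1 x.
  by apply/ball_rVP; split=> // j; rewrite !mxE.
exists (\row_j g j, n) => //; rewrite /F; case: asboolP => //=; apply.
move=> y cy; apply: xeA; apply: (@le_ball _ _ _ (n.+1%:R^-1 + n.+1%:R^-1)).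
  by rewrite [leRHS]splitr lerD// ltW// ne/=.
by apply: ball_triangle cy; exact: ball_sym.
Qed.

Lemma closed_measurable_rV A : closed A -> measurable A.
Proof.
move=> cA; rewrite -(setCK A); apply: measurableC.
by apply: open_measurable_rV; exact: closed_openC.
Qed.

Lemma continuous_at_measurable_rV A (g : 'rV[R]_d -> R) :
  open A -> (forall x, A x -> {for x, continuous g}) -> measurable_fun A g.
Proof.
move=> oA cg mA; apply: (measurability _ (RGenOpens.measurableE R)) => //.
move=> _ [_ [a [b ->]] <-]; apply: open_measurable_rV.
rewrite openE => x [Ax /= xab].
apply: filterI; first by apply: open_nbhs_nbhs; split.
by apply: cg => //; apply: open_nbhs_nbhs; split => //; exact: interval_open.
Qed.

(** When D is open and bounded, an exhaustion of D by compact sets. *)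
Definition inner D (n : nat) : set 'rV[R]_d :=
  [set x | ball x n.+1%:R^-1 `<=` D].

Lemma inner_sub D n : inner D n `<=` D.
Proof. by move=> x; apply; apply: ballxx; rewrite invr_gt0. Qed.

Lemma inner_mono D m n : (m <= n)%N -> inner D m `<=` inner D n.
Proof.
move=> mn x h y xy; apply: h; apply: le_ball xy.
by rewrite lef_pV2 ?posrE// ler_nat.
Qed.

Lemma closed_inner D n : closed (inner D n).
Proof.
rewrite -(setCK (inner D n)); apply: open_closedC; rewrite openE => x /=.
move=> /existsNP[y /not_implyP[/ball_sym xy Dy]].
have /nbhs_ballP[e e0 h] : nbhs x (ball y n.+1%:R^-1).
  by apply: open_nbhs_nbhs; split=> //; exact: ball_open.
apply/nbhs_ballP; exists e => // z /h /ball_sym yz /(_ _ yz); exact: Dy.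
Qed.

Lemma near_inner D x : open D -> D x ->
  \forall y \near x & n \near \oo, inner D n y.
Proof.
move=> oD Dx.
have /nbhs_ballP[e /= e0 xeD] : nbhs x D by apply: open_nbhs_nbhs; split.
have e2 : 0 < e / 2 by rewrite divr_gt0.
exists (ball x (e / 2), [set n | n.+1%:R^-1 < e / 2]) => /=.
  split; first exact: nbhsx_ballx.
  exact: (near_infty_natSinv_lt (PosNum e2)).
move=> [y n] [/= xy ne] z yz; apply: xeD.
apply: (@le_ball _ _ _ (e / 2 + n.+1%:R^-1)).
  by rewrite [leRHS]splitr lerD2l ltW.
exact: ball_triangle yz.
Qed.

Lemma compact_sub_inner D A : open D -> compact A -> A `<=` D ->
  \forall n \near \oo, A `<=` inner D n.
Proof.
move=> oD /compact_near_coveringP cA AD.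
by apply: cA => x Ax; exact: near_inner (AD _ Ax).
Qed.

Lemma coord_le_norm x j : `|x ord0 j| <= `|x|.
Proof.
rewrite [leRHS]/Num.norm/= mx_normrE.
exact: (le_bigmax _ (fun ij : 'I_1 * 'I_d => `|x ij.1 ij.2|) (ord0, j)).
Qed.

Lemma bounded_rVP A : bounded_set A ->
  exists2 M : R, 0 < M & forall x j, A x -> `|x ord0 j| <= M.
Proof.
move=> /pinfty_ex_gt0[M M0 AM]; exists M => // x j Ax.
by apply: le_trans (AM _ Ax); exact: coord_le_norm.
Qed.

Lemma compact_inner D n : bounded_set D -> compact (inner D n).
Proof.
move=> bD; apply: bounded_closed_compact; last exact: closed_inner.
by move: bD => [M [Mr DM]]; exists M; split=> // r /DM {}DM x /inner_sub /DM.
Qed.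

End rV_borel.

(** * Joint measurability of the killed semigroup *)

Section caratheodory.
Context {R : realType} d (Z : measurableType d).

Let grid (n : nat) (t : R) : R := (Num.floor (n.+1%:R * t))%:~R / n.+1%:R.

Let cvg_grid (t : R) : grid n t @[n --> \oo] --> t.
Proof.
apply/cvgrPdist_lt => e e0; have := near_infty_natSinv_lt (PosNum e0).
apply: filterS => n /=; apply: le_lt_trans.
have n0 : 0 < n.+1%:R :> R by rewrite ltr0n.
rewrite -(ler_pM2l n0) divff ?gt_eqF// -{1}(gtr0_norm n0) -normrM mulrBr.
rewrite /grid mulrCA divff ?gt_eqF// mulr1 ger0_norm ?subr_ge0 ?ge_floor//.
by rewrite lerBlDl -intrD1 ltW// lt_succ_floor.
Qed.

(** A function measurable in its second variable and continuous in the first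
    is the limit of its discretizations in the first variable. *)
Lemma measurable_fun_caratheodory (f : R -> Z -> R) :
  (forall t, measurable_fun setT (f t)) -> (forall z, continuous (f ^~ z)) ->
  measurable_fun setT (fun p : R * Z => f p.1 p.2).
Proof.
move=> mf cf.
apply: (measurable_fun_cvg (h := fun n (p : R * Z) => f (grid n p.1) p.2)).
  move=> n _ Y mY; rewrite setTI.
  rewrite (_ : _ @^-1` Y = \bigcup_(k : int)
      ([set p : R * Z | Num.floor (n.+1%:R * p.1) = k] `&`
       snd @^-1` ((f (k%:~R / n.+1%:R)) @^-1` Y))).
    apply: countable_bigcupT_measurable => // k; apply: measurableI.
      rewrite (_ : [set _ | _] =
          fst @^-1` ((fun t : R => n.+1%:R * t) @^-1` `[k%:~R, (k + 1)%:~R[)).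
        rewrite -[X in measurable X]setTI; apply: measurable_fst => //.
        rewrite -[X in measurable X]setTI.
        by apply: mulrl_measurable => //; exact: measurable_itv.
      apply/seteqP; split => p /=; rewrite in_itv/=.
        by move=> <-; rewrite ge_floor lt_succ_floor.
      by move=> h; exact: floor_def.
    rewrite -[X in measurable X]setTI; apply: measurable_snd => //.
    by rewrite -[X in measurable X]setTI; exact: mf.
  apply/seteqP; split => [p /= h|p [k _ [/= <-]]//].
  by exists (Num.floor (n.+1%:R * p.1)).
move=> p _; apply: (cvg_comp (grid ^~ p.1) (f ^~ p.2)); first exact: cvg_grid.
exact: cf.
Qed.

End caratheodory.

(** Functions of time known on [0, +oo[ only are extended to the whole line by
    their value at 0, so that continuity and measurability can be used
    globally. *)
Lemma continuous_comp_max0 {R : realType} (T : topologicalType) (f : R -> T) :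
  {within `[0, +oo[%classic, continuous f} ->
  continuous (fun s : R => f (Num.max 0 s)).
Proof.
move=> cf x U /= fU.
have x0 : `[0, +oo[%classic (Num.max 0 x).
  by rewrite /= in_itv/= andbT le_max lexx.
have h : within `[0, +oo[%classic (nbhs (Num.max 0 x)) (f @^-1` U).
  by rewrite nbhs_subspace_in//; exact: cf.
have cm : continuous (Num.max 0 : R -> R).
  move=> y; apply: (@continuous_max _ _ (cst 0) idfun).
    exact: cvg_cst.
  exact: cvg_id.
have : nbhs x (Num.max 0 @^-1` [set y | `[0, +oo[%classic y -> U (f y)]).
  exact: (cm x _ h).
apply: filterS => s /=; apply.
by rewrite in_itv/= andbT le_max lexx.
Qed.

Section killed.
Context {R : realType} {dO : measure_display} {Omega : measurableType dO}.
Context {d : nat}.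
Variables (P : probability Omega R) (B : R -> Omega -> 'rV[R]_d).
Variable D : set 'rV[R]_d.
Hypothesis bmB : brownian_motion P B.
Hypothesis oD : open D.

Lemma continuous_position x w :
  continuous (fun s : R => position B x (Num.max 0 s) w).
Proof.
have [_ _ cB _ _] := bmB; have := continuous_comp_max0 (cB w) => {}cB s.
by apply: cvgD; [exact: cvg_cst|apply: cvgZr; exact: cB].
Qed.

(** Paths are continuous, whence joint measurability in time and path. *)
Lemma measurable_position : measurable_fun setT
  (fun z : 'rV[R]_d * (R * Omega) => position B z.1 (Num.max 0 z.2.1) z.2.2).
Proof.
have [mB _ cB _ _] := bmB.
apply: measurable_fun_rV => i; rewrite /position.
rewrite (_ : (fun _ => _) = (fun z : 'rV[R]_d * (R * Omega) =>
  z.1 ord0 i + Num.sqrt 2 * (B (Num.max 0 z.2.1) z.2.2) ord0 i)); last first.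
  by apply/funext => z; rewrite !mxE.
apply: measurable_funD.
  exact: (measurableT_comp (measurable_coord_rV i) measurable_fst).
apply: measurable_funM => //.
apply: (measurableT_comp
  (f := fun p : R * Omega => B (Num.max 0 p.1) p.2 ord0 i)
  _ measurable_snd).
apply: (measurable_fun_caratheodory
  (f := fun t w => B (Num.max 0 t) w ord0 i)).
  move=> t; apply: (measurableT_comp (measurable_coord_rV i)).
  by apply: mB; rewrite le_max lexx.
move=> w; have := continuous_comp_max0 (cB w) => {}cB s.
apply: (@continuous_comp _ _ _ (fun s : R => B (Num.max 0 s) w)
  (fun v : 'rV[R]_d => v ord0 i)); first exact: cB.
exact: coord_continuous.
Qed.

(** A path that stays in the open set D up to time t stays in one of the sets
    exhausting D, by compactness; as these are closed, rational times
    decide. *)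
Lemma aliveP x (t : R) w : 0 <= t -> alive B D x t w <->
  exists n, forall q : rat, 0 <= (ratr q : R) <= 1 ->
    inner D n (position B x (Num.max 0 (ratr q * t)) w).
Proof.
move=> t0; pose g s := position B x (Num.max 0 (s * t)) w.
have cg : continuous g.
  move=> s; apply: (@continuous_comp _ _ _ (fun s : R => s * t)
    (fun s => position B x (Num.max 0 s) w)); first exact: mulrr_continuous.
  exact: continuous_position.
have gE s : 0 <= s -> g s = position B x (s * t) w.
  by move=> s0; rewrite /g max_r// mulr_ge0.
split=> [al|[n al] s /andP[s0 st]].
  have cK : compact (g @` `[0, 1]).
    apply: continuous_compact; last exact: segment_compact.
    exact: continuous_subspaceT.
  have KD : g @` `[0, 1] `<=` D.
    move=> _ [s /= + <-]; rewrite in_itv/= => /andP[s0 s1].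
    by rewrite gE//; apply: al; rewrite mulr_ge0//= ler_piMl.
  have [n _ nK] := compact_sub_inner oD cK KD.
  exists n => q q01; apply: (nK n); first exact: leqnn.
  by exists (ratr q) => //=; rewrite in_itv.
have [u [u0 u1 us]] : exists u, [/\ 0 <= u, u <= 1 & s = u * t].
  move: t0; rewrite le_eqVlt => /predU1P[t0|t0].
    exists 0; rewrite lexx ler01 mul0r; split => //; apply/eqP.
    by rewrite eq_le s0 t0 st.
  exists (s / t); rewrite divr_ge0 ?(ltW t0)// ler_pdivrMr// mul1r st divfK//.
  by rewrite gt_eqF.
rewrite us -gE//; apply: (@inner_sub _ _ _ n); apply: contrapT => gu.
have oC : open (~` inner D n) by apply: closed_openC; exact: closed_inner.
have /nbhs_ballP[e /= e0 eU] : nbhs u (g @^-1` (~` inner D n)).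
  by apply: cg; apply: open_nbhs_nbhs; split.
have [q] : exists q : rat, ratr q \in `](Num.max 0 (u - e)), (Num.min 1 (u + e))[.
  by apply: rat_in_itvoo; rewrite gt_max !lt_min; apply/andP; split;
    apply/andP; split; lra.
rewrite in_itv/= gt_max lt_min => /andP[/andP[q0 q1] /andP[q2 q3]].
apply: (eU (ratr q)); last by apply: al; rewrite !ltW.
by rewrite /ball/= ltr_distlC; apply/andP; split; lra.
Qed.

Definition alive_graph : set ('rV[R]_d * (R * Omega)) :=
  [set z | alive B D z.1 (Num.max 0 z.2.1) z.2.2].

(** Joint measurability in the starting point, the time and the path is what
    Tonelli's theorem needs in [measurable_killed_semigroup]. *)
Lemma measurable_alive_graph : measurable alive_graph.
Proof.
rewrite (_ : alive_graph = \bigcup_n \bigcap_(q in [set q : rat |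
      0 <= (ratr q : R) <= 1])
    ((fun z : 'rV[R]_d * (R * Omega) =>
       position B z.1 (Num.max 0 (ratr q * Num.max 0 z.2.1)) z.2.2) @^-1`
     (inner D n))).
  apply: bigcup_measurable => n _.
  rewrite -[X in measurable X]setCK setC_bigcap bigcup_mkcond.
  apply: measurableC; apply: bigcupT_measurable_rat => q; case: ifP => // _.
  apply: measurableC.
  rewrite -[X in measurable X]setTI.
  apply: (measurableT_comp (f := fun z : 'rV[R]_d * (R * Omega) =>
     position B z.1 (Num.max 0 z.2.1) z.2.2)
    (g := fun z : 'rV[R]_d * (R * Omega) =>
     (z.1, (ratr q * Num.max 0 z.2.1, z.2.2)))) => //.
  - exact: measurable_position.
  - apply: measurable_fun_pair => //; apply: measurable_fun_pair.
      apply: measurable_funM => //; apply: measurable_maxr => //.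
      exact: (measurableT_comp measurable_fst measurable_snd).
    exact: (measurableT_comp measurable_snd measurable_snd).
  - by apply: closed_measurable_rV; exact: closed_inner.
apply/seteqP; split => [[x [t w]]|[x [t w]] [n _ h]]; rewrite /alive_graph/=.
  move/aliveP => [|n h]; first by rewrite le_max lexx.
  by exists n => // q; exact: h.
apply/aliveP; first by rewrite le_max lexx.
by exists n => q q01; exact: (h q).
Qed.

Lemma measurable_alive x t : 0 <= t -> measurable (alive B D x t).
Proof.
move=> t0; rewrite (_ : alive B D x t =
    (fun w => (x, (t, w))) @^-1` alive_graph).
  rewrite -[X in measurable X]setTI.
  have mp : measurable_fun setT (fun w : Omega => (x, (t, w))).
    by apply: measurable_fun_pair => //; exact: measurable_fun_pair.
  by apply: mp => //; exact: measurable_alive_graph.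
by apply/seteqP; split=> w; rewrite /alive_graph/= max_r.
Qed.

Lemma measurable_position_at x t : 0 <= t ->
  measurable_fun setT (position B x t).
Proof.
move=> t0; rewrite (_ : position B x t = (fun z : 'rV[R]_d * (R * Omega) =>
  position B z.1 (Num.max 0 z.2.1) z.2.2) \o (fun w => (x, (t, w)))).
  apply: measurableT_comp; first exact: measurable_position.
  by apply: measurable_fun_pair => //; exact: measurable_fun_pair.
by apply/funext => w /=; rewrite max_r.
Qed.

Lemma alive_position x t w : 0 <= t -> alive B D x t w ->
  D (position B x t w).
Proof. by move=> t0; apply; rewrite t0 lexx. Qed.

Lemma measurable_alive_fun x t (u : 'rV[R]_d -> R) : 0 <= t ->
  measurable_fun D u ->
  measurable_fun (alive B D x t) (fun w => (u (position B x t w))%:E).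
Proof.
move=> t0 mu; apply/measurable_EFinP.
apply: (measurable_comp (F := D)) => //.
- exact: open_measurable_rV.
- by move=> _ [w aw <-]; exact: alive_position.
- by apply: measurable_funTS; exact: measurable_position_at.
Qed.

(** By Tonelli's theorem on the product of the parameter space with Omega. *)
Lemma measurable_killed_semigroup d' (Z : measurableType d')
    (xi : Z -> 'rV[R]_d) (tau : Z -> R) (u : Z -> 'rV[R]_d -> R) :
  measurable_fun setT xi -> measurable_fun setT tau ->
  measurable_fun setT (fun p : Z * 'rV[R]_d => u p.1 p.2) ->
  (forall z x, 0 <= u z x) ->
  measurable_fun setT
    (fun z => killed_semigroup P B D (Num.max 0 (tau z)) (u z) (xi z)).
Proof.
move=> mxi mtau mu u0.
pose G (p : Z * Omega) := (xi p.1, (tau p.1, p.2)).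
have mG : measurable_fun setT G.
  apply: measurable_fun_pair; first exact: measurableT_comp.
  by apply: measurable_fun_pair => //; exact: measurableT_comp.
pose F (p : Z * Omega) : \bar R :=
  ((fun p => (u p.1 (position B (xi p.1) (Num.max 0 (tau p.1)) p.2))%:E)
    \_ (G @^-1` alive_graph)) p.
have mF : measurable_fun setT F.
  apply/(measurable_restrictT _ _).1.
    rewrite -[X in measurable X]setTI; apply: mG => //.
    exact: measurable_alive_graph.
  apply: measurable_funTS; apply/measurable_EFinP.
  apply: (measurableT_comp (f := fun p : Z * 'rV[R]_d => u p.1 p.2)
    (g := fun p => (p.1, position B (xi p.1) (Num.max 0 (tau p.1)) p.2))) => //.
  apply: measurable_fun_pair => //.
  exact: (measurableT_comp measurable_position mG).
have F0 p : (0 <= F p)%E.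
  by rewrite /F patchE; case: ifPn => // _; rewrite lee_fin.
have := measurable_fun_fubini_tonelli_F (m2 := P) F mF F0.
congr (measurable_fun _ _); apply/funext => z.
rewrite /killed_semigroup integral_mkcond; apply: eq_integral => w _.
rewrite /F !patchE; congr (if _ then _ else _).
Qed.

End killed.

(** * Independent pairs and Gaussian moments *)

Section independent_pair.
Context {R : realType} d d1 d2 (Omega : measurableType d)
  (T1 : measurableType d1) (T2 : measurableType d2).
Variable P : probability Omega R.

(** The joint law of two independent variables is the product of their laws;
    then Tonelli. *)
Lemma ge0_integral_indep (Y1 : Omega -> T1) (Y2 : Omega -> T2)
    (f : T1 * T2 -> \bar R) :
  measurable_fun setT Y1 -> measurable_fun setT Y2 ->
  (forall A1 A2, measurable A1 -> measurable A2 ->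
    P (Y1 @^-1` A1 `&` Y2 @^-1` A2) = (P (Y1 @^-1` A1) * P (Y2 @^-1` A2))%E) ->
  measurable_fun setT f -> (forall z, (0 <= f z)%E) ->
  (\int[P]_w f (Y1 w, Y2 w) = \int[P]_w1 \int[P]_w2 f (Y1 w1, Y2 w2))%E.
Proof.
move=> mY1 mY2 ind mf f0.
pose X1 : {mfun Omega >-> T1} :=
  HB.pack Y1 (isMeasurableFun.Build _ _ _ _ _ mY1).
pose X2 : {mfun Omega >-> T2} :=
  HB.pack Y2 (isMeasurableFun.Build _ _ _ _ _ mY2).
have mY : measurable_fun setT (fun w => (Y1 w, Y2 w)).
  exact: measurable_fun_pair.
pose X : {mfun Omega >-> (T1 * T2)%type} :=
  HB.pack (fun w => (Y1 w, Y2 w)) (isMeasurableFun.Build _ _ _ _ _ mY).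
transitivity (\int[distribution P X]_z f z)%E.
  by rewrite ge0_integral_distribution.
transitivity (\int[(distribution P X1 \x distribution P X2)%E]_z f z)%E.
  apply: eq_measure_integral => A mA _; apply/esym.
  by apply: product_measure_unique => //= A1 A2 mA1 mA2; exact: ind.
rewrite fubini_tonelli1// ge0_integral_distribution//; last 2 first.
- exact: measurable_fun_fubini_tonelli_F.
- by move=> y; exact: integral_ge0.
apply: eq_integral => w1 _ /=; rewrite /fubini_F ge0_integral_distribution//.
exact: measurable_fun_pair2.
Qed.

End independent_pair.

Section expR_bounds.
Context {R : realType}.
Implicit Types x y t : R.

Lemma exprn_le_expR n x :
  `|x| ^+ n.+1 <= n.+1`!%:R * (expR x + expR (- x)).
Proof.
have h y : 0 <= y -> y ^+ n.+1 <= n.+1`!%:R * expR y.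
  move=> y0; rewrite mulrC -ler_pdivrMr ?ltr0n ?fact_gt0//.
  by apply: le_trans (expR_ge1Dxn n y0); rewrite lerDr.
have [x0|x0] := leP 0 x.
  rewrite ger0_norm// (le_trans (h _ x0))// ler_wpM2l ?ler0n//.
  by rewrite lerDl expR_ge0.
have x0' : 0 <= - x by rewrite oppr_ge0 ltW.
rewrite ltr0_norm// (le_trans (h _ x0'))// ler_wpM2l ?ler0n//.
by rewrite lerDr expR_ge0.
Qed.

Lemma expR_first_order y : `|y| <= 2^-1 -> `|expR y - 1 - y| <= 2 * y ^+ 2.
Proof.
rewrite ler_norml => /andP[y1 y2]; rewrite ger0_norm; last first.
  by rewrite -addrA -opprD subr_ge0 expR_ge1Dx.
have y3 : 0 < 1 - y by lra.
have : expR y <= (1 - y)^-1.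
  rewrite -[leLHS]invrK lef_pV2 ?posrE ?invr_gt0 ?expR_gt0// -expRN.
  exact: expR_ge1Dx.
have : (1 - y)^-1 <= 1 + y + 2 * y ^+ 2.
  by rewrite -[leLHS]div1r ler_pdivrMr//; nra.
by lra.
Qed.

Lemma cvg_expR_quotient (u : R^nat) t : (forall n, 0 < u n) ->
  u n @[n --> \oo] --> (0 : R) ->
  (expR (t * u n) - 1) / u n @[n --> \oo] --> t.
Proof.
move=> u0 cu; apply/cvgrPdist_le => e e0.
have d1 : 0 < (2 * (`|t| + 1))^-1 by rewrite invr_gt0; have := normr_ge0 t; lra.
have d2 : 0 < e / (2 * t ^+ 2 + 1).
  by rewrite divr_gt0//; have := sqr_ge0 t; lra.
near=> n.
have un0 := u0 n.
have h1 : u n <= (2 * (`|t| + 1))^-1.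
  have : `|0 - u n| <= (2 * (`|t| + 1))^-1.
    by near: n; move/cvgrPdist_le : cu; apply.
  by rewrite sub0r normrN gtr0_norm.
have h2 : u n <= e / (2 * t ^+ 2 + 1).
  have : `|0 - u n| <= e / (2 * t ^+ 2 + 1).
    by near: n; move/cvgrPdist_le : cu; apply.
  by rewrite sub0r normrN gtr0_norm.
have -> : t - (expR (t * u n) - 1) / u n = - (expR (t * u n) - 1 - t * u n) / u n.
  by field; rewrite gt_eqF.
rewrite normrM normrN normfV (gtr0_norm un0) ler_pdivrMr//.
apply: (le_trans (expR_first_order _)).
  rewrite normrM (gtr0_norm un0).
  move: h1; rewrite -[leRHS]div1r ler_pdivlMr; last first.
    by have := normr_ge0 t; lra.
  by have := normr_ge0 t; nra.
move: h2; rewrite ler_pdivlMr; last by have := sqr_ge0 t; lra.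
by have := sqr_ge0 t; nra.
Unshelve. all: by end_near. Qed.

End expR_bounds.

Section normal_mgf.
Context {R : realType}.
Local Notation mu := lebesgue_measure.

Lemma ge0_integral_normal_prob (m s : R) (f : R -> \bar R) :
  measurable_fun setT f -> (forall x, (0 <= f x)%E) ->
  (\int[normal_prob m s]_x f x = \int[mu]_x (f x * (normal_pdf m s x)%:E))%E.
Proof.
move=> mf f0; have dom := @normal_prob_dominates R m s.
rewrite -(@Radon_Nikodym_SigmaFinite.change_of_variables _ _ _ _ mu dom)//.
have rni := Radon_Nikodym_SigmaFinite.f_integrable dom.
have mp : measurable_fun setT (fun x => (normal_pdf m s x)%:E).
  by apply/measurable_EFinP; exact: measurable_normal_pdf.
apply: ae_eq_integral => //.
- by apply: emeasurable_funM => //; exact: measurable_int rni.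
- exact: emeasurable_funM.
- apply: (@filterS _ _ _ (fun x => setT x ->
    Radon_Nikodym_SigmaFinite.f (normal_prob m s) mu x =
    (normal_pdf m s x)%:E)).
    by move=> x /(_ I) -> _.
  apply: integral_ae_eq => // E _ mE.
  by rewrite -Radon_Nikodym_SigmaFinite.f_integral.
Qed.

(** Completing the square moves the factor exp (l x) into the mean. *)
Lemma normal_mgf (s l : R) : s != 0 ->
  (\int[normal_prob 0 s]_x (expR (l * x))%:E = (expR (l ^+ 2 * s ^+ 2 / 2))%:E)%E.
Proof.
move=> s0; rewrite ge0_integral_normal_prob; last 2 first.
- by apply/measurable_EFinP; apply: measurableT_comp.
- by move=> x; rewrite lee_fin expR_ge0.
transitivity (\int[mu]_x ((expR (l ^+ 2 * s ^+ 2 / 2))%:E *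
    (normal_pdf (l * s ^+ 2) s x)%:E))%E.
  apply: eq_integral => x _; rewrite -!EFinM; congr EFin.
  rewrite !normal_pdfE// mulrCA [RHS]mulrCA; congr (_ * _).
  have square v : v != 0 :> R -> l * x + - (x - 0) ^+ 2 / (v * 2) =
      l ^+ 2 * v / 2 + - (x - l * v) ^+ 2 / (v * 2).
    by move=> v0; field.
  by rewrite /normal_fun -!expRD -!(mulr_natr (s ^+ 2)) square// expf_neq0.
rewrite ge0_integralZl//; last 2 first.
- by apply/measurable_EFinP; exact: measurable_normal_pdf.
- by move=> x _; rewrite lee_fin normal_pdf_ge0.
by rewrite integral_normal_pdf mule1.
Qed.

End normal_mgf.

Section gaussian.
Context {R : realType} d (Omega : measurableType d) (P : probability Omega R).
Variables (X : Omega -> R) (s : R).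
Hypothesis mX : measurable_fun setT X.
Hypothesis s_gt0 : 0 < s.
Hypothesis lawX :
  forall A, measurable A -> P (X @^-1` A) = normal_prob 0 s A.

Lemma gaussian_mgf l :
  (\int[P]_w (expR (l * X w))%:E = (expR (l ^+ 2 * s ^+ 2 / 2))%:E)%E.
Proof.
rewrite -normal_mgf ?gt_eqF//.
have mX' : @measurable_fun _ _ Omega (measurableTypeR R) setT X := mX.
pose Y : {mfun Omega >-> measurableTypeR R} :=
  HB.pack (X : Omega -> measurableTypeR R) (isMeasurableFun.Build _ _ _ _ _ mX').
transitivity (\int[distribution P Y]_x (expR (l * x))%:E)%E.
  rewrite ge0_integral_distribution => [//||x]; last first.
    by rewrite lee_fin expR_ge0.
  by apply/measurable_EFinP; apply: measurableT_comp.
by apply: eq_measure_integral => A mA _; exact: lawX.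
Qed.

Lemma integrable_gaussian_expR l :
  P.-integrable setT (fun w => (expR (l * X w))%:E).
Proof.
apply/integrableP; split.
  apply/measurable_EFinP; apply: measurableT_comp => //.
  exact: measurable_funM.
under eq_integral do rewrite gee0_abs ?lee_fin ?expR_ge0//.
by rewrite gaussian_mgf ltry.
Qed.

Lemma integrable_gaussian_cosh l :
  P.-integrable setT (fun w => (expR (l * X w) + expR (- l * X w))%:E).
Proof.
rewrite (_ : (fun _ => _) =
  ((fun w => (expR (l * X w))%:E) \+ (fun w => (expR (- l * X w))%:E))%E)//.
by apply: integrableD => //; exact: integrable_gaussian_expR.
Qed.

Lemma integrable_gaussian (f : Omega -> R) (C l : R) :
  measurable_fun setT f ->
  (forall w, `|f w| <= C * (expR (l * X w) + expR (- l * X w))) ->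
  P.-integrable setT (EFin \o f).
Proof.
move=> mf fC; apply: (@le_integrable _ _ _ _ _ _ _
  (fun w => (C%:E * (expR (l * X w) + expR (- l * X w))%:E)%E)) => //.
- exact/measurable_EFinP.
- move=> w _ /=; rewrite lee_fin (le_trans (fC w))//.
  by rewrite ger0_norm// (le_trans _ (fC w)).
- by apply: integrableZl => //; exact: integrable_gaussian_cosh.
Qed.

Lemma integrable_gaussian_exprn n :
  P.-integrable setT (fun w => (X w ^+ n.+1)%:E).
Proof.
apply: (@integrable_gaussian (fun w => X w ^+ n.+1) n.+1`!%:R 1).
  exact: measurable_funX.
by move=> w; rewrite normrX mul1r mulN1r exprn_le_expR.
Qed.

(* The first two moments are derivatives at 0 of the moment generating function,
   obtained from difference quotients: g n x = 2 sinh (a x / 2) / a, with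
   a = (n + 1)^(-1/2), tends to x, g n X has mean 0 and its square has mean
   2 (exp (a^2 s^2 / 2) - 1) / a^2. *)
Let a (n : nat) : R := Num.sqrt n.+1%:R^-1.
Let g (n : nat) (x : R) : R := (expR (x / 2 * a n) - expR (- (x / 2) * a n)) / a n.

Let a_gt0 n : 0 < a n.
Proof. by rewrite sqrtr_gt0 invr_gt0. Qed.

Let a_le1 n : a n <= 1.
Proof. by rewrite -sqrtr1 ler_sqrt// invf_le1// ler1n. Qed.

Let cvg_a : a n @[n --> \oo] --> (0 : R).
Proof.
rewrite -[X in _ --> X]sqrtr0; apply: (cvg_comp (fun n => n.+1%:R^-1) Num.sqrt).
  exact: cvg_harmonic.
exact: sqrt_continuous.
Qed.

Let cvg_g x : g n x @[n --> \oo] --> x.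
Proof.
rewrite [X in _ --> X](_ : x = x / 2 - - (x / 2)); last by field.
rewrite (_ : g ^~ x = (fun n => (expR (x / 2 * a n) - 1) / a n -
    (expR (- (x / 2) * a n) - 1) / a n)); last first.
  by apply/funext => n; rewrite /g; field; rewrite gt_eqF.
by apply: cvgB; apply: cvg_expR_quotient.
Qed.

Let g_le n x : `|g n x| <= expR (2 * `|x|).
Proof.
have h y : 0 <= y -> `|g n y| <= expR (2 * y).
  move=> y0; have e1 : expR (- (y / 2) * a n) = (expR (y / 2 * a n))^-1.
    by rewrite mulNr expRN.
  have an0 := a_gt0 n; have an1 := a_le1 n.
  have ya : 0 <= y / 2 * a n by rewrite !mulr_ge0// ltW.
  rewrite ger0_norm; last first.
    by rewrite divr_ge0 ?(ltW an0)// subr_ge0 ler_expR mulNr; lra.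
  rewrite /g ler_pdivrMr//.
  have -> : expR (y / 2 * a n) - expR (- (y / 2) * a n) =
      expR (y / 2 * a n) * (1 - expR (- (y * a n))).
    by rewrite mulrBr mulr1 -expRD; congr (_ - expR _); field.
  apply: (@le_trans _ _ (expR y * (y * a n))).
    apply: ler_pM; rewrite ?expR_ge0//.
    - by rewrite subr_ge0 -expR0 ler_expR oppr_le0 mulr_ge0// ltW.
    - by rewrite ler_expR; nra.
    - by have := expR_ge1Dx (- (y * a n)); lra.
  rewrite mulrA ler_wpM2r ?(ltW an0)//.
  have -> : expR (2 * y) = expR y * expR y by rewrite -expRD; congr expR; ring.
  rewrite ler_wpM2l ?expR_ge0//.
  by have := expR_ge1Dx y; lra.
have [x0|x0] := leP 0 x; first by rewrite (ger0_norm x0) h.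
rewrite (ltr0_norm x0) (_ : g n x = - g n (- x)) ?normrN ?h ?oppr_ge0 ?ltW//.
by rewrite /g !mulNr !opprK; ring.
Qed.

Let measurable_g n : measurable_fun setT (fun w => g n (X w)).
Proof.
apply: measurable_funM => //; apply: measurable_funB;
  apply: measurableT_comp => //; apply: measurable_funM => //.
  exact: measurable_funM.
by apply: measurableT_comp => //; exact: measurable_funM.
Qed.

Let cvg_integral_g (k : nat) :
  (\int[P]_w (g n (X w) ^+ k.+1)%:E @[n --> \oo] -->
   \int[P]_w (X w ^+ k.+1)%:E)%E.
Proof.
have mg n : measurable_fun setT (fun w => (g n (X w) ^+ k.+1)%:E).
  by apply/measurable_EFinP; exact: measurable_funX.
have mXk : measurable_fun setT (fun w => (X w ^+ k.+1)%:E).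
  by apply/measurable_EFinP; exact: measurable_funX.
have cg : {ae P, forall w, setT w ->
    (g n (X w) ^+ k.+1)%:E @[n --> \oo] --> (X w ^+ k.+1)%:E}.
  apply: aeW => w _; apply: cvg_EFin; first exact: nearW.
  apply: (cvg_comp (fun n => g n (X w)) (fun x => x ^+ k.+1)).
    exact: cvg_g.
  exact: exprn_continuous.
have dom : {ae P, forall w n, setT w -> (`|(g n (X w) ^+ k.+1)%:E| <=
    (expR ((2 * k.+1%:R) * X w) + expR (- (2 * k.+1%:R) * X w))%:E)%E}.
  apply: aeW => w n _; rewrite /= lee_fin normrX.
  apply: (@le_trans _ _ (expR (2 * `|X w|) ^+ k.+1)).
    by rewrite lerXn2r ?nnegrE ?expR_ge0// g_le.
  rewrite -expRM_natr mulrAC.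
  have [X0|X0] := leP 0 (X w).
    by rewrite ger0_norm// lerDl expR_ge0.
  by rewrite ltr0_norm// mulrN mulNr lerDr expR_ge0.
by have [_ _] := dominated_convergence measurableT mg mXk cg
  (integrable_gaussian_cosh _) dom.
Qed.

Lemma gaussian_mean : (\int[P]_w (X w)%:E = 0)%E.
Proof.
have := @cvg_integral_g 0%N.
rewrite (_ : (fun n => _) = cst 0%E).
  by move/(cvg_unique (@ereal_hausdorff R) (cvg_cst _)) => /esym.
apply/funext => n.
transitivity (\int[P]_w ((a n)^-1%:E * ((expR (a n / 2 * X w))%:E -
    (expR (- (a n / 2) * X w))%:E)))%E.
  apply: eq_integral => w _; rewrite -EFinB -EFinM expr1 /g mulrC.
  by congr (_ * (expR _ - expR _))%:E; field.
rewrite integralZl//; last first.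
  by apply: integrableB => //; exact: integrable_gaussian_expR.
rewrite integralB//; try exact: integrable_gaussian_expR.
by rewrite !gaussian_mgf sqrrN subee// mule0.
Qed.

Lemma gaussian_second_moment : (\int[P]_w (X w ^+ 2)%:E = (s ^+ 2)%:E)%E.
Proof.
have := @cvg_integral_g 1%N.
rewrite (_ : (fun n => _) = fun n =>
    (2 * ((expR (s ^+ 2 / 2 * a n ^+ 2) - 1) / a n ^+ 2))%:E).
  move=> h; apply: (cvg_unique (@ereal_hausdorff R) h).
  apply: cvg_EFin; first exact: nearW.
  rewrite [X in _ --> X](_ : _ = 2 * (s ^+ 2 / 2)); last by field.
  apply: cvgM; first exact: cvg_cst.
  apply: (@cvg_expR_quotient _ (fun n => a n ^+ 2)).
    by move=> n; rewrite exprn_gt0.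
  rewrite [X in _ --> X](_ : _ = 0 ^+ 2); last by rewrite expr0n.
  exact: (cvg_comp a (fun x => x ^+ 2) cvg_a (@exprn_continuous _ _ _)).
apply/funext => n; have an0 := a_gt0 n.
transitivity (\int[P]_w ((a n ^+ 2)^-1%:E *
    ((expR (a n * X w) + expR (- a n * X w))%:E - (cst 2 w)%:E)))%E.
  apply: eq_integral => w _; rewrite -EFinB -EFinM /g; congr EFin.
  rewrite expr_div_n mulrC; congr (_ * _).
  rewrite sqrrB -!expRM_natl -expRD.
  rewrite (_ : _ + - (X w / 2) * a n = 0) ?expR0; last by field.
  rewrite (_ : 2%:R * (X w / 2 * a n) = a n * X w); last by field.
  rewrite (_ : 2%:R * (- (X w / 2) * a n) = - a n * X w); last by field.
  by rewrite /cst; ring.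
have i2 : P.-integrable setT (fun w => (cst (2 : R) w)%:E).
  by apply: finite_measure_integrable_cst.
rewrite integralZl//; last first.
  by apply: integrableB => //; exact: integrable_gaussian_cosh.
rewrite integralB//; last exact: integrable_gaussian_cosh.
under eq_integral do rewrite EFinD.
rewrite integralD//; try exact: integrable_gaussian_expR.
have -> : (\int[P]_x (cst (2 : R) x)%:E = 2%R%:E)%E.
  transitivity (2%R%:E * P setT)%E; last by rewrite probability_setT mule1.
  exact: (@integral_cst _ _ _ P setT measurableT 2%R%:E).
rewrite !gaussian_mgf sqrrN.
rewrite -EFinN -!EFinD -EFinM; congr EFin.
rewrite (_ : a n ^+ 2 * s ^+ 2 / 2 = s ^+ 2 / 2 * a n ^+ 2); last by field.
by field; rewrite gt_eqF.
Qed.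

(** Only the order of magnitude s^4 is of interest: x^4 <= 4! (e^x + e^-x) is
    applied to x = X / s. *)
Lemma gaussian_fourth_moment :
  (\int[P]_w (X w ^+ 4)%:E <= (48 * expR (2^-1) * s ^+ 4)%:E)%E.
Proof.
apply: (@le_trans _ _ (\int[P]_w ((24 * s ^+ 4)%:E *
    (expR (s^-1 * X w) + expR (- s^-1 * X w))%:E)))%E.
  apply: ge0_le_integral => //.
  - by move=> w _; rewrite lee_fin exprn_even_ge0.
  - by apply/measurable_EFinP; exact: measurable_funX.
  - apply: emeasurable_funM => //.
    exact: measurable_int (integrable_gaussian_cosh _).
  - move=> w _; rewrite -EFinM lee_fin.
    have := exprn_le_expR 3 (s^-1 * X w).
    rewrite -normrX ger0_norm; last by rewrite exprn_even_ge0.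
    rewrite exprMn exprVn mulrC ler_pdivrMr ?exprn_gt0// mulNr.
    by rewrite mulrAC.
rewrite integralZl//; last exact: integrable_gaussian_cosh.
under eq_integral do rewrite EFinD.
rewrite integralD//; try exact: integrable_gaussian_expR.
rewrite !gaussian_mgf sqrrN -EFinD -EFinM lee_fin exprVn mulVf; last first.
  by rewrite gt_eqF// exprn_gt0.
by rewrite div1r le_eqVlt; apply/orP; left; apply/eqP; ring.
Qed.

End gaussian.

(** * Second-order Taylor expansion on compact subsets *)

Section taylor1.
Context {R : realType}.
Implicit Types (f df : R -> R) (a s t c e : R).

Definition between a t := Num.min 0 a <= t <= Num.max 0 a.

Lemma between_norm a t : between a t -> `|t| <= `|a|.
Proof.
rewrite /between; have [a0|a0] := leP 0 a.
  by move=> /andP[t0 ta]; rewrite !ger0_norm.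
by move=> /andP[t0 ta]; rewrite (ltr0_norm a0) ler0_norm// lerN2.
Qed.

Lemma between_trans a s t : between a s -> between s t -> between a t.
Proof.
rewrite /between; have [a0|a0] := leP 0 a; have [s0|s0] := leP 0 s; lra.
Qed.

Lemma MVT_between f df a :
  (forall t, between a t -> is_derive t 1 f (df t)) ->
  exists2 c, between a c & f a - f 0 = df c * a.
Proof.
rewrite /between; have [a0|a0] := leP 0 a => dfE.
  have [||c] := @MVT_segment _ f df 0 a a0.
  - by move=> x; rewrite in_itv/= => /andP[x0 x1]; apply: dfE; rewrite !ltW.
  - apply: derivable_within_continuous => x; rewrite in_itv/= => /dfE dx.
    exact: ex_derive.
  - by rewrite in_itv/= subr0 => ? ?; exists c.
have [||c] := @MVT_segment _ f df a 0 (ltW a0).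
- by move=> x; rewrite in_itv/= => /andP[x0 x1]; apply: dfE; rewrite !ltW.
- apply: derivable_within_continuous => x; rewrite in_itv/= => /dfE dx.
  exact: ex_derive.
- by rewrite in_itv/= sub0r => ? ?; exists c => //; lra.
Qed.

Lemma taylor2_between f df ddf a c e :
  (forall t, between a t -> is_derive t 1 f (df t)) ->
  (forall t, between a t -> is_derive t 1 df (ddf t)) ->
  (forall t, between a t -> `|ddf t - c| <= e) ->
  `|f a - f 0 - df 0 * a - c / 2 * a ^+ 2| <= e * a ^+ 2.
Proof.
move=> dfE ddfE hc.
pose H t := f t - (df 0 * t + c / 2 * t ^+ 2).
have dH t : between a t -> is_derive t 1 H (df t - (df 0 + c * t)).
  move=> /dfE ft; rewrite /H; apply: is_deriveB.
  apply: is_derive_eq.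
  by rewrite /GRing.scale/= !mulr1; field.
have [xi xia] := MVT_between dH.
rewrite /H !mulr0 expr0n/= mulr0 addr0 subr0 => Ha.
have [z zx dz] : exists2 z, between xi z & df xi - df 0 = ddf z * xi.
  by apply: MVT_between => t /(between_trans xia)/ddfE.
have -> : f a - f 0 - df 0 * a - c / 2 * a ^+ 2 = (ddf z - c) * xi * a.
  transitivity (f a - (df 0 * a + c / 2 * a ^+ 2) - f 0); first by ring.
  by rewrite Ha; congr (_ * a); rewrite mulrBl -dz; ring.
have a2 : a ^+ 2 = `|a| * `|a| by rewrite -expr2 real_normK// num_real.
rewrite !normrM a2 mulrA ler_wpM2r// ler_pM//.
  by apply: hc; exact: between_trans zx.
exact: between_norm.
Qed.

End taylor1.

Lemma compact_ubound {R : realType} (T : topologicalType) (K : set T)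
    (g : T -> R) : compact K -> (forall x, K x -> {for x, continuous g}) ->
  exists2 M, 0 <= M & forall x, K x -> `|g x| <= M.
Proof.
move=> /compact_near_coveringP cK cg.
have [n _ nK] : \forall n \near \oo, K `<=` [set x | `|g x| <= n%:R].
  apply: cK => x Kx.
  have cgx : \forall y \near x, `|g x - g y| < 1.
    by move/cvgrPdist_lt : (cg _ Kx); apply.
  have near_n : \forall n \near \oo, `|g x| + 1 <= n%:R by exact: nbhs_infty_ger.
  near=> y n => /=.
  apply: (@le_trans _ _ (`|g x| + 1)); last by near: n.
  have := ler_normB (g x) (g x - g y); rewrite opprB addrC subrK => /le_trans; apply.
  by rewrite lerD2l ltW//; near: y.
by exists n%:R => // x Kx; exact: (nK n (leqnn _)).
Unshelve. all: by end_near. Qed.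

Section taylor.
Context {R : realType} {d : nat}.
Implicit Types (u : 'rV[R]_d -> R) (x y z : 'rV[R]_d) (i j : 'I_d).
Local Notation e_ i := (delta_mx ord0 i : 'rV[R]_d).

Lemma is_derive_line i u x (t : R) : has_partial i u (x + t *: e_ i) ->
  is_derive t 1 (fun t => u (x + t *: e_ i)) (partial i u (x + t *: e_ i)).
Proof.
move=> du.
have E : (fun h : R => h^-1 *: (((fun t => u (x + t *: e_ i)) \o shift t) (h *: 1) -
      u (x + t *: e_ i))) =
    (fun h : R => h^-1 *: ((u \o shift (x + t *: e_ i)) (h *: e_ i) -
      u (x + t *: e_ i))).
  apply/funext => h /=; congr (_ *: (u _ - _)).
  by rewrite [h *: 1]mulr1 scalerDl addrCA addrA.
by apply: DeriveDef; rewrite /derivable /derive/= E.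
Qed.

(** The increment from y to y + z is made along the axes, one coordinate at a
    time, which reduces Taylor's formula to one variable. *)
Definition prefix y z (k : nat) : 'rV[R]_d :=
  y + \row_i (if (i < k)%N then z ord0 i else 0).

Lemma prefix0 y z : prefix y z 0 = y.
Proof. by apply/rowP => i; rewrite !mxE addr0. Qed.

Lemma prefix_full y z : prefix y z d = y + z.
Proof. by apply/rowP => i; rewrite !mxE ltn_ord. Qed.

Lemma prefixS y z (k : 'I_d) :
  prefix y z k.+1 = prefix y z k + z ord0 k *: e_ k.
Proof.
apply/rowP => i; rewrite !mxE eqxx/= ltnS leq_eqVlt -!addrA; congr (_ + _).
have [->|ik] := eqVneq i k; first by rewrite eqxx ltnn mulr1 add0r.
by rewrite (inj_eq val_inj) (negbTE ik) mulr0 addr0.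
Qed.

Lemma ball_prefix y z (k : 'I_d) (delta t : R) : 0 < delta ->
  (forall i, `|z ord0 i| < delta) -> between (z ord0 k) t ->
  ball y delta (prefix y z k + t *: e_ k).
Proof.
move=> d0 zd /between_norm tz; apply/ball_rVP; split=> // i.
rewrite !mxE eqxx/= -addrA opprD addrA subrr sub0r normrN.
have [->|ik] := eqVneq i k.
  by rewrite ltnn mulr1 add0r (le_lt_trans tz).
by rewrite mulr0 addr0; case: ifP => // _; rewrite normr0.
Qed.

Lemma sum_ord_ltS (k : 'I_d) (F : 'I_d -> R) :
  \sum_(i < d | (i < k.+1)%N) F i = \sum_(i < d | (i < k)%N) F i + F k.
Proof.
rewrite (bigD1 k) ?ltnS//= addrC; congr (_ + _); apply: eq_bigl => i.
by rewrite ltnS ltn_neqAle andbC (inj_eq val_inj).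
Qed.

Lemma sum_ord_lt0 (F : 'I_d -> R) : \sum_(i < d | (i < 0)%N) F i = 0.
Proof. by apply: big1. Qed.

Lemma sum_ord_ltd (F : 'I_d -> R) :
  \sum_(i < d | (i < d)%N) F i = \sum_(i < d) F i.
Proof. by apply: eq_bigl => i; rewrite ltn_ord. Qed.

(** The mean value theorem along each axis in turn. *)
Lemma partial_prefix_le v y z (g : 'I_d -> R) (delta e : R) : 0 < delta ->
  (forall i, `|z ord0 i| < delta) ->
  (forall j x, ball y delta x -> has_partial j v x /\ `|partial j v x - g j| <= e) ->
  forall k, (k <= d)%N ->
  `|v (prefix y z k) - v y - \sum_(j < d | (j < k)%N) g j * z ord0 j| <=
  e * \sum_(j < d | (j < k)%N) `|z ord0 j|.
Proof.
move=> d0 zd H; elim=> [|k IH] kd.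
  by rewrite prefix0 !sum_ord_lt0 !subrr normr0 mulr0.
pose K : 'I_d := Ordinal kd.
have [c cz] : exists2 c, between (z ord0 K) c &
    v (prefix y z K + z ord0 K *: e_ K) - v (prefix y z K + 0 *: e_ K) =
    partial K v (prefix y z K + c *: e_ K) * z ord0 K.
  apply: (@MVT_between _ (fun t => v (prefix y z K + t *: e_ K))
    (fun t => partial K v (prefix y z K + t *: e_ K))) => t tz.
  by apply: is_derive_line; have [] := H K _ (ball_prefix y d0 zd tz).
rewrite -prefixS scale0r addr0 => vE.
rewrite -[k.+1]/(K.+1) !sum_ord_ltS mulrDr.
have -> : v (prefix y z K.+1) - v y -
    (\sum_(i < d | (i < K)%N) g i * z ord0 i + g K * z ord0 K) =
    (v (prefix y z k) - v y - \sum_(i < d | (i < k)%N) g i * z ord0 i) +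
    (partial K v (prefix y z K + c *: e_ K) - g K) * z ord0 K.
  by rewrite mulrBl -vE/=; ring.
rewrite (le_trans (ler_normD _ _))// lerD ?IH 1?ltnW// normrM ler_wpM2r//.
by have [] := H K _ (ball_prefix y d0 zd cz).
Qed.

Definition second u i j := partial j (partial i u).

(** The Taylor polynomial of degree 2, without its constant term; each mixed
    term occurs once because the coordinates are moved one after the other. *)
Definition taylor_poly u y z : R :=
  \sum_(i < d) (partial i u y * z ord0 i + second u i i y / 2 * z ord0 i ^+ 2 +
    (\sum_(j < d | (j < i)%N) second u i j y * z ord0 j) * z ord0 i).

(** The move along the i-th axis is expanded to second order by
    [taylor2_between]; the first derivative met there differs from the one at y
    because of the earlier moves, and [partial_prefix_le] expands it to first
    order. *)
Lemma taylor_local u y z (delta e : R) : 0 < delta -> 0 <= e ->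
  (forall i, `|z ord0 i| < delta) ->
  (forall x, ball y delta x -> forall i, has_partial i u x /\
     forall j, has_partial j (partial i u) x /\
       `|second u i j x - second u i j y| <= e) ->
  `|u (y + z) - u y - taylor_poly u y z| <=
    e * d.+1%:R * \sum_(i < d) z ord0 i ^+ 2.
Proof.
move=> d0 e0 zd H.
pose T i := partial i u y * z ord0 i + second u i i y / 2 * z ord0 i ^+ 2 +
    (\sum_(j < d | (j < i)%N) second u i j y * z ord0 j) * z ord0 i.
pose E i := e * (z ord0 i ^+ 2 + `|z ord0 i| * \sum_(j < d | (j < i)%N) `|z ord0 j|).
have M k : (k <= d)%N ->
    `|u (prefix y z k) - u y - \sum_(i < d | (i < k)%N) T i| <=
    \sum_(i < d | (i < k)%N) E i.
  elim: k => [|k IH] kd; first by rewrite prefix0 !sum_ord_lt0 !subrr normr0.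
  pose K : 'I_d := Ordinal kd.
  have t2 := @taylor2_between _ (fun t => u (prefix y z K + t *: e_ K))
    (fun t => partial K u (prefix y z K + t *: e_ K))
    (fun t => second u K K (prefix y z K + t *: e_ K)) (z ord0 K)
    (second u K K y) e.
  have {}t2 : `|u (prefix y z K.+1) - u (prefix y z K) -
      partial K u (prefix y z K) * z ord0 K -
      second u K K y / 2 * z ord0 K ^+ 2| <= e * z ord0 K ^+ 2.
    have p0 : prefix y z K + 0 *: e_ K = prefix y z K.
      by rewrite scale0r addr0.
    rewrite p0 -prefixS in t2; apply: t2 => t tz;
      have [h1 /(_ K)[h2 h3]] := H _ (ball_prefix y d0 zd tz) K.
    - exact: is_derive_line.
    - exact: is_derive_line.
    - exact: h3.
  have p1 := @partial_prefix_le (partial K u) y z (fun j => second u K j y)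
    delta e d0 zd (fun j x xy => (H x xy K).2 j) k (ltnW kd).
  rewrite -[k.+1]/(K.+1) !sum_ord_ltS.
  have -> : u (prefix y z K.+1) - u y - (\sum_(i < d | (i < K)%N) T i + T K) =
     (u (prefix y z k) - u y - \sum_(i < d | (i < k)%N) T i) +
     ((u (prefix y z K.+1) - u (prefix y z K) -
      partial K u (prefix y z K) * z ord0 K -
      second u K K y / 2 * z ord0 K ^+ 2) +
      (partial K u (prefix y z k) - partial K u y -
       \sum_(j < d | (j < k)%N) second u K j y * z ord0 j) * z ord0 K).
    by rewrite /T/=; ring.
  rewrite (le_trans (ler_normD _ _))// lerD ?IH 1?ltnW//.
  rewrite (le_trans (ler_normD _ _))// /E mulrDr lerD// normrM.
  by rewrite [`|z _ _| * _]mulrC mulrA ler_wpM2r.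
have := M d (leqnn _); rewrite prefix_full !sum_ord_ltd => /le_trans; apply.
rewrite -mulr_sumr -mulrA ler_wpM2l// big_split/= -natr1 mulrDl mul1r addrC.
rewrite lerD2r.
apply: (@le_trans _ _ (\sum_(i < d) \sum_(j < d)
    (z ord0 i ^+ 2 / 2 + z ord0 j ^+ 2 / 2))).
  apply: ler_sum => i _; rewrite mulr_sumr big_mkcond/=; apply: ler_sum => j _.
  have sq : `|z ord0 i| * `|z ord0 j| <= z ord0 i ^+ 2 / 2 + z ord0 j ^+ 2 / 2.
    rewrite -(real_normK (num_real (z ord0 i))) -(real_normK (num_real (z ord0 j))).
    by have := sqr_ge0 (`|z ord0 i| - `|z ord0 j|); nra.
  by case: ifP => // _; rewrite (le_trans _ sq)// mulr_ge0.
under [leLHS]eq_bigr => i _ do rewrite big_split/= sumr_const card_ord.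
rewrite big_split/= sumr_const card_ord sumrMnl -mulrnDl -mulr_suml -splitr.
by rewrite mulr_natl.
Qed.

Section compact_domain.
Variables (D : set 'rV[R]_d) (u : 'rV[R]_d -> R).
Hypotheses (oD : open D) (bD : bounded_set D) (C2u : C2_on D u).
Hypothesis u_ge0 : forall x, D x -> 0 <= u x.

(** The second derivatives are uniformly continuous near a compact subset
    of D. *)
Lemma taylor_uniform n (e : R) : 0 < e -> exists2 delta, 0 < delta &
  forall y z, inner D n y -> (forall i, `|z ord0 i| < delta) ->
  D (y + z) /\ u (y + z) <= u y + taylor_poly u y z + e * \sum_(i < d) z ord0 i ^+ 2.
Proof.
move=> e0; pose e' := e / d.+1%:R.
have e'0 : 0 < e' by rewrite divr_gt0.
have /compact_near_coveringP cK := @compact_inner _ _ D n bD.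
have [N _ NK] : \forall N \near \oo, inner D n `<=` [set y |
    forall x, ball y N.+1%:R^-1 x -> D x /\ forall i j,
       `|second u i j x - second u i j y| <= e'].
  apply: cK => y0 /inner_sub Dy0.
  have : \forall x \near y0, D x /\ forall i j,
      `|second u i j y0 - second u i j x| <= e' / 2.
    apply: filterI; first by apply: open_nbhs_nbhs; split.
    apply: (@filter_forall _ _ (fun i x => forall j,
      `|second u i j y0 - second u i j x| <= e' / 2) (nbhs y0)) => i.
    apply: (@filter_forall _ _ (fun j x =>
      `|second u i j y0 - second u i j x| <= e' / 2) (nbhs y0)) => j.
    have [_ _ /(_ i j)[_ cij]] := C2u Dy0.
    by move/cvgrPdist_le : cij; apply; rewrite divr_gt0.
  move=> /nbhs_ballP[r /= r0 hr].
  have r2 : 0 < r / 2 by rewrite divr_gt0.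
  exists (ball y0 (r / 2), [set N | N.+1%:R^-1 < r / 2]) => /=.
    split; first exact: nbhsx_ballx.
    exact: (near_infty_natSinv_lt (PosNum r2)).
  move=> [y N] [/= yy0 Nr] x yx.
  have [Dx hx] : D x /\ forall i j,
      `|second u i j y0 - second u i j x| <= e' / 2.
    apply: hr; apply: (@le_ball _ _ _ (r / 2 + N.+1%:R^-1)).
      by rewrite [leRHS]splitr lerD2l ltW.
    exact: ball_triangle yx.
  have [Dy hy] : D y /\ forall i j,
      `|second u i j y0 - second u i j y| <= e' / 2.
    by apply: hr; apply: le_ball yy0; rewrite ler_pdivrMr// ler_peMr ?ler1n// ltW.
  split=> // i j; rewrite [leRHS]splitr.
  have -> : second u i j x - second u i j y =
      (second u i j y0 - second u i j y) - (second u i j y0 - second u i j x).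
    by rewrite opprB [RHS]addrC addrA subrK.
  exact: le_trans (ler_normB _ _) (lerD (hy i j) (hx i j)).
exists N.+1%:R^-1; first by rewrite invr_gt0.
move=> y z yK zd.
have N0 : 0 < N.+1%:R^-1 :> R by rewrite invr_gt0.
split.
  apply: (NK N (leqnn _) _ yK _ _).1; apply/ball_rVP; split=> // i.
  by rewrite mxE opprD addrA subrr sub0r normrN.
have h := @taylor_local u y z N.+1%:R^-1 e' N0 (ltW e'0) zd.
have {h} : `|u (y + z) - u y - taylor_poly u y z| <=
    e' * d.+1%:R * \sum_(i < d) z ord0 i ^+ 2.
  apply: h => x yx i; have [Dx hx] := NK N (leqnn _) _ yK _ yx.
  have [_ h1 h2] := C2u Dx.
  by split=> [|j]; [exact: (h1 i).1|split; [exact: (h2 i j).1|exact: hx]].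
by rewrite divfK// ler_norml => /andP[_]; lra.
Qed.

(** Away from 0 the fourth powers dominate everything; this makes the Taylor
    bound global, and it survives truncating u to a compact set because u is
    nonnegative. *)
Lemma taylor_global n (e : R) : 0 < e -> exists2 C, 0 <= C &
  forall y z, inner D n y ->
  (u \_ (inner D n)) (y + z) <= u y + taylor_poly u y z +
    e * \sum_(i < d) z ord0 i ^+ 2 + C * \sum_(i < d) z ord0 i ^+ 4.
Proof.
move=> e0; have [delta d0 near0] := taylor_uniform n e0.
have cK := @compact_inner _ _ D n bD.
have [M0 M00 uM0] : exists2 M, 0 <= M & forall x, inner D n x -> `|u x| <= M.
  by apply: compact_ubound => // x /inner_sub/C2u[].
have /choice[M1 uM1] : forall i, exists M : R,
    0 <= M /\ forall x, inner D n x -> `|partial i u x| <= M.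
  move=> i; have [M M00' MM] := @compact_ubound _ _ _ (partial i u) cK
    (fun x Kx => let: And3 _ h _ := C2u (inner_sub Kx) in (h i).2).
  by exists M.
have /choice[M2 uM2] : forall ij : 'I_d * 'I_d, exists M : R,
    0 <= M /\ forall x, inner D n x -> `|second u ij.1 ij.2 x| <= M.
  move=> ij; have [M M00' MM] := @compact_ubound _ _ _ (second u ij.1 ij.2) cK
    (fun x Kx => let: And3 _ _ h := C2u (inner_sub Kx) in (h ij.1 ij.2).2).
  by exists M.
pose A := \sum_(i < d) (M1 i + M2 (i, i) / 2 + \sum_(j < d | (j < i)%N) M2 (i, j)).
have A0 : 0 <= A.
  rewrite sumr_ge0// => i _; rewrite !addr_ge0//.
  - by have [] := uM1 i.
  - by rewrite divr_ge0//; have [] := uM2 (i, i).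
  - by rewrite sumr_ge0// => j _; have [] := uM2 (i, j).
(* If some coordinate of z is at least delta in norm, then 1 <= delta^-4 S for
   the sum S of the fourth powers, and 1 + S bounds all the monomials. *)
pose C := (M0 + M0 + A) * (delta ^- 4 + 1).
have C0 : 0 <= C.
  by rewrite mulr_ge0 ?addr_ge0// invr_ge0 exprn_ge0// ltW.
exists C => // y z Ky; pose S := \sum_(i < d) z ord0 i ^+ 4; rewrite -/S.
have S0 : 0 <= S by apply: sumr_ge0 => i _; rewrite exprn_even_ge0.
have z2 : 0 <= \sum_(i < d) z ord0 i ^+ 2.
  by apply: sumr_ge0 => i _; rewrite exprn_even_ge0.
have ez := mulr_ge0 (ltW e0) z2; have CS := mulr_ge0 C0 S0.
have [zd|/existsNP[k /negP]] := pselect (forall i, `|z ord0 i| < delta).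
  have [Dyz h] := near0 y z Ky zd; have u0 := u_ge0 Dyz.
  rewrite patchE; case: ifP => _; first by lra.
  by apply: (@le_trans _ _ 0) => //; lra.
rewrite -leNgt => dz.
have uM : (u \_ (inner D n)) (y + z) <= M0.
  by rewrite patchE; case: ifPn => // /set_mem/uM0; exact: le_trans (ler_norm _).
have z4S i : z ord0 i ^+ 4 <= S.
  rewrite /S (bigD1 i)//= lerDl.
  by apply: sumr_ge0 => j _; rewrite exprn_even_ge0.
have sqS i : z ord0 i ^+ 2 <= 1 + S.
  by have := z4S i; have := sqr_ge0 (z ord0 i ^+ 2 - 1); nra.
have zS i : `|z ord0 i| <= 1 + S.
  have := sqS i; rewrite -(real_normK (num_real (z ord0 i))).
  have := sqr_ge0 (`|z ord0 i| - 1); have := z4S i.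
  rewrite -[z ord0 i ^+ 4]ger0_norm ?exprn_even_ge0// normrX.
  have := sqr_ge0 (`|z ord0 i| ^+ 2 - 1); have := normr_ge0 (z ord0 i); nra.
have zzS i j : `|z ord0 i * z ord0 j| <= 1 + S.
  rewrite normrM; have := sqS i; have := sqS j.
  rewrite -(real_normK (num_real (z ord0 i))) -(real_normK (num_real (z ord0 j))).
  by have := sqr_ge0 (`|z ord0 i| - `|z ord0 j|); nra.
have TA : `|taylor_poly u y z| <= A * (1 + S).
  rewrite /A mulr_suml (le_trans (ler_norm_sum _ _ _))//; apply: ler_sum => i _.
  rewrite mulrDl mulrDl (le_trans (ler_normD _ _))// lerD//.
    rewrite (le_trans (ler_normD _ _))// lerD//.
      by rewrite normrM ler_pM//; exact: (uM1 i).2.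
    rewrite normrM ler_pM//; last by rewrite ger0_norm ?sqr_ge0.
    by rewrite normrM [`|2^-1|]ger0_norm// ler_wpM2r//; exact: (uM2 (i, i)).2.
  rewrite !mulr_suml (le_trans (ler_norm_sum _ _ _))//; apply: ler_sum => j _.
  by rewrite -mulrA normrM ler_pM//; exact: (uM2 (i, j)).2.
have dS : 1 <= delta ^- 4 * S.
  rewrite mulrC ler_pdivlMr ?exprn_gt0// mul1r (le_trans _ (z4S k))//.
  rewrite -[leRHS]ger0_norm ?exprn_even_ge0// normrX.
  by rewrite lerXn2r// nnegrE ltW.
have uy := uM0 y Ky; rewrite ler_norml in uy; rewrite ler_norml in TA.
have CE : (M0 + M0 + A) * (1 + S) <= C * S.
  by rewrite /C -mulrA ler_wpM2l ?addr_ge0//; lra.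
move: uy TA => /andP[uy _] /andP[TA _].
have : M0 + M0 + A * (1 + S) <= (M0 + M0 + A) * (1 + S) by nra.
by lra.
Qed.

End compact_domain.
End taylor.

(** * One step of Brownian motion *)

Section cylinders.
Context {R : realType} {d0 : measure_display} {Omega : measurableType d0}.
Variables (P : probability Omega R) (I : finType) (X : I -> Omega -> R).
Hypothesis mX : forall i, measurable_fun setT (X i).
Hypothesis indX : mutually_independent P X.

(** A pi-system that generates the sigma-algebra of the X i with i in J. *)
Definition cylinders (J : pred I) : set (set Omega) :=
  [set E | exists2 A : I -> set R,
    forall i, measurable (A i) /\ (~~ J i -> A i = setT) &
    E = \bigcap_(i in [set: I]) (X i @^-1` A i)].

Lemma cylindersT J : cylinders J setT.
Proof.
exists (fun=> setT); first by move=> i; split.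
by apply/seteqP; split.
Qed.

Lemma cylinders_setI J : setI_closed (cylinders J).
Proof.
move=> E F [A hA ->] [C hC ->]; exists (fun i => A i `&` C i).
  move=> i; have [mA AT] := hA i; have [mC CT] := hC i.
  by split=> [|Ji]; [exact: measurableI|rewrite AT// CT// setIT].
by rewrite -bigcapI.
Qed.

Lemma cylinders_measurable J : cylinders J `<=` measurable.
Proof.
move=> _ [A hA ->]; apply: fin_bigcap_measurable => // i _.
by rewrite -[X in measurable X]setTI; apply: mX => //; exact: (hA i).1.
Qed.

Lemma cylinders_indep J E F : cylinders J E -> cylinders (predC J) F ->
  P (E `&` F) = (P E * P F)%E.
Proof.
move=> [A hA ->] [C hC ->]; rewrite -bigcapI.
rewrite (indX (A := A)); last by move=> i; exact: (hA i).1.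
rewrite (indX (A := C)); last by move=> i; exact: (hC i).1.
rewrite -big_split/=.
under eq_bigcapr do rewrite -preimage_setI.
rewrite (indX (A := fun i => A i `&` C i)); last first.
  by move=> i; apply: measurableI; [exact: (hA i).1|exact: (hC i).1].
apply: eq_bigr => i _; have [Ji|Ji] := boolP (J i).
  rewrite (hC i).2/= ?negbK// setIT preimage_setT.
  by rewrite [X in (_ * X)%E]probability_setT mule1.
by rewrite (hA i).2// setTI preimage_setT [X in (X * _)%E]probability_setT mul1e.
Qed.

(** Measures that agree on a pi-system agree on the sigma-algebra it generates;
    this is applied to one factor after the other. *)
Lemma generated_indep J E F : <<s cylinders J >> E ->
  <<s cylinders (predC J) >> F -> P (E `&` F) = (P E * P F)%E.
Proof.
have sub J' : <<s cylinders J' >> `<=` measurable.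
  by apply: smallest_sub; [exact: sigma_algebra_measurable|
    exact: cylinders_measurable].
have uniq J' (m1 m2 : {measure set Omega -> \bar R}) : (m1 setT < +oo)%E ->
    (forall A, cylinders J' A -> m1 A = m2 A) ->
    forall A, <<s cylinders J' >> A -> m1 A = m2 A.
  move=> m1oo m12; apply: (g_sigma_algebra_measure_unique (cylinders J')
    (@cylinders_measurable J') (fun=> setT)) => //.
  - by move=> _; exact: cylindersT.
  - by rewrite bigcup_const.
  - exact: cylinders_setI.
have fin A : measurable A -> P A = (fine (P A))%:E.
  by move=> mA; rewrite fineK// fin_num_measure.
have half A F' : cylinders (predC J) F' -> <<s cylinders J >> A ->
    P (A `&` F') = (P A * P F')%E.
  move=> cF sA; have mF := cylinders_measurable cF.
  pose k : {nonneg R} := NngNum (fine_ge0 (measure_ge0 P F')).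
  rewrite muleC (fin _ mF).
  apply: (uniq J (mrestr P mF) (mscale k P)) sA => [|A' cA'].
    by rewrite /= /mrestr setTI ltey_eq fin_num_measure.
  rewrite /= /mrestr /mscale/= -(fin _ mF) muleC.
  exact: (@cylinders_indep J).
move=> sE sF; have mE := sub _ _ sE.
pose k : {nonneg R} := NngNum (fine_ge0 (measure_ge0 P E)).
rewrite setIC (fin _ mE).
apply: (uniq (predC J) (mrestr P mE) (mscale k P)) sF => [|A' cA'].
  by rewrite /= /mrestr setTI ltey_eq fin_num_measure.
by rewrite /= /mrestr /mscale/= -(fin _ mE) setIC half.
Qed.

Lemma measurable_cylinder (J : pred I) i : J i ->
  measurable_fun [set: g_sigma_algebraType (cylinders J)] (X i).
Proof.
move=> Ji _ A mA; rewrite setTI; apply: sub_sigma_algebra.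
exists (fun j => if j == i then A else setT).
  move=> j; split; first by case: ifP.
  by case: eqP => // ->; rewrite Ji.
apply/seteqP; split=> w.
  by move=> Aw j _; rewrite /preimage/=; case: eqP => // ->.
by move=> /(_ i Logic.I); rewrite /preimage/= eqxx.
Qed.

End cylinders.

Section has_mean.
Context {R : realType} {d0 : measure_display} {Omega : measurableType d0}.
Variable P : probability Omega R.
Implicit Types (f g : Omega -> R) (a b : R).

Definition has_mean f a :=
  P.-integrable setT (EFin \o f) /\ (\int[P]_w (f w)%:E = a%:E)%E.

Lemma has_mean_cst a : has_mean (cst a) a.
Proof.
split; first exact: finite_measure_integrable_cst.
transitivity (a%:E * P setT)%E; last by rewrite probability_setT mule1.
exact: (@integral_cst _ _ _ P setT measurableT a%:E).
Qed.

Lemma has_meanD f g a b : has_mean f a -> has_mean g b ->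
  has_mean (fun w => f w + g w) (a + b).
Proof.
move=> [iF fa] [iG gb]; split.
  rewrite (_ : EFin \o _ = (EFin \o f) \+ (EFin \o g))%E//.
  exact: integrableD.
under eq_integral do rewrite EFinD.
by rewrite (@integralD _ _ _ P setT measurableT _ _ iF iG)/= fa gb.
Qed.

Lemma has_meanZ f a b : has_mean f a -> has_mean (fun w => b * f w) (b * a).
Proof.
move=> [iF fa]; split.
  rewrite (_ : EFin \o _ = (fun w => b%:E * (EFin \o f) w))%E//.
  exact: integrableZl.
under eq_integral do rewrite EFinM.
by rewrite (@integralZl _ _ _ P setT measurableT _ iF b)/= fa.
Qed.

Lemma has_mean_sum (I : Type) (r : seq I) (p : pred I) (f : I -> Omega -> R)
    (a : I -> R) : (forall i, p i -> has_mean (f i) (a i)) ->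
  has_mean (fun w => \sum_(i <- r | p i) f i w) (\sum_(i <- r | p i) a i).
Proof.
move=> fa; elim: r => [|i r IH].
  rewrite big_nil (_ : (fun _ => _) = cst 0); first exact: has_mean_cst.
  by apply/funext => w; rewrite big_nil.
rewrite big_cons (_ : (fun _ => _) = (fun w => (if p i then f i w else 0) +
    \sum_(j <- r | p j) f j w)); last first.
  by apply/funext => w; rewrite big_cons; case: ifP => // _; rewrite add0r.
have [pi|pi] := boolP (p i); first exact: has_meanD (fa i pi) IH.
rewrite -[X in has_mean _ X]add0r; apply: has_meanD IH.
exact: has_mean_cst.
Qed.

Lemma ge0_integral_le_mean f g a : measurable_fun setT f ->
  (forall w, 0 <= f w <= g w) -> has_mean g a ->
  (\int[P]_w (f w)%:E <= a%:E)%E.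
Proof.
move=> mf fg [iG <-]; apply: ge0_le_integral => //.
- by move=> w _; rewrite lee_fin; have /andP[] := fg w.
- exact/measurable_EFinP.
- exact: measurable_int iG.
- by move=> w _; rewrite lee_fin; have /andP[] := fg w.
Qed.

End has_mean.

Section increments.
Context {R : realType} {dO : measure_display} {Omega : measurableType dO}.
Context {d : nat}.
Variables (P : probability Omega R) (B : R -> Omega -> 'rV[R]_d).
Hypothesis bmB : brownian_motion P B.

Definition increment (s h : R) (k : nat) (i : 'I_d) (w : Omega) : R :=
  (B (s + k.+1%:R * h) w - B (s + k%:R * h) w) ord0 i.

Lemma measurable_brownian_coord t i : 0 <= t ->
  measurable_fun setT (fun w => B t w ord0 i).
Proof.
have [mB _ _ _ _] := bmB => /mB mBt.
exact: (measurableT_comp (measurable_coord_rV i) mBt).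
Qed.

Lemma measurable_increment s h k i : 0 <= s -> 0 <= h ->
  measurable_fun setT (increment s h k i).
Proof.
move=> s0 h0; rewrite (_ : increment s h k i = (fun w =>
  B (s + k.+1%:R * h) w ord0 i - B (s + k%:R * h) w ord0 i)); last first.
  by apply/funext => w; rewrite /increment !mxE.
by apply: measurable_funB; apply: measurable_brownian_coord;
  rewrite addr_ge0 ?mulr_ge0.
Qed.

Lemma increment_law s h k i A : 0 <= s -> 0 < h -> measurable A ->
  P (increment s h k i @^-1` A) = normal_prob 0 (Num.sqrt h) A.
Proof.
move=> s0 h0 mA; have [_ _ _ law _] := bmB.
have := law i (s + k%:R * h) (s + k.+1%:R * h) A.
rewrite (_ : s + k.+1%:R * h - (s + k%:R * h) = h); last first.
  by rewrite -natr1; ring.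
apply => //; first by rewrite addr_ge0// mulr_ge0// ltW.
by rewrite ltrD2l ltr_pM2r// ltr_nat.
Qed.

Lemma increments_indep s h n : 0 <= s -> 0 < h ->
  mutually_independent P
    (fun (ik : 'I_d * 'I_n) => increment s h ik.2 ik.1).
Proof.
move=> s0 h0; have [_ _ _ _ ind] := bmB.
apply: (ind n (fun k => s + k%:R * h)); first by rewrite mul0r addr0.
by move=> k; rewrite ltrD2l ltr_pM2r// ltr_nat.
Qed.

Section moments.
Variables (s h : R) (k : nat).
Hypotheses (s0 : 0 <= s) (h0 : 0 < h).
Local Notation Z := (increment s h k).

Let sh0 : 0 < Num.sqrt h. Proof. by rewrite sqrtr_gt0. Qed.
Let mZ i : measurable_fun setT (Z i).
Proof. exact: measurable_increment s0 (ltW h0). Qed.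
Let lawZ i A : measurable A -> P (Z i @^-1` A) = normal_prob 0 (Num.sqrt h) A.
Proof. exact: increment_law. Qed.

Lemma increment_mean i : has_mean P (Z i) 0.
Proof.
split; last exact: gaussian_mean (mZ i) sh0 (@lawZ i).
exact: (integrable_gaussian_exprn (mZ i) sh0 (@lawZ i) 0).
Qed.

Lemma increment_second i : has_mean P (fun w => Z i w ^+ 2) h.
Proof.
split; first exact: (integrable_gaussian_exprn (mZ i) sh0 (@lawZ i) 1).
by rewrite (gaussian_second_moment (mZ i) sh0 (@lawZ i)) sqr_sqrtr// ltW.
Qed.

Lemma increment_fourth i : exists2 m, m <= 48 * expR (2^-1) * h ^+ 2 &
  has_mean P (fun w => Z i w ^+ 4) m.
Proof.
have iZ := integrable_gaussian_exprn (mZ i) sh0 (@lawZ i) 3.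
have fin := integrable_fin_num measurableT iZ.
exists (fine (\int[P]_w (Z i w ^+ 4)%:E)); last by split; rewrite ?fineK.
rewrite -lee_fin fineK//.
apply: le_trans (gaussian_fourth_moment (mZ i) sh0 (@lawZ i)) _.
by rewrite lee_fin (exprM _ 2 2) sqr_sqrtr// ltW.
Qed.

(** By polarization: E (Z_i + Z_j)^2 is computed with Tonelli's theorem. *)
Lemma increment_cross i j : j != i -> has_mean P (fun w => Z j w * Z i w) 0.
Proof.
move=> ji.
have [i1 e1] := increment_second i; have [i2 e2] := increment_second j.
have mij : measurable_fun setT (fun w => Z j w * Z i w).
  exact: measurable_funM.
have iji : P.-integrable setT (EFin \o (fun w => Z j w * Z i w)).
  apply: (@le_integrable _ _ _ _ _ _ _
    ((fun w => (Z j w ^+ 2)%:E) \+ (fun w => (Z i w ^+ 2)%:E))%E) => //.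
  - exact/measurable_EFinP.
  - move=> w _ /=; rewrite lee_fin normrM [leRHS]ger0_norm ?addr_ge0 ?sqr_ge0//.
    rewrite -(real_normK (num_real (Z j w))) -(real_normK (num_real (Z i w))).
    have := sqr_ge0 (`|Z j w| - `|Z i w|).
    by have := mulr_ge0 (normr_ge0 (Z j w)) (normr_ge0 (Z i w)); nra.
  - exact: integrableD.
have fin := integrable_fin_num measurableT iji.
have [m hm] : exists m, has_mean P (fun w => Z j w * Z i w) m.
  by exists (fine (\int[P]_w (Z j w * Z i w)%:E)); split; rewrite ?fineK.
suff -> : 0 = m by [].
have ind A1 A2 : measurable A1 -> measurable A2 ->
    P (Z j @^-1` A1 `&` Z i @^-1` A2) = (P (Z j @^-1` A1) * P (Z i @^-1` A2))%E.
  move=> mA1 mA2.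
  pose X := fun (ik : 'I_d * 'I_k.+1) => increment s h ik.2 ik.1.
  have indX : mutually_independent P X by exact: increments_indep.
  apply: (@cylinders_indep _ _ _ _ _ X indX (pred1 (j, ord_max))).
    exists (fun l => if l == (j, ord_max) then A1 else setT).
      by move=> l; split; [case: ifP|rewrite /= => /negbTE ->].
    apply/seteqP; split=> w.
      by move=> Aw l _; rewrite /preimage/=; case: eqP => // ->.
    by move=> /(_ (j, ord_max) I); rewrite /preimage/= eqxx.
  exists (fun l => if l == (i, ord_max) then A2 else setT).
    move=> l; split; first by case: ifP.
    rewrite /= negbK => /eqP ->; case: eqP => // -[ijE].
    by rewrite ijE eqxx in ji.
  apply/seteqP; split=> w.
    by move=> Aw l _; rewrite /preimage/=; case: eqP => // ->.
  by move=> /(_ (i, ord_max) I); rewrite /preimage/= eqxx.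
have sq a : has_mean P (fun w => (a + Z i w) ^+ 2) (a ^+ 2 + h).
  rewrite (_ : (fun _ => _) = (fun w => (cst (a ^+ 2) w + (2 * a) * Z i w) +
    Z i w ^+ 2)); last by apply/funext => w; rewrite /cst; ring.
  rewrite (_ : a ^+ 2 + h = (a ^+ 2 + (2 * a) * 0) + h); last by ring.
  apply: has_meanD (increment_second i); apply: has_meanD.
    exact: has_mean_cst.
  by apply: has_meanZ; exact: increment_mean.
have E2 : (\int[P]_w ((Z j w + Z i w) ^+ 2)%:E = (h + h)%:E)%E.
  rewrite (ge0_integral_indep (f := fun p : R * R => ((p.1 + p.2) ^+ 2)%:E)
    (mZ j) (mZ i) ind).
  - under eq_integral do rewrite /= (sq _).2.
    have [_ <-] := has_meanD (increment_second j) (has_mean_cst P h).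
    by [].
  - by apply/measurable_EFinP; apply: measurable_funX; exact: measurable_funD.
  - by move=> p; rewrite lee_fin sqr_ge0.
have : has_mean P (fun w => (Z j w + Z i w) ^+ 2) (h + (2 * m) + h).
  rewrite (_ : (fun _ => _) = (fun w => (Z j w ^+ 2 + 2 * (Z j w * Z i w)) +
    Z i w ^+ 2)); last by apply/funext => w; ring.
  apply: has_meanD (increment_second i); apply: has_meanD.
    exact: increment_second.
  exact: has_meanZ.
by move=> [_]; rewrite E2 => -[]; lra.
Qed.

End moments.

Section one_step.
Variables (D : set 'rV[R]_d) (u : 'rV[R]_d -> R).
Hypotheses (oD : open D) (bD : bounded_set D) (C2u : C2_on D u).
Hypothesis u_ge0 : forall x, D x -> 0 <= u x.

Lemma measurable_C2 : measurable_fun D u.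
Proof.
by apply: continuous_at_measurable_rV => // x /C2u[].
Qed.

Lemma measurable_trunc n : measurable_fun setT (u \_ (inner D n)).
Proof.
have mK : measurable (inner D n).
  by apply: closed_measurable_rV; exact: closed_inner.
have muK : measurable_fun (inner D n) u.
  apply: (measurable_funS _ (@inner_sub _ _ D n)); last exact: measurable_C2.
  exact: open_measurable_rV.
exact: (measurable_restrictT u mK).1 muK.
Qed.

Lemma trunc_ge0 n x : 0 <= (u \_ (inner D n)) x.
Proof.
by rewrite patchE; case: ifPn => // /set_mem/inner_sub/u_ge0.
Qed.

(** The generator of sqrt 2 B is the Laplacian: in the mean of the Taylor
    polynomial, the linear and the mixed terms vanish, the squares give
    h times the Laplacian, and the fourth powers are of order h^2. *)
Lemma one_step n e : 0 < e -> exists2 C, 0 <= C &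
  forall s h k y, 0 <= s -> 0 < h -> inner D n y ->
  (\int[P]_w ((u \_ (inner D n)) (y + Num.sqrt 2 *:
      (B (s + k.+1%:R * h) w - B (s + k%:R * h) w)))%:E <=
   (u y + h * laplacian u y + e * h + C * h ^+ 2)%:E)%E.
Proof.
(* The squares of the coordinates of sqrt 2 B add up to mean 2 d h. *)
move=> e0; pose e' := e / (2 * d%:R + 1).
have d1 : 0 < 2 * d%:R + 1 :> R by rewrite ltr_wpDl// mulr_ge0.
have e'0 : 0 < e' by rewrite divr_gt0.
have [C C0 hC] := taylor_global oD bD C2u u_ge0 n e'0.
exists (C * (d%:R * (4 * (48 * expR (2^-1))))).
  by rewrite !mulr_ge0// expR_ge0.
move=> s h k y s0 h0 Ky; pose Z := increment s h k.
have /choice[m4 hm4] : forall i, exists m, m <= 48 * expR (2^-1) * h ^+ 2 /\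
    has_mean P (fun w => Z i w ^+ 4) m.
  by move=> i; have [m ? ?] := increment_fourth k s0 h0 i; exists m.
pose r2 : R := Num.sqrt 2.
have r22 : r2 * r2 = 2 by rewrite -expr2 sqr_sqrtr.
have key1 a b c x : a * (r2 * x) + b / 2 * (r2 * x) ^+ 2 + r2 * c * (r2 * x) =
    a * r2 * x + b * x ^+ 2 + 2 * c * x.
  transitivity (a * r2 * x + b / 2 * (r2 * r2) * x ^+ 2 + (r2 * r2) * c * x).
    by ring.
  by rewrite r22; field.
have key2 (a b c : R) : 2 * (a * b) * c = (a * 2) * (b * c) by ring.
pose T w := \sum_(i < d) ((partial i u y * r2) * Z i w +
   (second u i i y) * Z i w ^+ 2 +
   \sum_(j < d | (j < i)%N) (second u i j y * 2) * (Z j w * Z i w)).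
have hT : has_mean P T (h * laplacian u y).
  rewrite /laplacian mulr_sumr; apply: has_mean_sum => i _.
  rewrite (_ : h * _ = (partial i u y * r2) * 0 + (second u i i y) * h +
    \sum_(j < d | (j < i)%N) (second u i j y * 2) * 0); last first.
    by rewrite mulr0 add0r big1 => [|j _]; rewrite ?mulr0// addr0 mulrC.
  apply: has_meanD; first apply: has_meanD.
  - by apply: has_meanZ; exact: increment_mean.
  - by apply: has_meanZ; exact: increment_second.
  - apply: has_mean_sum => j ji; apply: has_meanZ; apply: increment_cross => //.
    by apply: contraTN ji => /eqP ->; rewrite ltnn.
have hP : has_mean P (fun w => (u y + T w) +
    (e' * 2) * (\sum_(i < d) Z i w ^+ 2) + (C * 4) * (\sum_(i < d) Z i w ^+ 4))
    ((u y + h * laplacian u y) + (e' * 2) * (\sum_(i < d) h) +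
     (C * 4) * (\sum_(i < d) m4 i)).
  apply: has_meanD; first apply: has_meanD; first apply: has_meanD => //.
  - exact: has_mean_cst.
  - by apply: has_meanZ; apply: has_mean_sum => i _; exact: increment_second.
  - by apply: has_meanZ; apply: has_mean_sum => i _; exact: (hm4 i).2.
apply: (@le_trans _ _ ((u y + h * laplacian u y) + (e' * 2) * (\sum_(i < d) h) +
     (C * 4) * (\sum_(i < d) m4 i))%:E).
  apply: ge0_integral_le_mean hP => [|w].
    apply: measurableT_comp; first exact: measurable_trunc.
    apply: measurable_fun_rV => i.
    rewrite (_ : (fun _ => _) = (fun w => y ord0 i + r2 * Z i w)).
      apply: measurable_funD => //; apply: measurable_funM => //.
      exact: measurable_increment (ltW h0).
    by apply/funext => w; rewrite /Z /increment !mxE.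
  rewrite trunc_ge0/=; set z := Num.sqrt 2 *: _.
  have zE i : z ord0 i = r2 * Z i w by rewrite /z /Z /increment !mxE.
  apply: (le_trans (hC y z Ky)); rewrite le_eqVlt; apply/orP; left; apply/eqP.
  congr (_ + _ + _ + _).
  - apply: eq_bigr => i _; rewrite zE.
    rewrite (eq_bigr (fun j => r2 * (second u i j y * Z j w))); last first.
      by move=> j _; rewrite zE mulrCA.
    rewrite -mulr_sumr key1; congr (_ + _); rewrite mulr_sumr mulr_suml.
    by apply: eq_bigr => j _; rewrite key2.
  - rewrite -mulrA; congr (_ * _); rewrite mulr_sumr; apply: eq_bigr => i _.
    by rewrite zE exprMn expr2 r22.
  - rewrite -mulrA; congr (_ * _); rewrite mulr_sumr; apply: eq_bigr => i _.
    by rewrite zE exprMn (exprM _ 2 2) [r2 ^+ 2]expr2 r22; congr (_ * _); ring.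
rewrite lee_fin; apply: lerD.
  rewrite lerD2l sumr_const card_ord -(mulr_natl h) /e'.
  rewrite (_ : _ * (_ * h) = (2 * d%:R / (2 * d%:R + 1)) * (e * h)); last by ring.
  rewrite -[leRHS]mul1r ler_wpM2r ?mulr_ge0 ?(ltW e0) ?(ltW h0)//.
  by rewrite ler_pdivrMr// mul1r lerDl.
rewrite (_ : _ * h ^+ 2 = (C * 4) * (d%:R * (48 * expR (2^-1) * h ^+ 2))); last by ring.
rewrite ler_wpM2l ?mulr_ge0// mulr_natl -[d in leRHS]card_ord -sumr_const.
by apply: ler_sum => i _; exact: (hm4 i).1.
Qed.

End one_step.
End increments.

(** * Decay of the killed semigroup on eigenfunctions *)

Section supermartingale.
Context {R : realType} {dO : measure_display} {Omega : measurableType dO}.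
Context {d : nat}.
Variables (P : probability Omega R) (B : R -> Omega -> 'rV[R]_d).
Hypothesis bmB : brownian_motion P B.
Variables (D : set 'rV[R]_d) (u : 'rV[R]_d -> R) (lam : R).
Hypotheses (oD : open D) (bD : bounded_set D) (C2u : C2_on D u).
Hypothesis u_gt0 : forall x, D x -> 0 < u x.
Hypothesis eigen_u : forall x, D x -> - laplacian u x = lam * u x.

Let u_ge0 x : D x -> 0 <= u x. Proof. by move=> /u_gt0/ltW. Qed.

Let inner_lower n : exists2 m, 0 < m & forall y, inner D n y -> m <= u y.
Proof.
have cK := @compact_inner _ _ D n bD.
have [M M0 uM] : exists2 M, 0 <= M & forall y, inner D n y -> `|(u y)^-1| <= M.
  apply: compact_ubound cK _ => y /inner_sub Dy.
  have [cu _ _] := C2u Dy.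
  by apply: (cvgV _ cu); rewrite gt_eqF// u_gt0.
have M1 : 0 < M + 1 by rewrite ltr_wpDl.
exists (M + 1)^-1; first by rewrite invr_gt0.
move=> y Ky; have uy := u_gt0 (inner_sub Ky).
rewrite -[leRHS]invrK lef_pV2 ?posrE ?invr_gt0//.
have := uM y Ky; rewrite gtr0_norm ?invr_gt0//.
by move=> /le_trans; apply; rewrite lerDl.
Qed.

Section discrete.
Variables (n : nat) (h : R) (x : 'rV[R]_d).
Hypothesis h_gt0 : 0 < h.

Definition grid (k : nat) : R := 0 + k%:R * h.

Let grid_ge0 k : 0 <= grid k.
Proof. by rewrite /grid add0r mulr_ge0// ltW. Qed.

Definition alive_grid (m : nat) : set Omega :=
  [set w | forall k, (k <= m)%N -> inner D n (position B x (grid k) w)].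

(** The mean of [survival m] is the discrete analogue of the killed semigroup
    at time m h. *)
Definition survival (m : nat) (w : Omega) : R :=
  \1_(alive_grid m) w * (u \_ (inner D n)) (position B x (grid m) w).

Section past.
Variable m : nat.
Local Notation X := (fun ik : 'I_d * 'I_m.+1 => increment B 0 h ik.2 ik.1).
Local Notation past := (fun ik : 'I_d * 'I_m.+1 => (ik.2 < m)%N).
Local Notation OmegaP := (g_sigma_algebraType (cylinders X past)).

Let measurable_past_coord k i : (k <= m)%N ->
  measurable_fun [set: OmegaP] (fun w => B (grid k) w ord0 i).
Proof.
elim: k => [|k IH] km.
  have -> : (fun w => B (grid 0) w ord0 i) = cst 0.
    apply/funext => w; have [_ B0 _ _ _] := bmB.
    by rewrite /grid mul0r addr0 B0 mxE.
  exact: measurable_cst.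
have km' : (k < m.+1)%N by rewrite ltnS ltnW.
rewrite (_ : (fun _ => _) = (fun w => B (grid k) w ord0 i +
    X (i, Ordinal km') w)); last first.
  by apply/funext => w; rewrite /increment !mxE /grid/= subrKC.
apply: measurable_funD; first exact: (IH (ltnW km)).
exact: measurable_cylinder.
Qed.

Let measurable_past_position k : (k <= m)%N ->
  measurable_fun [set: OmegaP] (position B x (grid k)).
Proof.
move=> km; apply: measurable_fun_rV => i.
rewrite (_ : (fun _ => _) = (fun w => x ord0 i + Num.sqrt 2 *
    (B (grid k) w ord0 i))); last by apply/funext => w; rewrite !mxE.
by apply: measurable_funD => //; apply: measurable_funM => //;
  exact: measurable_past_coord.
Qed.

Let measurable_past_alive :
  measurable_fun [set: OmegaP] (\1_(alive_grid m) : Omega -> R).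
Proof.
apply: measurable_indic.
rewrite (_ : alive_grid m = \bigcap_(k in [set k | (k <= m)%N])
    (position B x (grid k) @^-1` inner D n)).
  apply: bigcap_measurable; first by exists 0%N.
  move=> k /= km; rewrite -[X in measurable X]setTI.
  apply: measurable_past_position => //.
  by apply: closed_measurable_rV; exact: closed_inner.
by apply/seteqP; split=> w h' k; exact: h'.
Qed.

Let now (w : Omega) : 'rV[R]_d * R :=
  (position B x (grid m) w, \1_(alive_grid m) w).
Let next (w : Omega) : 'rV[R]_d := B (grid m.+1) w - B (grid m) w.

(* [now] depends on the first m increments, and [next] on the following one. *)
Let generated_measurable A : <<s cylinders X past >> A -> measurable A.
Proof.
move=> sA; apply: (smallest_sub _ _ sA); first exact: sigma_algebra_measurable.
apply: cylinders_measurable => ik.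
by apply: (measurable_increment bmB) => //; exact: ltW.
Qed.

Let now_past A : measurable A -> <<s cylinders X past >> (now @^-1` A).
Proof.
move=> mA; have : measurable_fun [set: OmegaP] now.
  apply: measurable_fun_pair; first exact: measurable_past_position.
  exact: measurable_past_alive.
by move=> /(_ measurableT _ mA); rewrite setTI.
Qed.

Let next_future A : measurable A ->
  <<s cylinders X (predC past) >> (next @^-1` A).
Proof.
move=> mA.
have : measurable_fun [set: g_sigma_algebraType (cylinders X (predC past))] next.
  apply: measurable_fun_rV => i.
  by apply: (measurable_cylinder (X := X) (i := (i, ord_max))) => /=; rewrite ltnn.
by move=> /(_ measurableT _ mA); rewrite setTI.
Qed.

Let mnow : measurable_fun setT now.
Proof.
by move=> _ A mA; rewrite setTI; apply: generated_measurable; exact: now_past.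
Qed.

Let mnext : measurable_fun setT next.
Proof.
apply: measurable_fun_rV => i.
by apply: (measurable_increment bmB (s := 0)) => //; exact: ltW.
Qed.

(** The next increment is independent of the past, so that it can be integrated
    first. *)
Lemma survival_step (q : R) : 0 <= q ->
  (forall y, inner D n y ->
    (\int[P]_w ((u \_ (inner D n)) (y + Num.sqrt 2 *: next w))%:E <=
     (q * u y)%:E)%E) ->
  (\int[P]_w (survival m.+1 w)%:E <= q%:E * \int[P]_w (survival m w)%:E)%E.
Proof.
move=> q0 hq.
have mtr := measurable_trunc oD C2u n.
have tr0 y : 0 <= (u \_ (inner D n)) y by exact: trunc_ge0.
pose F (p : ('rV[R]_d * R) * 'rV[R]_d) : \bar R :=
  (`|p.1.2| * (u \_ (inner D n)) (p.1.1 + Num.sqrt 2 *: p.2))%:E.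
have mF : measurable_fun setT F.
  apply/measurable_EFinP; apply: measurable_funM.
    apply: measurableT_comp => //.
    exact: (measurableT_comp measurable_snd measurable_fst).
  apply: (measurableT_comp mtr); apply: measurable_fun_rV => i.
  rewrite (_ : (fun _ => _) = (fun p : ('rV[R]_d * R) * 'rV[R]_d =>
    p.1.1 ord0 i + Num.sqrt 2 * p.2 ord0 i)); last first.
    by apply/funext => p; rewrite !mxE.
  apply: measurable_funD.
    apply: (measurableT_comp (measurable_coord_rV i)).
    exact: (measurableT_comp measurable_fst measurable_fst).
  apply: measurable_funM => //.
  exact: (measurableT_comp (measurable_coord_rV i) measurable_snd).
have F0 p : (0 <= F p)%E by rewrite lee_fin mulr_ge0.
have msurv k : measurable_fun setT (fun w => (survival k w)%:E).
  apply/measurable_EFinP; apply: measurable_funM.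
    apply: measurable_indic.
    rewrite (_ : alive_grid k = \bigcap_(l in [set l | (l <= k)%N])
        (position B x (grid l) @^-1` inner D n)).
      apply: bigcap_measurable; first by exists 0%N.
      move=> l /= _; rewrite -[X in measurable X]setTI.
      apply: (measurable_position_at bmB) => //.
      by apply: closed_measurable_rV; exact: closed_inner.
    by apply/seteqP; split=> w h' l; exact: h'.
  apply: (measurableT_comp mtr).
  exact: (measurable_position_at bmB).
have surv0 k w : 0 <= survival k w by rewrite mulr_ge0.
apply: (@le_trans _ _ (\int[P]_w F (now w, next w))%E).
  apply: ge0_le_integral => //.
  - by move=> w _; rewrite lee_fin.
  - by apply: (measurableT_comp mF); exact: measurable_fun_pair.
  - move=> w _; rewrite /F lee_fin ger0_norm//= /survival.
    have -> : position B x (grid m) w + Num.sqrt 2 *: next w =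
        position B x (grid m.+1) w.
      by rewrite /position /next -addrA -scalerDr subrKC.
    rewrite ler_wpM2r// !indicE ler_nat.
    have [|] := boolP (w \in alive_grid m.+1) => //.
    rewrite !inE => al; suff -> : w \in alive_grid m by [].
    by rewrite inE => k km; apply: al; exact: leqW.
rewrite (ge0_integral_indep mnow mnext _ mF F0); last first.
  move=> A1 A2 mA1 mA2; apply: (@generated_indep _ _ _ P _ X _ _ past).
  - by move=> ik; apply: (measurable_increment bmB) => //; exact: ltW.
  - exact: increments_indep.
  - exact: now_past.
  - exact: next_future.
rewrite -ge0_integralZl//; last by move=> w _; rewrite lee_fin.
apply: ge0_le_integral => //.
- by move=> w _; exact: integral_ge0.
- have mF' : measurable_fun setT (fun p : Omega * Omega => F (now p.1, next p.2)).
    apply: (measurableT_comp mF); apply: measurable_fun_pair.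
      exact: (measurableT_comp mnow measurable_fst).
    exact: (measurableT_comp mnext measurable_snd).
  exact: (@measurable_fun_fubini_tonelli_F _ _ _ _ _ P _ mF').
- by apply: emeasurable_funM => //; exact: msurv.
- move=> w _; rewrite /F/= /survival ger0_norm//.
  under eq_integral do rewrite EFinM.
  rewrite ge0_integralZl//; last 2 first.
  + apply/measurable_EFinP; apply: (measurableT_comp mtr).
    apply: measurable_fun_rV => i; rewrite (_ : (fun _ => _) = (fun w' =>
      position B x (grid m) w ord0 i + Num.sqrt 2 * next w' ord0 i)); last first.
      by apply/funext => w'; rewrite !mxE.
    apply: measurable_funD => //; apply: measurable_funM => //.
    exact: (measurableT_comp (measurable_coord_rV i) mnext).
  + by move=> w' _; rewrite lee_fin.
  rewrite indicE; have [|] := boolP (w \in alive_grid m); last first.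
    by move=> _; rewrite mul0e mul0r mule0.
  rewrite inE => al; rewrite mul1e mul1r -EFinM.
  have Km := al m (leqnn _).
  by apply: (le_trans (hq _ Km)); rewrite patchE mem_set.
Qed.

End past.
End discrete.

(** By the eigenvalue equation one step multiplies u by 1 - lam h, up to errors;
    these are absorbed in multiples of u, which is bounded below on a compact
    subset of D. *)
Lemma discrete_decay n e : 0 < e -> exists2 C, 0 <= C &
  forall h x m, 0 < h -> inner D n x ->
  (\int[P]_w (survival n h x m w)%:E <=
   (expR (m%:R * (- lam * h + e * h + C * h ^+ 2)) * u x)%:E)%E.
Proof.
move=> e0; have [m0 m00 um0] := inner_lower n.
have [C C0 hC] := one_step bmB oD bD C2u u_ge0 n (mulr_gt0 e0 m00).
exists (C / m0); first by rewrite divr_ge0// ltW.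
move=> h x m h0 Kx; set q := _ + _ * h ^+ 2.
have step k : (\int[P]_w (survival n h x k.+1 w)%:E <=
    (expR q)%:E * \int[P]_w (survival n h x k w)%:E)%E.
  apply: (@survival_step n h x h0 k (expR q)) => [|y Ky]; first exact: expR_ge0.
  apply: (le_trans (hC 0 h k y (lexx _) h0 Ky)); rewrite lee_fin.
  have Dy := inner_sub Ky; have uy := u_gt0 Dy.
  have -> : laplacian u y = - (lam * u y) by rewrite -eigen_u// opprK.
  apply: (@le_trans _ _ ((1 + q) * u y)); last first.
    by rewrite ler_wpM2r ?expR_ge1Dx// ltW.
  have h1 : e * m0 * h <= e * h * u y.
    by rewrite mulrAC ler_wpM2l ?um0// mulr_ge0// ltW.
  have h2 : C * h ^+ 2 <= C / m0 * h ^+ 2 * u y.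
    rewrite mulrAC ler_wpM2r ?exprn_ge0 ?(ltW h0)//.
    rewrite -mulrA ler_peMr// mulrC ler_pdivlMr// mul1r.
    exact: um0.
  by rewrite /q; lra.
elim: m => [|m IH].
  rewrite mul0r expR0 mul1r.
  apply: (@le_trans _ _ (\int[P]_w (cst (u x)%:E w))%E); last first.
    by rewrite integral_cst// [X in (_ * X)%E]probability_setT mule1.
  have pos0 w : position B x (grid h 0) w = x.
    have [_ B0 _ _ _] := bmB.
    by rewrite /position /grid mul0r addr0 B0 scaler0 addr0.
  have Dx := inner_sub Kx; have ux := u_ge0 Dx.
  apply: ge0_le_integral => //.
  - by move=> w _; rewrite /survival pos0 lee_fin mulr_ge0// trunc_ge0.
  - rewrite /survival; under eq_fun do rewrite pos0.
    apply/measurable_EFinP; apply: measurable_funM => //.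
    apply: measurable_indic.
    rewrite (_ : alive_grid _ _ _ _ = setT)//.
    apply/seteqP; split=> // w _ k; rewrite leqn0 => /eqP ->.
    by rewrite pos0.
  - move=> w _; rewrite /survival pos0 lee_fin patchE mem_set// indicE.
    by case: (_ \in _); rewrite ?mul1r ?mul0r.
rewrite -natr1 mulrDl mul1r expRD mulrAC EFinM muleC.
by apply: (le_trans (step m)); rewrite lee_wpmul2l.
Qed.

Let alive_inner x t (n : nat) : set Omega :=
  [set w | forall q : rat, 0 <= (ratr q : R) <= 1 ->
    inner D n (position B x (Num.max 0 (ratr q * t)) w)].

Let measurable_alive_inner x t n : measurable (alive_inner x t n).
Proof.
rewrite (_ : alive_inner x t n = ~` \bigcup_(q in [set q | 0 <= (ratr q : R) <= 1])
    (position B x (Num.max 0 (ratr q * t)) @^-1` (~` inner D n))).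
  apply: measurableC; rewrite bigcup_mkcond; apply: bigcupT_measurable_rat => q.
  case: ifP => // _; rewrite -[X in measurable X]setTI.
  apply: (measurable_position_at bmB); rewrite ?le_max ?lexx//.
  by apply: measurableC; apply: closed_measurable_rV; exact: closed_inner.
apply/seteqP; split=> w.
  by move=> al [q q01] /=; apply; exact: al.
by move=> nal q q01; apply: contrapT => nq; apply: nal; exists q.
Qed.

(** A path that stays in the compact set is in it at the points of a grid of
    step t / (N + 1), with N so large that the quadratic errors add up to less
    than e / 2. *)
Lemma killed_decay_inner n x t e : inner D n x -> 0 < t -> 0 < e ->
  (\int[P]_(w in alive_inner x t n) (u (position B x t w))%:E <=
   (expR (- lam * t + e) * u x)%:E)%E.
Proof.
move=> Kx t0 e0; pose e' := e / (2 * t).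
have e'0 : 0 < e' by rewrite divr_gt0// mulr_gt0.
have [C C0 hC] := discrete_decay n e'0.
have [N NC] : exists N : nat, 2 * C * t ^+ 2 / e <= N.+1%:R.
  have [N _ /(_ N (leqnn _)) hN] := nbhs_infty_ger (2 * C * t ^+ 2 / e).
  by exists N; rewrite (le_trans hN)// ler_nat.
pose h := t / N.+1%:R; have h0 : 0 < h by rewrite divr_gt0.
apply: (@le_trans _ _ (\int[P]_w (survival n h x N.+1 w)%:E)%E).
  rewrite integral_mkcond.
  have gN : grid h N.+1 = t by rewrite /grid add0r /h mulrC divfK.
  have sub w : alive_inner x t n w -> alive_grid n h x N.+1 w.
    move=> al k kN; have := al (k%:R / N.+1%:R).
    have -> : ratr (k%:R / N.+1%:R) = k%:R / N.+1%:R :> R.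
      by rewrite fmorph_div/= !ratr_nat.
    rewrite divr_ge0//= ler_pdivrMr// mul1r ler_nat kN => /(_ isT).
    by rewrite max_r ?mulr_ge0 ?divr_ge0 ?(ltW t0)// /grid add0r /h mulrAC mulrA.
  apply: ge0_le_integral => //.
  - move=> w _; rewrite patchE; case: ifPn => // /set_mem /sub/(_ N.+1 (leqnn _)).
    by rewrite gN lee_fin => /inner_sub/u_ge0.
  - apply/(measurable_restrictT _ (measurable_alive_inner x t n)).1.
    apply/measurable_EFinP.
    apply: (measurable_comp (F := D)) (measurable_C2 oD C2u) _.
    + exact: open_measurable_rV.
    + move=> _ [w /sub/(_ N.+1 (leqnn _)) + <-].
      by rewrite gN; exact: inner_sub.
    + by apply: measurable_funTS; apply: (measurable_position_at bmB); exact: ltW.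
  - apply/measurable_EFinP; apply: measurable_funM.
      apply: measurable_indic.
      rewrite (_ : alive_grid _ _ _ _ = \bigcap_(l in [set l | (l <= N.+1)%N])
          (position B x (grid h l) @^-1` inner D n)).
        apply: bigcap_measurable; first by exists 0%N.
        move=> l /= _; rewrite -[X in measurable X]setTI.
        apply: (measurable_position_at bmB) => //.
          by rewrite /grid add0r mulr_ge0// ltW.
        by apply: closed_measurable_rV; exact: closed_inner.
      by apply/seteqP; split=> w h' l; exact: h'.
    apply: (measurableT_comp (measurable_trunc oD C2u n)).
    by apply: (measurable_position_at bmB); rewrite gN ltW.
  - move=> w _; rewrite patchE; case: ifPn => [/set_mem/sub al|_].
      rewrite /survival indicE mem_set// mul1r gN patchE mem_set//.
      by have := al N.+1 (leqnn _); rewrite gN.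
    by rewrite lee_fin mulr_ge0// trunc_ge0.
apply: (le_trans (hC h x N.+1 h0 Kx)); rewrite lee_fin.
rewrite ler_wpM2r ?u_ge0 ?ler_expR//; first exact: inner_sub Kx.
have -> : N.+1%:R * (- lam * h + e' * h + C * h ^+ 2) =
    - lam * t + e / 2 + C * t ^+ 2 / N.+1%:R.
  by rewrite /h /e'; field; rewrite !gt_eqF// mulr_gt0.
rewrite -addrA lerD2l [leRHS]splitr lerD2l ler_pdivrMr//.
by move: NC; rewrite ler_pdivrMr//; lra.
Qed.

(** The paths alive at time t are exhausted by those that stay in the n-th
    compact subset, to which [killed_decay_inner] applies. *)
Lemma killed_semigroup_decay x t : D x -> 0 <= t ->
  (killed_semigroup P B D t u x <= (expR (- lam * t) * u x)%:E)%E.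
Proof.
move=> Dx; rewrite le_eqVlt => /predU1P[<-|t0].
  rewrite mulr0 expR0 mul1r /killed_semigroup.
  have pos0 w : position B x 0 w = x.
    by have [_ B0 _ _ _] := bmB; rewrite /position B0 scaler0 addr0.
  have ma := measurable_alive bmB oD x (lexx 0).
  under eq_integral do rewrite pos0.
  rewrite integral_cst//= -[leRHS]mule1 lee_wpmul2l ?lee_fin ?u_ge0//.
  exact: probability_le1.
have aliveE : alive B D x t = \bigcup_n alive_inner x t n.
  apply/seteqP; split=> w; first by move=> /(aliveP bmB oD) -/(_ (ltW t0))[n al]; exists n.
  by move=> [n _ al]; apply/(aliveP bmB oD); [exact: ltW|exists n].
have ndE : nondecreasing_seq (alive_inner x t).
  move=> m n mn; apply/subsetPset => w al q q01.
  by apply: inner_mono mn _ _; exact: al.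
have sub n : alive_inner x t n `<=` alive B D x t.
  by rewrite aliveE; exact: bigcup_sup.
have mf := measurable_alive_fun bmB oD (x := x) (ltW t0) (measurable_C2 oD C2u).
have f0 n w : alive_inner x t n w -> (0 <= (u (position B x t w))%:E)%E.
  by move=> /sub/(alive_position (ltW t0))/u_ge0; rewrite lee_fin.
have := ge0_nondecreasing_set_cvg_integral (mu := P) ndE
  (measurable_alive_inner x t) (fun n => measurable_funS
    (measurable_alive bmB oD x (ltW t0)) (@sub n) mf) f0.
rewrite -aliveE -/(killed_semigroup P B D t u x) => cvg.
have bound e : 0 < e ->
    (killed_semigroup P B D t u x <= (expR (- lam * t + e) * u x)%:E)%E.
  move=> e0; apply: cvge_le cvg.
  have [[U V] [/= Ux nV] UV] := near_inner oD Dx.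
  apply: filterS nV => n Vn; apply: killed_decay_inner => //.
  by apply: (UV (x, n)); split=> //=; exact: nbhs_singleton.
have L0 : (0 <= killed_semigroup P B D t u x)%E.
  apply: integral_ge0 => w /(alive_position (ltW t0))/u_ge0.
  by rewrite lee_fin.
have fL : killed_semigroup P B D t u x \is a fin_num.
  by rewrite ge0_fin_numE// (le_lt_trans (bound _ ltr01))// ltry.
pose c := expR (- lam * t) * u x.
have c0 : 0 < c by rewrite mulr_gt0 ?expR_gt0 ?u_gt0.
rewrite -(fineK fL) lee_fin -/c; apply/ler_addgt0Pr => e e0.
(* With this choice c exp e' <= c (1 + 2 e') <= c + e. *)
pose e' := Num.min 2^-1 (e / (2 * c)).
have e'0 : 0 < e'.
  rewrite lt_min; apply/andP; split; first by rewrite invr_gt0.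
  by rewrite divr_gt0// mulr_gt0.
have := bound _ e'0; rewrite -(fineK fL) lee_fin expRD mulrAC -/c.
move=> /le_trans; apply.
have e'1 : e' <= 2^-1 by rewrite ge_min lexx.
have e'2 : c * e' <= e / 2.
  rewrite mulrC -ler_pdivlMr//; apply: (@le_trans _ _ (e / (2 * c))).
    by rewrite ge_min lexx orbT.
  by rewrite invfM mulrA.
have := @expR_first_order _ e'; rewrite gtr0_norm// => /(_ e'1).
rewrite ler_norml => /andP[_ h].
have h2 : expR e' <= 1 + 2 * e' by nra.
apply: (@le_trans _ _ (c * (1 + 2 * e'))); first by rewrite ler_pM2l.
by lra.
Qed.

End supermartingale.

(** * The Bernoulli equation *)

Section bernoulli_equation.
Context {R : realType}.
Local Notation mu := (@lebesgue_measure R).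
Variables (rho : R -> R) (c0 beta theta : R).
Hypotheses (crho : continuous rho) (c0_ge0 : 0 <= c0) (beta_gt0 : 0 < beta).
Hypothesis theta_lt1 : theta < 1.
Local Notation J t := (\int[mu]_(r in `[0, t]) rho r)%R.
Hypothesis J_le : forall t, beta * c0 * J t <= theta.

Let base (t : R) : R := 1 - beta * c0 * J t.

(** The solution of phi' = c0 rho phi^(1 + beta), phi 0 = 1. *)
Definition bernoulli (t : R) : R := base t `^ (- beta^-1).
Local Notation phi := bernoulli.

Let base_ge t : 1 - theta <= base t.
Proof. by rewrite /base lerD2l lerN2. Qed.

Let base_gt0 t : 0 < base t.
Proof. by apply: lt_le_trans (base_ge t); rewrite subr_gt0. Qed.

Lemma bernoulli_gt0 t : 0 < phi t.
Proof. by rewrite powR_gt0. Qed.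

Lemma bernoulli_le t : phi t <= (1 - theta) `^ (- beta^-1).
Proof.
have b0 := base_gt0 t; have th0 : 0 < 1 - theta by rewrite subr_gt0.
rewrite /phi !powRN lef_pV2 ?posrE ?powR_gt0//.
apply: ge0_ler_powR; rewrite ?nnegrE ?(ltW b0) ?(ltW th0)//.
by rewrite invr_ge0 ltW.
Qed.

Let irho t : mu.-integrable `[0, t] (EFin \o rho).
Proof.
apply: continuous_compact_integrable; first exact: segment_compact.
exact: continuous_subspaceT.
Qed.

Let continuous_base t : 0 <= t -> {within `[0, t], continuous base}.
Proof.
move=> t0; have := parameterized_integral_continuous t0 (irho t).
move=> cJ x; apply: cvgB; first exact: cvg_cst.
by apply: cvgM; [exact: cvg_cst|exact: cJ].
Qed.

Let is_derive_base (t : R) : 0 < t -> is_derive t 1 base (- (beta * c0 * rho t)).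
Proof.
move=> t0; have t1 : t < t + 1 by rewrite ltrDl.
have [dJ JE] := continuous_FTC1_closed t1 (irho (t + 1)) t0 (@crho t).
have iJ : is_derive t 1 (fun t => J t) (rho t).
  by apply: DeriveDef; [exact: dJ|rewrite -derive1E; exact: JE].
rewrite /base; apply: is_derive_eq.
by rewrite /GRing.scale/= add0r mul1r.
Qed.

Let powR_continuous a x : 0 < x -> {for x, continuous (fun y : R => y `^ a)}.
Proof.
move=> x0; apply: differentiable_continuous; apply/derivable1_diffP.
by have [] := is_derive1_powR a x0.
Qed.

Let continuous_phi t : 0 <= t -> {within `[0, t], continuous phi}.
Proof.
move=> t0 x; apply: (@continuous_comp (subspace `[0, t]) _ _ base
  (fun y : R => y `^ (- beta^-1))); first exact: continuous_base.
exact: powR_continuous.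
Qed.

Lemma continuous_bernoulli_rhs t : 0 <= t ->
  {within `[0, t], continuous (fun r => c0 * rho r * phi r `^ (1 + beta))}.
Proof.
move=> t0 x; apply: cvgM.
  apply: cvgM; first exact: cvg_cst.
  exact: (continuous_subspaceT crho).
apply: (@continuous_comp (subspace `[0, t]) _ _ phi
  (fun y : R => y `^ (1 + beta))); first exact: continuous_phi.
exact/powR_continuous/bernoulli_gt0.
Qed.

Lemma bernoulli_integral t : 0 <= t ->
  (\int[mu]_(r in `[0%R, t]) (c0 * rho r * phi r `^ (1 + beta))%:E =
   (phi t - 1)%:E)%E.
Proof.
have phi0 : phi 0 = 1.
  rewrite /phi /base set_itv1 Rintegral_set1 mulr0 subr0.
  by rewrite powR1.
rewrite le_eqVlt => /predU1P[<-|t0].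
  by rewrite set_itv1 integral_set1 phi0 subrr.
have dphi (r : R) : 0 < r -> is_derive r 1 phi (c0 * rho r * phi r `^ (1 + beta)).
  move=> r0; have [dq dqE] := is_derive_base r0.
  have [dp dpE] := is_derive1_powR (- beta^-1) (base_gt0 r).
  have b0 : beta != 0 by rewrite gt_eqF.
  have -> : c0 * rho r * phi r `^ (1 + beta) =
      - beta^-1 * base r `^ (- beta^-1 - 1) * (- (beta * c0 * rho r)).
    rewrite /phi -powRrM.
    rewrite (_ : - beta^-1 * (1 + beta) = - beta^-1 - 1); last by field.
    by field.
  apply: DeriveDef.
    apply/derivable1_diffP; apply: (@differentiable_comp _ _ _ _ base
      (fun y : R => y `^ (- beta^-1))); apply/derivable1_diffP.
      exact: dq.
    exact: dp.
  rewrite -derive1E (@derive1_comp _ base (fun y : R => y `^ (- beta^-1)));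
    [|exact: dq|exact: dp].
  by rewrite !derive1E dqE dpE.
rewrite (continuous_FTC2 (F := phi) t0).
- by rewrite phi0.
- exact: continuous_bernoulli_rhs (ltW t0).
- have /(continuous_within_itvP _ t0)[_ c1 c2] := continuous_phi (ltW t0).
  split; [|exact: c1|exact: c2] => x; rewrite in_itv/= => /andP[x0 _].
  by case: (dphi x x0).
- move=> x; rewrite in_itv/= => /andP[x0 _].
  by rewrite derive1E; case: (dphi x x0).
Qed.

End bernoulli_equation.

(** * Supremum and integral of the eigenfunction *)

Section finite_volume.
Context {R : realType}.

Definition box n (M : R) : set 'rV[R]_n :=
  [set x | forall i, `[- M, M]%classic (x ord0 i)].

Lemma measurable_box n M : measurable (@box n M).
Proof.
rewrite (_ : @box n M = \bigcap_(i in [set: 'I_n])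
    ((fun x : 'rV[R]_n => x ord0 i) @^-1` `[- M, M])).
  apply: fin_bigcap_measurable => // i _; rewrite -[X in measurable X]setTI.
  by apply: measurable_coord_rV.
by apply/seteqP; split=> x h i; [move=> _; exact: h|exact: (h i Logic.I)].
Qed.

Lemma lebesgue_rV_box n M : (lebesgue_rV n (@box n M) < +oo)%E.
Proof.
elim: n => [|n IH].
  by rewrite /= diracE ltry.
rewrite /= /cons_measure /pushforward.
rewrite (_ : _ @^-1` _ = `[- M, M] `*` @box n M).
  rewrite product_measure1E//; last exact: measurable_box.
  have mI : (@lebesgue_measure R `[(- M)%R, M]%classic < +oo)%E.
    by rewrite lebesgue_measure_itv/=; case: ifP => // _; rewrite -EFinB ltry.
  by rewrite lte_mul_pinfty// ge0_fin_numE.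
apply/seteqP; split=> [[a x] /= h|[a x] [/= h1 h2] i].
  split=> [|i].
    have := h (@lshift 1 n ord0).
    by rewrite /cons_rV/= (@row_mxEl _ 1 1 n) mxE eqxx mulr1n.
  have := h (@rshift 1 n i).
  by rewrite /cons_rV/= (@row_mxEr _ 1 1 n).
rewrite /cons_rV; case: (@splitP 1 n i) => j ij.
  have -> : i = @lshift 1 n j by exact/val_inj.
  by rewrite (@row_mxEl _ 1 1 n) mxE !ord1.
have -> : i = @rshift 1 n j by exact/val_inj.
by rewrite (@row_mxEr _ 1 1 n).
Qed.

Variables (d : nat) (D : set 'rV[R]_d) (u : 'rV[R]_d -> R).
Hypotheses (D0 : D !=set0) (oD : open D) (bD : bounded_set D).
Hypothesis cu : {within closure D, continuous u}.
Hypothesis u_gt0 : forall x, D x -> 0 < u x.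

Lemma lebesgue_rV_bounded : (lebesgue_rV d D < +oo)%E.
Proof.
have [M M0 DM] := bounded_rVP bD.
apply: le_lt_trans (lebesgue_rV_box d M); apply: le_measure.
- by rewrite inE; exact: open_measurable_rV.
- by rewrite inE; exact: measurable_box.
- by move=> x Dx i /=; rewrite in_itv/= -ler_norml; exact: DM.
Qed.

Lemma has_sup_image : has_sup (u @` D).
Proof.
split; first by have [x Dx] := D0; exists (u x), x.
have cl : compact (closure D).
  apply: bounded_closed_compact; last exact: closed_closure.
  have [M M0 DM] := bounded_rVP bD.
  have : bounded_set (@box d M).
    apply: compact_bounded.
    apply: (@rV_compact R d (fun=> `[- M, M]%classic)) => _.
    exact: segment_compact.
  move=> [N [Nr hN]]; exists N; split=> // r /hN h x Dx; apply: h => i /=.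
  have cM : closed [set x : 'rV[R]_d | `[- M, M]%classic (x ord0 i)].
    apply: (@closed_comp _ _ (fun x : 'rV[R]_d => x ord0 i)).
      by move=> y _; exact: coord_continuous.
    exact: itv_closed.
  have sub : D `<=` [set x | `[- M, M]%classic (x ord0 i)].
    by move=> y Dy /=; rewrite in_itv/= -ler_norml; exact: DM.
  by have := closure_subset sub Dx; rewrite -((closure_id _).1 cM).
have /compact_bounded[N [Nr hN]] := continuous_compact cu cl.
exists (N + 1) => _ [x Dx <-]; apply: (le_trans (ler_norm _)).
apply: (hN (N + 1)); first by rewrite ltrDl.
by exists x => //; exact: subset_closure.
Qed.

Lemma le_sup_image x : D x -> u x <= sup (u @` D).
Proof.
by move=> Dx; apply: sup_upper_bound; [exact: has_sup_image|exists x].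
Qed.

Lemma sup_image_gt0 : 0 < sup (u @` D).
Proof.
by have [x Dx] := D0; apply: lt_le_trans (le_sup_image Dx); exact: u_gt0.
Qed.

(** 1 = int u^2 <= (sup u) int u. *)
Lemma sup_integral_ge1 :
  measurable_fun D u ->
  (\int[lebesgue_rV d]_(x in D) ((u x) ^+ 2)%:E = 1)%E ->
  1 <= sup (u @` D) * \int[lebesgue_rV d]_(y in D) u y.
Proof.
move=> mu u2; have mD := open_measurable_rV oD.
have iu : (\int[lebesgue_rV d]_(y in D) (u y)%:E)%E \is a fin_num.
  rewrite ge0_fin_numE; last first.
    by apply: integral_ge0 => x Dx; rewrite lee_fin ltW// u_gt0.
  apply: (@le_lt_trans _ _ (\int[lebesgue_rV d]_(y in D) cst (sup (u @` D))%:E y)%E).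
    apply: ge0_le_integral => //.
    - by move=> x Dx; rewrite lee_fin ltW// u_gt0.
    - exact/measurable_EFinP.
    - by move=> x Dx; rewrite lee_fin le_sup_image.
  rewrite integral_cst// lte_mul_pinfty//; last exact: lebesgue_rV_bounded.
  by rewrite lee_fin ltW// sup_image_gt0.
rewrite -lee_fin EFinM /Rintegral fineK// -u2.
rewrite -ge0_integralZl//; last 3 first.
- exact/measurable_EFinP.
- by move=> x Dx; rewrite lee_fin ltW// u_gt0.
- by rewrite lee_fin ltW// sup_image_gt0.
apply: ge0_le_integral => //.
- by move=> x Dx; rewrite lee_fin sqr_ge0.
- by apply/measurable_EFinP; exact: measurable_funX.
- by apply: emeasurable_funM => //; exact/measurable_EFinP.
- move=> x Dx; rewrite -EFinM lee_fin expr2 ler_wpM2r ?le_sup_image//.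
  by rewrite ltW// u_gt0.
Qed.

End finite_volume.

(** * The mild equation as a fixed point problem *)

Section killed_semigroup_theory.
Context {R : realType} {dO : measure_display} {Omega : measurableType dO}.
Context {d : nat}.
Variables (P : probability Omega R) (B : R -> Omega -> 'rV[R]_d).
Variable D : set 'rV[R]_d.
Hypotheses (bmB : brownian_motion P B) (oD : open D).
Local Notation S := (killed_semigroup P B D).
Implicit Types (t a : R) (u v : 'rV[R]_d -> R) (x y : 'rV[R]_d).

Lemma killed_semigroup_ge0 t u x : 0 <= t -> (forall y, D y -> 0 <= u y) ->
  (0 <= S t u x)%E.
Proof.
move=> t0 u0; apply: integral_ge0 => w /(alive_position t0)/u0.
by rewrite lee_fin.
Qed.

Lemma eq_killed_semigroup t u v x : 0 <= t -> (forall y, D y -> u y = v y) ->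
  S t u x = S t v x.
Proof.
by move=> t0 uv; apply: eq_integral => w /set_mem/(alive_position t0)/uv ->.
Qed.

Lemma le_killed_semigroup t u v x : 0 <= t -> measurable_fun D u ->
  measurable_fun D v -> (forall y, D y -> 0 <= u y <= v y) ->
  (S t u x <= S t v x)%E.
Proof.
move=> t0 mu mv uv; apply: ge0_le_integral.
- exact: (measurable_alive bmB oD).
- by move=> w /(alive_position t0)/uv/andP[]; rewrite lee_fin.
- exact: (measurable_alive_fun bmB oD).
- exact: (measurable_alive_fun bmB oD).
- by move=> w /(alive_position t0)/uv/andP[]; rewrite lee_fin.
Qed.

Lemma killed_semigroupZ t a u x : 0 <= t -> 0 <= a -> measurable_fun D u ->
  (forall y, D y -> 0 <= u y) -> S t (fun y => a * u y) x = (a%:E * S t u x)%E.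
Proof.
move=> t0 a0 mu u0; rewrite /killed_semigroup.
under eq_integral do rewrite EFinM.
rewrite ge0_integralZl//.
- exact: (measurable_alive bmB oD).
- exact: (measurable_alive_fun bmB oD).
- by move=> w /(alive_position t0)/u0; rewrite lee_fin.
Qed.

Lemma killed_semigroupD t u v x : 0 <= t -> measurable_fun D u ->
  measurable_fun D v -> (forall y, D y -> 0 <= u y) ->
  (forall y, D y -> 0 <= v y) ->
  S t (fun y => u y + v y) x = (S t u x + S t v x)%E.
Proof.
move=> t0 mu mv u0 v0; rewrite /killed_semigroup.
under eq_integral do rewrite EFinD.
rewrite ge0_integralD//.
- exact: (measurable_alive bmB oD).
- by move=> w /(alive_position t0)/u0; rewrite lee_fin.
- exact: (measurable_alive_fun bmB oD).
- by move=> w /(alive_position t0)/v0; rewrite lee_fin.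
- exact: (measurable_alive_fun bmB oD).
Qed.

Lemma killed_semigroup_cst_le t a x : 0 <= t -> 0 <= a ->
  (S t (cst a) x <= a%:E)%E.
Proof.
move=> t0 a0; have ma := measurable_alive bmB oD x t0.
have -> : S t (cst a) x = (a%:E * P (alive B D x t))%E.
  exact: (@integral_cst _ _ _ P _ ma a%:E).
by rewrite -[leRHS]mule1 lee_wpmul2l ?lee_fin//; exact: probability_le1.
Qed.

Lemma cvg_killed_semigroup t (u_ : nat -> 'rV[R]_d -> R) u x : 0 <= t ->
  (forall n, measurable_fun D (u_ n)) ->
  (forall n y, D y -> 0 <= u_ n y) ->
  (forall y, D y -> nondecreasing_seq (u_ ^~ y)) ->
  (forall y, D y -> u_ n y @[n --> \oo] --> u y) ->
  S t (u_ n) x @[n --> \oo] --> S t u x.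
Proof.
move=> t0 mu u0 ndu cu.
have -> : S t u x = (\int[P]_(w in alive B D x t)
    limn (fun n => (u_ n (position B x t w))%:E))%E.
  apply: eq_integral => w /set_mem/(alive_position t0) Dw.
  apply/esym/cvg_lim => //; apply: cvg_EFin; first exact: nearW.
  exact: cu.
apply: cvg_monotone_convergence.
- exact: (measurable_alive bmB oD).
- by move=> n; exact: (measurable_alive_fun bmB oD).
- by move=> n w /(alive_position t0)/(u0 n); rewrite lee_fin.
- move=> w /(alive_position t0)/ndu h m n mn.
  by rewrite lee_fin; exact: h.
Qed.

End killed_semigroup_theory.

Section mild_map.
Context {R : realType} {dO : measure_display} {Omega : measurableType dO}.
Context {d : nat}.
Variables (P : probability Omega R) (B : R -> Omega -> 'rV[R]_d).
Variable D : set 'rV[R]_d.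
Hypotheses (bmB : brownian_motion P B) (oD : open D).
Variables (kappa : R) (f : 'rV[R]_d -> R).
Hypotheses (mf : measurable_fun D f) (f_ge0 : forall x, D x -> 0 <= f x).
Local Notation S := (killed_semigroup P B D).
Local Notation mu := (@lebesgue_measure R).
Implicit Types (g : R -> 'rV[R]_d -> R).

(** A mild solution is a fixed point v of the composite of this map with
    v |-> exp (- kappa W) G (exp (kappa W) v). *)
Definition mild_map g (t : R) (x : 'rV[R]_d) : \bar R :=
  ((expR (- (kappa ^+ 2 * t / 2)))%:E * S t f x +
   \int[mu]_(r in `[0%R, t])
     ((expR (- (kappa ^+ 2 * (t - r) / 2)))%:E * S (t - r) (g r) x))%E.

Definition source_term g :=
  measurable_fun setT (fun z : R * 'rV[R]_d => g z.1 z.2) /\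
  forall r y, 0 <= g r y.

Lemma source_term_measurable g r : source_term g -> measurable_fun D (g r).
Proof.
move=> [mg _]; apply: measurable_funTS.
exact: (measurable_fun_pair2 (f := fun z : R * 'rV[R]_d => g z.1 z.2) r mg).
Qed.

Let integrand g (z : (R * 'rV[R]_d) * R) : \bar R :=
  ((expR (- (kappa ^+ 2 * (z.1.1 - z.2) / 2)))%:E *
   S (Num.max 0 (z.1.1 - z.2))%R (g z.2) z.1.2)%E.

Let measurable_integrand g : source_term g -> measurable_fun setT (integrand g).
Proof.
move=> [mg g0].
have m12 : measurable_fun setT (fun z : (R * 'rV[R]_d) * R => z.1.1 - z.2).
  apply: measurable_funB => //.
  exact: (measurableT_comp measurable_fst measurable_fst).
apply: emeasurable_funM.
  apply/measurable_EFinP; apply: measurableT_comp => //.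
  apply: measurableT_comp => //; apply: measurable_funM => //.
  exact: measurable_funM.
apply: (measurable_killed_semigroup bmB oD (tau := fun z : (R * 'rV[R]_d) * R => z.1.1 - z.2)
  (xi := fun z => z.1.2) (u := fun z => g z.2)) => //.
  exact: (measurableT_comp measurable_snd measurable_fst).
apply: (measurableT_comp (f := fun z : R * 'rV[R]_d => g z.1 z.2)
  (g := fun p : ((R * 'rV[R]_d) * R) * 'rV[R]_d => (p.1.2, p.2))) => //.
apply: measurable_fun_pair => //.
exact: (measurableT_comp measurable_snd measurable_fst).
Qed.

Let integrand_ge0 g z : source_term g -> (0 <= integrand g z)%E.
Proof.
move=> [_ g0]; rewrite mule_ge0 ?lee_fin ?expR_ge0//.
by apply: killed_semigroup_ge0; rewrite ?le_max ?lexx.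
Qed.

Let integrandE g t r x : `[0, t]%classic r -> integrand g ((t, x), r) =
  ((expR (- (kappa ^+ 2 * (t - r) / 2)))%:E * S (t - r) (g r) x)%E.
Proof.
by rewrite /= in_itv/= => /andP[r0 rt]; rewrite /integrand/= max_r// subr_ge0.
Qed.

Lemma measurable_mild_integrand g t x : source_term g ->
  measurable_fun (`[0, t]%classic : set R)
   (fun r => ((expR (- (kappa ^+ 2 * (t - r) / 2)))%:E * S (t - r) (g r) x)%E).
Proof.
move=> sg; apply: (eq_measurable_fun (fun r => integrand g ((t, x), r))).
  by move=> r /set_mem rt; rewrite integrandE.
apply: measurable_funTS.
exact: (measurable_fun_pair2 (t, x) (measurable_integrand sg)).
Qed.

Lemma mild_integrand_ge0 g t x r : source_term g -> `[0, t]%classic r ->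
  (0 <= (expR (- (kappa ^+ 2 * (t - r) / 2)))%:E * S (t - r) (g r) x)%E.
Proof. by move=> sg rt; rewrite -integrandE//; exact: integrand_ge0. Qed.

Lemma mild_map_ge0 g t x : source_term g -> 0 <= t -> (0 <= mild_map g t x)%E.
Proof.
move=> sg t0; apply: adde_ge0.
  by rewrite mule_ge0 ?lee_fin ?expR_ge0//; exact: killed_semigroup_ge0.
by apply: integral_ge0 => r rt; exact: mild_integrand_ge0.
Qed.

(** Tonelli's theorem on the set of the (t, x, r) with 0 <= r <= t. *)
Lemma measurable_mild_map g : source_term g ->
  measurable_fun setT (fun z : R * 'rV[R]_d => mild_map g (Num.max 0 z.1) z.2).
Proof.
move=> sg; apply: emeasurable_funD.
  apply: emeasurable_funM.
    apply/measurable_EFinP; apply: measurableT_comp => //.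
    apply: measurableT_comp => //; apply: measurable_funM => //.
    by apply: measurable_funM => //; exact: measurable_maxr.
  have fE z : S (Num.max 0 z.1) f z.2 = S (Num.max 0 z.1) (f \_ D) z.2 :> \bar R.
    apply: eq_killed_semigroup; first by rewrite le_max lexx.
    by move=> y Dy; rewrite patchE mem_set.
  under eq_fun do rewrite fE.
  apply: (measurable_killed_semigroup bmB oD (tau := fst) (xi := snd)
    (u := fun _ : R * 'rV[R]_d => f \_ D)) => //.
    apply: (measurableT_comp (f := f \_ D)) => //.
    exact: (measurable_restrictT f (open_measurable_rV oD)).1 mf.
  by move=> _ y; rewrite patchE; case: ifPn => // /set_mem/f_ge0.
pose A : set ((R * 'rV[R]_d) * R) :=
  [set z | 0 <= z.2] `&` [set z | z.2 <= Num.max 0 z.1.1].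
have mA : measurable A.
  have m2 : measurable_fun setT (snd : (R * 'rV[R]_d) * R -> R) by [].
  have m11 : measurable_fun setT (fun z : (R * 'rV[R]_d) * R => Num.max 0 z.1.1).
    apply: measurable_maxr => //.
    exact: (measurableT_comp measurable_fst measurable_fst).
  apply: measurableI.
    have := measurable_fun_le measurableT (measurable_cst (0 : R)) m2.
    by rewrite setTI.
  have := measurable_fun_le measurableT m2 m11.
  by rewrite setTI.
pose F := (fun z => integrand g ((Num.max 0 z.1.1, z.1.2), z.2)) \_ A.
have mF : measurable_fun setT F.
  apply: (measurable_restrictT _ mA).1; apply: measurable_funTS.
  apply: (measurableT_comp (measurable_integrand sg)).
  apply: measurable_fun_pair => //; apply: measurable_fun_pair.
    apply: measurable_maxr => //.
    exact: (measurableT_comp measurable_fst measurable_fst).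
  exact: (measurableT_comp measurable_snd measurable_fst).
have F0 z : (0 <= F z)%E.
  by rewrite /F patchE; case: ifPn => // _; exact: integrand_ge0.
have := measurable_fun_fubini_tonelli_F (m2 := mu) F mF F0.
congr (measurable_fun _ _); apply/funext => -[t x].
rewrite [RHS]integral_mkcond; apply: eq_integral => r _.
rewrite /F !patchE.
have -> : (r \in `[0, Num.max 0 t]%classic) = ((t, x, r) \in A).
  by apply/idP/idP; rewrite !inE /A/= in_itv/= => /andP.
case: ifPn => [/set_mem[/= r0 rt]|_]; last by [].
by rewrite integrandE//= in_itv/= r0.
Qed.

Lemma le_mild_map g1 g2 t x : source_term g1 -> source_term g2 -> 0 <= t ->
  (forall r y, 0 <= r <= t -> D y -> g1 r y <= g2 r y) ->
  (mild_map g1 t x <= mild_map g2 t x)%E.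
Proof.
move=> s1 s2 t0 g12; apply: leeD2l; apply: ge0_le_integral => //.
- by move=> r rt; exact: mild_integrand_ge0.
- exact: measurable_mild_integrand.
- exact: measurable_mild_integrand.
- move=> r; rewrite /= in_itv/= => rt; rewrite lee_wpmul2l ?lee_fin ?expR_ge0//.
  have /andP[r0 r1] := rt.
  apply: le_killed_semigroup => //; rewrite ?subr_ge0//.
  + exact: source_term_measurable.
  + exact: source_term_measurable.
  + by move=> y Dy; rewrite s1.2/= g12.
Qed.

Lemma eq_mild_map g1 g2 t x : (forall r y, 0 <= r <= t -> D y -> g1 r y = g2 r y) ->
  mild_map g1 t x = mild_map g2 t x.
Proof.
move=> g12; congr (_ + _)%E; apply: eq_integral => r /set_mem.
rewrite /= in_itv/= => rt; congr (_ * _)%E; have /andP[r0 r1] := rt.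
by apply: eq_killed_semigroup => [|y Dy]; rewrite ?subr_ge0// g12.
Qed.

(** Monotone convergence, over the paths and then over time. *)
Lemma cvg_mild_map (g_ : nat -> R -> 'rV[R]_d -> R) g t x : 0 <= t ->
  (forall n, source_term (g_ n)) ->
  (forall r y, 0 <= r <= t -> D y -> nondecreasing_seq (fun n => g_ n r y)) ->
  (forall r y, 0 <= r <= t -> D y -> g_ n r y @[n --> \oo] --> g r y) ->
  mild_map (g_ n) t x @[n --> \oo] --> mild_map g t x.
Proof.
move=> t0 sg ndg cg.
pose h n r := ((expR (- (kappa ^+ 2 * (t - r) / 2)))%:E * S (t - r) (g_ n r) x)%E.
have ndh r : `[0, t]%classic r -> nondecreasing_seq (h ^~ r).
  move=> rt m n mn; rewrite lee_wpmul2l ?lee_fin ?expR_ge0//.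
  move: rt; rewrite /= in_itv/= => rt; have /andP[r0 r1] := rt.
  apply: le_killed_semigroup => //; rewrite ?subr_ge0//.
  - exact: source_term_measurable.
  - exact: source_term_measurable.
  - by move=> y Dy; rewrite (sg m).2/=; exact: ndg.
have ch r : `[0, t]%classic r -> h n r @[n --> \oo] -->
    ((expR (- (kappa ^+ 2 * (t - r) / 2)))%:E * S (t - r) (g r) x)%E.
  rewrite /= in_itv/= => rt; have /andP[r0 r1] := rt.
  apply: cvgeZl => //; apply: cvg_killed_semigroup => //; rewrite ?subr_ge0//.
  - by move=> n; exact: source_term_measurable.
  - by move=> n y Dy; exact: (sg n).2.
  - by move=> y Dy; exact: ndg.
  - by move=> y Dy; exact: cg.
have cI : (\int[mu]_(r in `[0%R, t]) h n r @[n --> \oo] -->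
    \int[mu]_(r in `[0%R, t])
     ((expR (- (kappa ^+ 2 * (t - r) / 2)))%:E * S (t - r) (g r) x))%E.
  rewrite [X in _ --> X](_ : _ =
      (\int[mu]_(r in `[0%R, t]) limn (h ^~ r))%E); last first.
    by apply: eq_integral => r /set_mem rt; apply/esym/cvg_lim => //; exact: ch.
  apply: cvg_monotone_convergence => //.
  - by move=> n; exact: measurable_mild_integrand.
  - by move=> n r rt; exact: mild_integrand_ge0.
apply: cvgeD => //; last exact: cvg_cst.
apply: ge0_adde_def; rewrite inE.
  by rewrite mule_ge0 ?lee_fin ?expR_ge0//; exact: killed_semigroup_ge0.
apply: integral_ge0 => r rt; apply: cvge_ge (ch r rt); apply: nearW => n.
exact: mild_integrand_ge0.
Qed.

End mild_map.

(** * The nonlinearity and the source term *)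

Section nonlinearity.
Context {R : realType}.
Variable G : R -> R.
Hypothesis G_ge0 : forall z : R, 0 <= z -> 0 <= G z.
Hypothesis G0 : G 0 = 0.
Hypothesis G_incr : forall x y : R, 0 < x -> x <= y -> G x / x <= G y / y.

Lemma nondecreasing_nonlinearity (x y : R) : 0 <= x -> x <= y -> G x <= G y.
Proof.
rewrite le_eqVlt => /predU1P[<-|x0] xy.
  by rewrite G0 G_ge0.
have y0 := lt_le_trans x0 xy.
have := G_incr x0 xy; rewrite ler_pdivrMr// => /le_trans; apply.
rewrite mulrAC ler_pdivrMr// ler_wpM2l//; exact/G_ge0/ltW.
Qed.

Hypothesis G_lip : forall z : R, 0 <= z -> exists r : R, exists L : R, 0 < r /\
  forall x y : R, 0 <= x -> 0 <= y -> `|x - z| < r -> `|y - z| < r ->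
    `|G x - G y| <= L * `|x - y|.

Lemma continuous_nonlinearity : continuous (fun z : R => G (Num.max 0 z)).
Proof.
apply: continuous_comp_max0; apply/subspace_continuousP => z.
rewrite /= in_itv/= andbT => z0.
have [r [L [r0 GL]]] := G_lip z0.
apply/cvgrPdist_lt => e e0; near=> y.
have y0 : 0 <= y.
  near: y; rewrite /prop_near1 /within/=; apply: nearW => y.
  by rewrite in_itv/= andbT.
have yr : `|y - z| < r.
  rewrite distrC; near: y; apply: cvg_within.
  exact: (nbhsx_ballx z _ r0).
apply: (@le_lt_trans _ _ ((`|L| + 1) * `|z - y|)).
  apply: le_trans (GL z y z0 y0 _ yr) _; first by rewrite subrr normr0.
  by rewrite ler_wpM2r// (le_trans (ler_norm _))// lerDl.
rewrite mulrC -ltr_pdivlMr; last by rewrite ltr_wpDl.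
near: y; apply: cvg_within.
have L0 : 0 < e / (`|L| + 1) by rewrite divr_gt0// ltr_wpDl.
exact: (nbhsx_ballx z _ L0).
Unshelve. all: by end_near. Qed.

(** By compactness the local Lipschitz constants are uniform at scale 1/n;
    beyond that scale the monotonicity of G bounds its increments. *)
Lemma lipschitz_nonlinearity (M : R) : exists2 L : R, 0 < L &
  forall x y : R, 0 <= x <= M -> 0 <= y <= M -> `|G x - G y| <= L * `|x - y|.
Proof.
pose Q (n : nat) (z : R) := forall x : R, 0 <= x -> `|x - z| < n.+1%:R^-1 ->
  0 <= z -> `|G x - G z| <= n.+1%:R * `|x - z|.
have QK : \forall n \near \oo, `[0, M]%classic `<=` Q n.
  have /compact_near_coveringP := @segment_compact _ 0 M.
  apply=> z; rewrite /= in_itv/= => /andP[z0 _].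
  have [r [L [r0 GL]]] := G_lip z0; have r2 : 0 < r / 2 by rewrite divr_gt0.
  exists (ball z (r / 2), [set n | n.+1%:R^-1 < r / 2] `&` [set n | L <= n.+1%:R]).
    split=> /=; first exact: nbhsx_ballx.
    apply: filterI; first exact: (near_infty_natSinv_lt (PosNum r2)).
    near=> n; apply: (@le_trans _ _ n%:R); last by rewrite ler_nat.
    by near: n; exact: nbhs_infty_ger.
  move=> [y n] [/= zy [/= nr nL]] x x0 xy y0.
  have yz : `|y - z| < r / 2 by rewrite distrC.
  apply: le_trans (GL x y x0 y0 _ _) _.
  - apply: (@le_lt_trans _ _ (`|x - y| + `|y - z|)); first exact: ler_distD.
    by rewrite [ltRHS]splitr ltrD// (lt_trans xy).
  - by rewrite (lt_le_trans yz)// ler_pdivrMr// ler_pMr// ler1n.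
  - by rewrite ler_wpM2r.
have [n _ /(_ n (leqnn n)) nK] := QK.
have n0 : 0 < n.+1%:R :> R by rewrite ltr0n.
exists (n.+1%:R * (1 + G `|M|)).
  by rewrite mulr_gt0// ltr_pwDl// G_ge0.
move=> x y /andP[x0 xM] /andP[y0 yM].
have GM0 : 0 <= G `|M| by exact: G_ge0.
have Gx : 0 <= G x <= G `|M|.
  by rewrite G_ge0//= nondecreasing_nonlinearity// (le_trans xM)// ler_norm.
have Gy : 0 <= G y <= G `|M|.
  by rewrite G_ge0//= nondecreasing_nonlinearity// (le_trans yM)// ler_norm.
have [xy|xy] := ltP `|x - y| n.+1%:R^-1.
  apply: le_trans (nK y _ x x0 xy y0) _; first by rewrite /= in_itv/= y0.
  by rewrite ler_wpM2r// ler_peMr ?(ltW n0)// lerDl.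
apply: (@le_trans _ _ (1 + G `|M|)).
  by rewrite ler_norml; move: Gx Gy => /andP[? ?] /andP[? ?]; apply/andP; split; lra.
rewrite mulrAC ler_peMl//; first by rewrite addr_ge0.
by rewrite mulrC -ler_pdivrMr// mul1r.
Unshelve. all: by end_near. Qed.

End nonlinearity.

Section source.
Context {R : realType} {d : nat}.
Variables (G W : R -> R) (kappa : R).
Hypothesis G_ge0 : forall z : R, 0 <= z -> 0 <= G z.
Hypothesis G0 : G 0 = 0.
Hypothesis G_incr : forall x y : R, 0 < x -> x <= y -> G x / x <= G y / y.
Hypothesis G_lip : forall z : R, 0 <= z -> exists r : R, exists L : R, 0 < r /\
  forall x y : R, 0 <= x -> 0 <= y -> `|x - z| < r -> `|y - z| < r ->
    `|G x - G y| <= L * `|x - y|.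
Hypothesis cW : continuous (fun r : R => W (Num.max 0 r)).
Implicit Types V U : R -> 'rV[R]_d -> R.

(** G and W are extended to the whole line by their values at 0, so that the
    source is a total measurable function. *)
Definition source V (r : R) (y : 'rV[R]_d) : R :=
  expR (- kappa * W (Num.max 0 r)) *
  G (Num.max 0 (expR (kappa * W (Num.max 0 r)) * V r y)).

Lemma sourceE V r y : 0 <= r -> 0 <= V r y ->
  source V r y = expR (- kappa * W r) * G (expR (kappa * W r) * V r y).
Proof.
by move=> r0 V0; rewrite /source !max_r// mulr_ge0// expR_ge0.
Qed.

Lemma source_term_source V :
  measurable_fun setT (fun z : R * 'rV[R]_d => V z.1 z.2) ->
  source_term (source V).
Proof.
move=> mV; split=> [|r y]; last first.
  by rewrite mulr_ge0 ?expR_ge0// G_ge0// le_max lexx.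
have mW : measurable_fun setT (fun z : R * 'rV[R]_d => W (Num.max 0 z.1)).
  apply: (measurableT_comp (f := fun r : R => W (Num.max 0 r))) => //.
  exact: continuous_measurable_fun.
apply: measurable_funM.
  by apply: measurableT_comp => //; exact: measurable_funM.
apply: (measurableT_comp (f := fun z : R => G (Num.max 0 z))).
  apply: continuous_measurable_fun; exact: continuous_nonlinearity.
apply: measurable_funM => //.
by apply: measurableT_comp => //; exact: measurable_funM.
Qed.

Lemma le_source V U r y : 0 <= V r y <= U r y -> source V r y <= source U r y.
Proof.
move=> /andP[V0 VU]; rewrite ler_wpM2l ?expR_ge0//.
have VU' : expR (kappa * W (Num.max 0 r)) * V r y <=
   expR (kappa * W (Num.max 0 r)) * U r y by rewrite ler_wpM2l ?expR_ge0.
apply: nondecreasing_nonlinearity => //; first by rewrite le_max lexx.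
by rewrite ge_max !le_max lexx VU' orbT.
Qed.

Lemma cvg_source (V_ : nat -> R -> 'rV[R]_d -> R) V r y :
  V_ n r y @[n --> \oo] --> V r y ->
  source (V_ n) r y @[n --> \oo] --> source V r y.
Proof.
move=> cV; apply: cvgMl_tmp.
pose a := expR (kappa * W (Num.max 0 r)).
have cz : a * V_ n r y @[n --> \oo] --> a * V r y by apply: cvgM cV; exact: cvg_cst.
apply: (cvg_comp _ (fun z : R => G (Num.max 0 z)) cz).
exact: continuous_nonlinearity.
Qed.

(** The factors expR (- kappa * W r) and expR (kappa * W r) cancel in the
    Lipschitz estimate. *)
Lemma source_lipschitz V U r y (M L : R) : 0 <= r ->
  (forall x z : R, 0 <= x <= M -> 0 <= z <= M -> `|G x - G z| <= L * `|x - z|) ->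
  0 <= V r y -> expR (kappa * W r) * V r y <= M ->
  0 <= U r y -> expR (kappa * W r) * U r y <= M ->
  `|source V r y - source U r y| <= L * `|V r y - U r y|.
Proof.
move=> r0 GL V0 VM U0 UM; rewrite !sourceE// -mulrBr normrM.
rewrite (gtr0_norm (expR_gt0 _)) mulNr expRN.
rewrite mulrC ler_pdivrMr ?expR_gt0//.
apply: le_trans (GL _ _ _ _) _.
- by rewrite VM mulr_ge0// expR_ge0.
- by rewrite UM mulr_ge0// expR_ge0.
- by rewrite -mulrBr normrM (gtr0_norm (expR_gt0 _)) -mulrA [X in _ * X]mulrC.
Qed.

End source.

(** * The global solution below a supersolution *)

Section noise.
Context {R : realType}.
Variables (W : R -> R) (kappa beta lam : R).
Hypothesis cW : continuous (fun r : R => W (Num.max 0 r)).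

Definition noise (r : R) : R :=
  expR (kappa * beta * W (Num.max 0 r) - (lam + kappa ^+ 2 / 2) * beta * r).

Lemma continuous_noise : continuous noise.
Proof.
move=> r; apply: (@continuous_comp R R R
  (fun r => kappa * beta * W (Num.max 0 r) -
     (lam + kappa ^+ 2 / 2) * beta * r) (@expR R)).
  apply: cvgB; last exact: mulrl_continuous.
  by apply: cvgM; [exact: cvg_cst|exact: cW].
exact: continuous_expR.
Qed.

End noise.

Section global_solution.
Context {R : realType} {dO : measure_display} {Omega : measurableType dO}.
Context {d : nat}.
Variables (P : probability Omega R) (B : R -> Omega -> 'rV[R]_d).
Variable D : set 'rV[R]_d.
Hypotheses (bmB : brownian_motion P B) (oD : open D).
Local Notation S := (killed_semigroup P B D).
Local Notation leb := (@lebesgue_measure R).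

Variables (G W : R -> R) (kappa : R).
Hypothesis G_ge0 : forall z : R, 0 <= z -> 0 <= G z.
Hypothesis G0 : G 0 = 0.
Hypothesis G_incr : forall x y : R, 0 < x -> x <= y -> G x / x <= G y / y.
Hypothesis G_lip : forall z : R, 0 <= z -> exists r : R, exists L : R, 0 < r /\
  forall x y : R, 0 <= x -> 0 <= y -> `|x - z| < r -> `|y - z| < r ->
    `|G x - G y| <= L * `|x - y|.
Hypothesis cW : continuous (fun r : R => W (Num.max 0 r)).
Variables (Lambda beta : R).
Hypotheses (Lambda_gt0 : 0 < Lambda) (beta_gt0 : 0 < beta).
Hypothesis G_le : forall z : R, 0 < z -> G z <= Lambda * z `^ (1 + beta).

Variables (psi : 'rV[R]_d -> R) (lam smax : R).
Hypotheses (mpsi : measurable_fun D psi) (psi_gt0 : forall y, D y -> 0 < psi y).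
Hypothesis psi_le : forall y, D y -> psi y <= smax.
Hypothesis decay : forall (t : R) x, 0 <= t -> D x ->
  (S t psi x <= (expR (- lam * t) * psi x)%:E)%E.

Variables (f : 'rV[R]_d -> R) (A : R).
Hypotheses (mf : measurable_fun D f) (f_ge0 : forall x, D x -> 0 <= f x).
Hypotheses (A_gt0 : 0 < A) (f_le : forall y, D y -> f y <= A * psi y).

Let m := lam + kappa ^+ 2 / 2.
Let c0 := Lambda * (A * smax) `^ beta.

Local Notation noise := (noise W kappa beta lam).

Variable theta : R.
Hypothesis theta_lt1 : theta < 1.
Hypothesis noise_le :
  forall t, beta * c0 * (\int[leb]_(r in `[0, t]) noise r)%R <= theta.

Local Notation phi := (bernoulli noise c0 beta).
Local Notation Phi := (mild_map P B D kappa f).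

(** exp(-m t) psi solves the linear part of the equation; the factor phi
    absorbs the source term, whose growth it matches pointwise. *)
Definition barrier (t : R) (x : 'rV[R]_d) : R :=
  phi t * (A * expR (- m * t) * psi x).

Let c0_ge0 : 0 <= c0.
Proof. by rewrite mulr_ge0 ?powR_ge0// ltW. Qed.

Let phi_gt0 t : 0 < phi t.
Proof. exact: (bernoulli_gt0 theta_lt1 noise_le). Qed.

Lemma barrier_gt0 t x : D x -> 0 < barrier t x.
Proof.
move=> Dx; apply: mulr_gt0; first exact: phi_gt0.
by rewrite mulr_gt0 ?psi_gt0// mulr_gt0 ?expR_gt0.
Qed.

Let rhs (r : R) : R := c0 * noise r * phi r `^ (1 + beta).

Let rhs_ge0 r : 0 <= rhs r.
Proof. by rewrite mulr_ge0 ?powR_ge0// mulr_ge0// expR_ge0. Qed.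

(** The powers of exp (kappa W) combine into the noise, and the excess factor
    psi^beta is bounded by its supremum. *)
Lemma source_barrier (r : R) y : 0 <= r -> D y ->
  source G W kappa barrier r y <= rhs r * (A * expR (- m * r) * psi y).
Proof.
move=> r0 Dy; rewrite sourceE//; last exact/ltW/barrier_gt0.
set z := expR (kappa * W r) * barrier r y.
have z0 : 0 < z by rewrite mulr_gt0 ?expR_gt0// barrier_gt0.
apply: (@le_trans _ _ (expR (- kappa * W r) * (Lambda * z `^ (1 + beta)))).
  by rewrite ler_wpM2l ?expR_ge0// G_le.
have -> : z `^ (1 + beta) = z * z `^ beta.
  rewrite powRD ?powRr1// ?(ltW z0)//.
  by rewrite (gt_eqF z0) implybT.
have -> : expR (- kappa * W r) * (Lambda * (z * z `^ beta)) =
    Lambda * z `^ beta * phi r * (A * expR (- m * r) * psi y).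
  rewrite /z mulNr expRN /barrier.
  have := expR_gt0 (kappa * W r); move: (expR _) (z `^ _) => a b a0.
  by field; rewrite gt_eqF.
rewrite ler_wpM2r//.
  by rewrite mulr_ge0 ?(ltW (psi_gt0 Dy))// mulr_ge0 ?expR_ge0// ltW.
rewrite /rhs powRD; last by rewrite (gt_eqF (phi_gt0 r)) implybT.
rewrite powRr1 ?(ltW (phi_gt0 r))// (mulrC (phi r)) mulrA.
rewrite ler_wpM2r ?(ltW (phi_gt0 r))// -!mulrA ler_wpM2l ?(ltW Lambda_gt0)//.
have zE : z = expR (kappa * W r - m * r) * phi r * (A * psi y).
  by rewrite /z /barrier expRD mulNr; ring.
have s0 : 0 <= smax by apply: le_trans (psi_le Dy); exact/ltW/psi_gt0.
have p0 := ltW (phi_gt0 r).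
have Apsi0 : 0 <= A * psi y by rewrite mulr_ge0 ?(ltW A_gt0)// ltW// psi_gt0.
have e0 := expR_ge0 (kappa * W r - m * r).
have ep0 : 0 <= expR (kappa * W r - m * r) * phi r by rewrite mulr_ge0.
rewrite zE (@powRM _ (_ * _) (A * psi y))//.
rewrite (@powRM _ (expR _) (phi r))//.
rewrite -expRM /noise max_r//.
have -> : (kappa * W r - m * r) * beta = kappa * beta * W r - m * beta * r by ring.
rewrite mulrC ler_wpM2r//; first by rewrite mulr_ge0 ?powR_ge0 ?expR_ge0.
apply: ge0_ler_powR; rewrite ?nnegrE ?(ltW beta_gt0)//.
- by rewrite mulr_ge0// ltW.
- by rewrite ler_pM2l// psi_le.
Qed.

Let scaled_decay (a t : R) x : 0 <= a -> 0 <= t -> D x ->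
  (S t (fun y => a * psi y)%R x <= (a * (expR (- lam * t) * psi x))%:E)%E.
Proof.
move=> a0 t0 Dx; rewrite killed_semigroupZ//.
  by rewrite EFinM lee_wpmul2l ?lee_fin// decay.
by move=> y Dy; exact/ltW/psi_gt0.
Qed.

(** The barrier is a supersolution: by the decay of S_t psi the source
    contributes at most (int_0^t phi') A exp(-m t) psi. *)
Lemma barrier_supersolution g (t : R) x : source_term g -> 0 <= t -> D x ->
  (forall r y, 0 <= r <= t -> D y -> g r y <= source G W kappa barrier r y) ->
  (Phi g t x <= (barrier t x)%:E)%E.
Proof.
move=> sg t0 Dx gb.
have noiseC : continuous noise by exact: continuous_noise.
set b := A * expR (- m * t) * psi x.
have b0 : 0 <= b.
  by rewrite mulr_ge0 ?(ltW (psi_gt0 Dx))// mulr_ge0 ?expR_ge0// ltW.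
have -> : (barrier t x)%:E = (b%:E + (phi t - 1)%:E * b%:E)%E.
  by rewrite -EFinM -EFinD; congr EFin; rewrite /barrier -/b; ring.
apply: leeD.
  apply: (@le_trans _ _ ((expR (- (kappa ^+ 2 * t / 2)))%:E *
      (A * (expR (- lam * t) * psi x))%:E)%E).
    rewrite lee_wpmul2l ?lee_fin ?expR_ge0//.
    apply: le_trans (scaled_decay (ltW A_gt0) t0 Dx).
    apply: (le_killed_semigroup bmB oD) => //; first exact: measurable_funM.
    by move=> y Dy; rewrite f_ge0//= f_le.
  rewrite -EFinM lee_fin /b /m.
  have -> : - (lam + kappa ^+ 2 / 2) * t = - (kappa ^+ 2 * t / 2) + - lam * t.
    by field.
  by rewrite expRD le_eqVlt; apply/orP; left; apply/eqP; ring.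
rewrite -(bernoulli_integral noiseC beta_gt0 theta_lt1 noise_le t0).
have mrhs : measurable_fun `[0, t]%classic (EFin \o rhs).
  apply/measurable_EFinP; apply: subspace_continuous_measurable_fun => //.
  exact: (continuous_bernoulli_rhs noiseC theta_lt1 noise_le t0).
rewrite -ge0_integralZr//; last by move=> r _; rewrite lee_fin rhs_ge0.
apply: ge0_le_integral => //.
- move=> r rt; exact: (mild_integrand_ge0 P B D kappa x sg rt).
- exact: (measurable_mild_integrand bmB oD).
- by apply: emeasurable_funM => //.
move=> r; rewrite /= in_itv/= => /andP[r0 rt].
apply: (@le_trans _ _ ((expR (- (kappa ^+ 2 * (t - r) / 2)))%:E *
   (rhs r * (A * expR (- m * r)) * (expR (- lam * (t - r)) * psi x))%:E)%E).
  rewrite lee_wpmul2l ?lee_fin ?expR_ge0//.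
  have a0 : 0 <= rhs r * (A * expR (- m * r)).
    by rewrite mulr_ge0// mulr_ge0 ?expR_ge0// ltW.
  apply: le_trans (scaled_decay a0 _ Dx); last by rewrite subr_ge0.
  apply: (le_killed_semigroup bmB oD) => //.
  + by rewrite subr_ge0.
  + exact: (source_term_measurable _ sg).
  + exact: measurable_funM.
  + move=> y Dy; rewrite sg.2/= -mulrA; apply: le_trans (gb _ _ _ Dy) _.
      by rewrite r0.
    exact: source_barrier.
rewrite -!EFinM lee_fin -/(rhs r) /b.
have -> : - m * t = - (kappa ^+ 2 * (t - r) / 2) + - m * r + - lam * (t - r).
  by rewrite /m; field.
by rewrite !expRD le_eqVlt; apply/orP; left; apply/eqP; ring.
Qed.

Let restrict (u : R -> 'rV[R]_d -> \bar R) : R -> 'rV[R]_d -> R :=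
  fun t => (fun x => fine (u (Num.max 0 t) x)) \_ D.

(** Started at 0, the iteration increases, because G does. *)
Fixpoint picard n : R -> 'rV[R]_d -> R :=
  if n is k.+1 then restrict (Phi (source G W kappa (picard k)))
  else fun _ _ => 0.

Let picard_inv n :
  [/\ measurable_fun setT (fun z : R * 'rV[R]_d => picard n z.1 z.2),
      forall t x, 0 <= picard n t x &
      forall (t : R) x, 0 <= t -> D x -> picard n t x <= barrier t x].
Proof.
elim: n => [|n [mp p0 pb]].
  by split=> // t x _ Dx; exact/ltW/barrier_gt0.
have ss := source_term_source kappa G_ge0 G_lip cW mp.
split=> [|t x|t x t0 Dx].
- rewrite /= /restrict.
  rewrite (_ : (fun _ => _) = (fun z : R * 'rV[R]_d =>
    fine (Phi (source G W kappa (picard n)) (Num.max 0 z.1) z.2)) \_ (snd @^-1` D)).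
    have mD : measurable ((snd : R * 'rV[R]_d -> 'rV[R]_d) @^-1` D).
      rewrite -[X in measurable X]setTI; apply: measurable_snd => //.
      exact: open_measurable_rV.
    apply: (measurable_restrictT _ mD).1; apply: measurable_funTS.
    apply: (measurableT_comp (f := @fine R)); first exact: fine_measurable.
    exact: (measurable_mild_map bmB oD kappa mf f_ge0 ss).
  by apply/funext => z; rewrite !patchE; congr (if _ then _ else _).
- rewrite /= /restrict patchE; case: ifPn => // _; apply: fine_ge0.
  by apply: (mild_map_ge0 P B _ f_ge0 _ ss); rewrite le_max lexx.
- rewrite /= /restrict patchE mem_set// max_r//.
  have Pb : (Phi (source G W kappa (picard n)) t x <= (barrier t x)%:E)%E.
    apply: barrier_supersolution => // r y /andP[r0 _] Dy.
    by apply: le_source => //; rewrite p0 pb.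
  rewrite -lee_fin fineK// ge0_fin_numE.
    by apply: le_lt_trans Pb _; rewrite ltry.
  exact: (mild_map_ge0 P B _ f_ge0 _ ss).
Qed.

Let source_picard n : source_term (source G W kappa (picard n)).
Proof.
by have [mp _ _] := picard_inv n; exact: (source_term_source kappa G_ge0 G_lip cW mp).
Qed.

Let picardS n (t : R) x : 0 <= t -> D x ->
  (picard n.+1 t x)%:E = Phi (source G W kappa (picard n)) t x.
Proof.
move=> t0 Dx; rewrite /= /restrict patchE mem_set// max_r// fineK//.
have [mp p0 pb] := picard_inv n.
rewrite ge0_fin_numE; last first.
  by apply: (mild_map_ge0 P B _ f_ge0 _ (source_picard n)).
apply: (@le_lt_trans _ _ (barrier t x)%:E); last exact: ltry.
apply: barrier_supersolution => // r y /andP[r0 _] Dy.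
by apply: le_source => //; rewrite p0 pb.
Qed.

Let nd_picard (t : R) x : 0 <= t -> D x -> nondecreasing_seq (fun n => picard n t x).
Proof.
move=> t0 Dx; apply/nondecreasing_seqP => n; elim: n t x t0 Dx => [|n IH] t x t0 Dx.
  by have [_ p0 _] := picard_inv 1; exact: p0.
have aux (a b : R) X Y : a%:E = X -> b%:E = Y -> (X <= Y)%E -> a <= b.
  by move=> <- <-; rewrite lee_fin.
apply: (aux _ _ _ _ (picardS n t0 Dx) (picardS n.+1 t0 Dx)).
apply: (le_mild_map bmB oD); [exact: source_picard|exact: source_picard|exact: t0|].
move=> r y /andP[r0 _] Dy.
by apply: le_source => //; rewrite IH// andbT; have [_ p0 _] := picard_inv n.
Qed.

Definition picard_limit (t : R) (x : 'rV[R]_d) : R :=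
  limn (fun n => picard n t x).

Let cvg_picard (t : R) x : 0 <= t -> D x ->
  picard n t x @[n --> \oo] --> picard_limit t x.
Proof.
move=> t0 Dx; apply: nondecreasing_is_cvgn; first exact: nd_picard.
by exists (barrier t x) => _ [n _ <-]; have [_ _ ] := picard_inv n; exact.
Qed.

(** The barrier bounds all the iterates, and the equation passes to the limit by
    monotone convergence. *)
Lemma picard_limit_mild_solution :
  mild_solution P B D kappa G W f +oo%E picard_limit.
Proof.
have v0 (t : R) x : 0 <= t -> D x -> 0 <= picard_limit t x.
  move=> t0 Dx; apply: limr_ge; first by apply: cvgP; exact: cvg_picard.
  by apply: nearW => n; have [_ p0 _] := picard_inv n.
have vb (t : R) x : 0 <= t -> D x -> picard_limit t x <= barrier t x.
  move=> t0 Dx; apply: limr_le; first by apply: cvgP; exact: cvg_picard.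
  by apply: nearW => n; have [_ _ pb] := picard_inv n; exact: pb.
split=> [t x t0 _ Dx||s _|t x t0 _ Dx].
- exact: v0.
- apply: (measurable_fun_cvg
    (h := fun n (z : R * 'rV[R]_d) => picard n z.1 z.2)).
    by move=> n; have [mp _ _] := picard_inv n; exact: measurable_funTS.
  by move=> z [z0 _ Dz]; exact: cvg_picard.
- exists ((1 - theta) `^ (- beta^-1) * (A * expR (`|m| * s) * smax)) => t x /andP[t0 ts] Dx.
  apply: le_trans (vb _ _ t0 Dx) _; rewrite /barrier.
  have s0 : 0 <= psi x by exact/ltW/psi_gt0.
  apply: ler_pM; rewrite ?(ltW (phi_gt0 t))//.
  + by rewrite mulr_ge0// mulr_ge0 ?expR_ge0// ltW.
  + exact: (bernoulli_le beta_gt0 theta_lt1 noise_le).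
  apply: ler_pM; rewrite ?psi_le//.
    by rewrite mulr_ge0 ?expR_ge0// ltW.
  rewrite ler_pM2l// ler_expR; apply: (@le_trans _ _ (`|m| * t)).
    by rewrite ler_wpM2r// lerNl lerNnormlW.
  by rewrite ler_wpM2l.
have -> : (picard_limit t x)%:E = Phi (fun r y =>
    expR (- kappa * W r) * G (expR (kappa * W r) * picard_limit r y)) t x; last by [].
have cv : (picard n.+1 t x)%:E @[n --> \oo] --> (picard_limit t x)%:E.
  apply: cvg_EFin; first exact: nearW.
  by have := cvg_picard t0 Dx; rewrite -(cvg_shiftS (fun n => picard n t x)).
apply: (cvg_unique _ cv) => //.
rewrite (_ : (fun n => _) = (fun n => Phi (source G W kappa (picard n)) t x)); last first.
  by apply/funext => n; exact: picardS.
apply: (cvg_mild_map bmB oD) => //.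
- move=> r y /andP[r0 _] Dy; apply/nondecreasing_seqP => n; apply: le_source => //.
  have [_ p0 _] := picard_inv n; rewrite p0/=.
  by have /nondecreasing_seqP := nd_picard r0 Dy; exact.
- move=> r y /andP[r0 _] Dy; rewrite -sourceE//; last exact: v0.
  by apply: cvg_source => //; exact: cvg_picard.
Qed.

End global_solution.

(** * Uniqueness of bounded solutions *)

Section perturbation.
Context {R : realType} {dO : measure_display} {Omega : measurableType dO}.
Context {d : nat}.
Variables (P : probability Omega R) (B : R -> Omega -> 'rV[R]_d).
Variable D : set 'rV[R]_d.
Hypotheses (bmB : brownian_motion P B) (oD : open D).
Variables (kappa : R) (f : 'rV[R]_d -> R).
Local Notation leb := (@lebesgue_measure R).
Local Notation S := (killed_semigroup P B D).
Local Notation Phi := (mild_map P B D kappa f).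

(** The semigroup contracts constants. *)
Lemma mild_map_perturbation (g1 g2 : R -> 'rV[R]_d -> R) (h : R -> R) (t : R) x :
  source_term g1 -> source_term g2 -> measurable_fun setT h ->
  (forall r, 0 <= h r) -> 0 <= t ->
  (forall r y, 0 <= r <= t -> D y -> g1 r y <= g2 r y + h r) ->
  (Phi g1 t x <= Phi g2 t x + \int[leb]_(r in `[0%R, t]) (h r)%:E)%E.
Proof.
move=> s1 s2 mh h0 t0 gh; rewrite -addeA; apply: leeD2l.
rewrite -ge0_integralD//=; last 4 first.
- by move=> r rt; exact: (mild_integrand_ge0 P B D kappa x s2 rt).
- exact: (measurable_mild_integrand bmB oD).
- by move=> r _; rewrite lee_fin.
- by apply/measurable_EFinP; exact: measurable_funTS.
apply: ge0_le_integral => //.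
- by move=> r rt; exact: (mild_integrand_ge0 P B D kappa x s1 rt).
- exact: (measurable_mild_integrand bmB oD).
- apply: emeasurable_funD; first exact: (measurable_mild_integrand bmB oD).
  by apply/measurable_EFinP; exact: measurable_funTS.
move=> r; rewrite /= in_itv/= => rt; have /andP[r0 r1] := rt.
have tr : 0 <= t - r by rewrite subr_ge0.
set e := expR _; have e1 : e <= 1.
  by rewrite -expR0 ler_expR oppr_le0 divr_ge0// mulr_ge0// sqr_ge0.
have Sle : (S (t - r) (g1 r) x <= S (t - r) (g2 r) x + (h r)%:E)%E.
  apply: (@le_trans _ _ (S (t - r) (fun y => g2 r y + h r) x)).
    apply: (le_killed_semigroup bmB oD) => //.
    - exact: (source_term_measurable _ s1).
    - by apply: measurable_funD => //; exact: (source_term_measurable _ s2).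
    - by move=> y Dy; rewrite s1.2 gh.
  rewrite (killed_semigroupD bmB oD (v := cst (h r)))//.
  - by apply: leeD2l; exact: (killed_semigroup_cst_le bmB oD).
  - exact: (source_term_measurable _ s2).
  - by move=> y _; exact: s2.2.
  - by move=> y _; exact: h0.
apply: (@le_trans _ _ (e%:E * (S (t - r) (g2 r) x + (h r)%:E))%E).
  by rewrite lee_wpmul2l ?lee_fin ?expR_ge0.
rewrite ge0_muleDr ?lee_fin//; last first.
  by apply: killed_semigroup_ge0 => // y _; exact: s2.2.
by apply: leeD2l; rewrite -EFinM lee_fin ler_piMl.
Qed.

End perturbation.

Section uniqueness.
Context {R : realType} {dO : measure_display} {Omega : measurableType dO}.
Context {d : nat}.
Variables (P : probability Omega R) (B : R -> Omega -> 'rV[R]_d).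
Variable D : set 'rV[R]_d.
Hypotheses (bmB : brownian_motion P B) (oD : open D).
Local Notation leb := (@lebesgue_measure R).
Variables (G W : R -> R) (kappa : R) (f : 'rV[R]_d -> R).
Hypothesis G_ge0 : forall z : R, 0 <= z -> 0 <= G z.
Hypothesis G0 : G 0 = 0.
Hypothesis G_incr : forall x y : R, 0 < x -> x <= y -> G x / x <= G y / y.
Hypothesis G_lip : forall z : R, 0 <= z -> exists r : R, exists L : R, 0 < r /\
  forall x y : R, 0 <= x -> 0 <= y -> `|x - z| < r -> `|y - z| < r ->
    `|G x - G y| <= L * `|x - y|.
Hypothesis cW : continuous (fun r : R => W (Num.max 0 r)).
Local Notation Phi := (mild_map P B D kappa f).
Local Notation solution := (mild_solution P B D kappa G W f).

Let time_domain (T : \bar R) : set (R * 'rV[R]_d) :=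
  [set z | [/\ 0 <= z.1, (z.1%:E < T)%E & D z.2]].

Let measurable_time_domain T : measurable (time_domain T).
Proof.
have mD : measurable [set z : R * 'rV[R]_d | D z.2].
  rewrite -[X in measurable X]setTI; apply: measurable_snd => //.
  exact: open_measurable_rV.
have m0 : measurable [set z : R * 'rV[R]_d | 0 <= z.1].
  have := measurable_fun_le measurableT
    (measurable_cst (0 : R)) (@measurable_fst _ _ R ('rV[R]_d)).
  by rewrite setTI.
have mT : measurable [set z : R * 'rV[R]_d | (z.1%:E < T)%E].
  have := @emeasurable_fun_lt _ _ R setT measurableT
   (fun z : R * 'rV[R]_d => z.1%:E) (cst T).
  rewrite setTI; apply => //.
  by apply/measurable_EFinP; exact: measurable_fst.
rewrite (_ : time_domain T = [set z : R * 'rV[R]_d | 0 <= z.1] `&`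
  [set z : R * 'rV[R]_d | (z.1%:E < T)%E] `&` [set z : R * 'rV[R]_d | D z.2]).
  by do 2 apply: measurableI => //.
by apply/seteqP; split=> [z []|z [[]]].
Qed.

Lemma mild_solution_restrict (T T' : \bar R) u : (T' <= T)%E ->
  solution T u -> solution T' u.
Proof.
move=> TT [u0 mu ub ue]; split.
- by move=> t x t0 tT; apply: u0 => //; exact: lt_le_trans TT.
- apply: measurable_funS mu; first exact: measurable_time_domain.
  by move=> z [z0 zT Dz]; split=> //; exact: lt_le_trans TT.
- by move=> s sT; apply: ub; exact: lt_le_trans TT.
- by move=> t x t0 tT; apply: ue => //; exact: lt_le_trans TT.
Qed.

Let bounded_noise (s : R) : exists M, forall r, 0 <= r <= s ->
  expR (kappa * W r) <= M.
Proof.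
have [s0|s0] := leP 0 s; last first.
  by exists 0 => r /andP[r0 /(le_trans r0)]; rewrite leNgt s0.
pose g r := expR (kappa * W (Num.max 0 r)).
have cg : {within `[0, s], continuous g}.
  apply: continuous_subspaceT => r; apply: (@continuous_comp R R R
    (fun r => kappa * W (Num.max 0 r)) (@expR R)); last exact: continuous_expR.
  by apply: cvgM; [exact: cvg_cst|exact: cW].
have [c _ gc] := EVT_max s0 cg.
exists (g c) => r rs; have := gc r; rewrite in_itv/= => /(_ rs).
by rewrite {1}/g max_r//; case/andP : rs.
Qed.

Let integral_exp (L a t : R) : 0 < L -> 0 <= a -> 0 <= t ->
  (\int[leb]_(r in `[0%R, t]) (L * a * expR (2 * L * r))%:E
   <= (a / 2 * expR (2 * L * t))%:E)%E.
Proof.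
move=> L0 a0; rewrite le_eqVlt => /predU1P[<-|t0].
  by rewrite set_itv1 integral_set1 lee_fin mulr_ge0 ?expR_ge0// divr_ge0.
pose F r : R := a / 2 * expR (2 * L * r).
have dF (r : R) : is_derive r 1 F (L * a * expR (2 * L * r)).
  rewrite /F; apply: is_derive_eq.
  by rewrite /GRing.scale/=; field.
have cF : continuous F.
  by move=> r; apply/differentiable_continuous/derivable1_diffP; case: (dF r).
rewrite (continuous_FTC2 (F := F) t0).
- by rewrite -EFinD lee_fin /F gerBl// mulr_ge0 ?expR_ge0// divr_ge0.
- apply: continuous_subspaceT => r.
  have := cF r; rewrite (_ : (fun r => L * a * expR (2 * L * r)) =
    (fun r => 2 * L * F r)); last first.
    by apply/funext => x; rewrite /F; field.
  by move=> cFr; apply: cvgM => //; exact: cvg_cst.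
- split.
  + by move=> r _; case: (dF r).
  + exact: cvg_at_right_filter (cF _).
  + exact: cvg_at_left_filter (cF _).
- by move=> r _; rewrite derive1E; case: (dF r).
Qed.

Section contraction.
Variables (T : \bar R) (s : R) (u v : R -> 'rV[R]_d -> R) (L M : R).
Hypotheses (solu : solution T u) (solv : solution T v).
Hypotheses (sT : (s%:E < T)%E) (L0 : 0 < L).
Hypothesis GL : forall x z : R, 0 <= x <= M -> 0 <= z <= M ->
  `|G x - G z| <= L * `|x - z|.
Hypothesis uM : forall r y, 0 <= r <= s -> D y ->
  expR (kappa * W r) * u r y <= M.
Hypothesis vM : forall r y, 0 <= r <= s -> D y ->
  expR (kappa * W r) * v r y <= M.

Let ext (w : R -> 'rV[R]_d -> R) (r : R) (y : 'rV[R]_d) : R :=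
  ((fun z : R * 'rV[R]_d => w z.1 z.2) \_ (time_domain T)) (r, y).

Let measurable_ext w : solution T w ->
  measurable_fun setT (fun z : R * 'rV[R]_d => ext w z.1 z.2).
Proof.
move=> [_ mw _ _].
have := (measurable_restrictT _ (measurable_time_domain T)).1 mw.
by congr measurable_fun; apply/funext => -[].
Qed.

Let extE w r y : 0 <= r <= s -> D y -> ext w r y = w r y.
Proof.
move=> /andP[r0 rs] Dy; rewrite /ext patchE mem_set//; split => //=.
by apply: le_lt_trans sT; rewrite lee_fin.
Qed.

Let solution_ext w (t : R) x : solution T w -> 0 <= t <= s -> D x ->
  (w t x)%:E = Phi (source G W kappa (ext w)) t x.
Proof.
move=> [w0 _ _ we] /andP[t0 ts] Dx.
have tT : (t%:E < T)%E by apply: le_lt_trans sT; rewrite lee_fin.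
rewrite (we t x t0 tT Dx).
apply: (eq_mild_map P B kappa f) => r y /andP[r0 rt] Dy.
have rs : 0 <= r <= s by rewrite r0 (le_trans rt).
have rT : (r%:E < T)%E by apply: le_lt_trans tT; rewrite lee_fin.
by rewrite sourceE// ?extE//; apply: w0.
Qed.

(** With the weight exp(2 L t) the integral of the Lipschitz estimate gains a
    factor 1/2. *)
Lemma mild_contraction (a : R) : 0 <= a ->
  (forall r y, 0 <= r <= s -> D y -> `|u r y - v r y| <= a * expR (2 * L * r)) ->
  forall t x, 0 <= t <= s -> D x -> u t x <= v t x + a / 2 * expR (2 * L * t).
Proof.
move=> a0 uv t x ts Dx; have /andP[t0 t1] := ts.
rewrite -lee_fin EFinD (solution_ext solu ts Dx) (solution_ext solv ts Dx).
have su := source_term_source kappa G_ge0 G_lip cW (measurable_ext solu).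
have sv := source_term_source kappa G_ge0 G_lip cW (measurable_ext solv).
apply: le_trans (leeD2l _ (integral_exp L0 a0 t0)).
apply: (mild_map_perturbation bmB oD) => //.
- apply: measurable_funM => //; exact: measurableT_comp.
- by move=> r; rewrite mulr_ge0 ?expR_ge0// mulr_ge0// ltW.
move=> r y /andP[r0 rt] Dy; have rs : 0 <= r <= s by rewrite r0 (le_trans rt).
have rT : (r%:E < T)%E.
  by case/andP : rs => _ rs; apply: le_lt_trans sT; rewrite lee_fin.
have [u0 _ _ _] := solu; have [v0 _ _ _] := solv.
rewrite -lerBlDl; apply: le_trans (ler_norm _) _.
apply: le_trans (source_lipschitz r0 GL _ _ _ _) _; rewrite ?extE//.
- exact: u0.
- exact: uM.
- exact: v0.
- exact: vM.
- by rewrite -mulrA ler_wpM2l ?(ltW L0)// uv.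
Qed.

End contraction.

(** Iterating the contraction from a crude bound C on the difference of the
    solutions bounds it by C 2^-n exp (2 L t) for all n. *)
Lemma mild_solution_unique (T : \bar R) u v : solution T u -> solution T v ->
  forall (t : R) x, 0 <= t -> (t%:E < T)%E -> D x -> u t x = v t x.
Proof.
move=> solu solv s x0 s0 sT Dx0.
have [u0 _ /(_ s sT)[Cu uC] _] := solu; have [v0 _ /(_ s sT)[Cv vC] _] := solv.
have [N NW] := bounded_noise s.
have lt_T r : r <= s -> (r%:E < T)%E.
  by move=> rs; apply: le_lt_trans sT; rewrite lee_fin.
pose C := `|Cu| + `|Cv|.
have bound w : (forall r y, 0 <= r <= s -> D y -> 0 <= w r y <= C) ->
    forall r y, 0 <= r <= s -> D y -> expR (kappa * W r) * w r y <= `|N| * C.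
  move=> w0 r y rs Dy; have /andP[w1 w2] := w0 r y rs Dy.
  apply: ler_pM => //.
  exact: le_trans (NW _ rs) (ler_norm _).
have uB r y : 0 <= r <= s -> D y -> 0 <= u r y <= C.
  move=> rs Dy; have /andP[r0 r1] := rs; rewrite u0 ?lt_T//=.
  by rewrite (le_trans (uC _ _ rs Dy))// (le_trans (ler_norm _))// lerDl.
have vB r y : 0 <= r <= s -> D y -> 0 <= v r y <= C.
  move=> rs Dy; have /andP[r0 r1] := rs; rewrite v0 ?lt_T//=.
  by rewrite (le_trans (vC _ _ rs Dy))// (le_trans (ler_norm _))// lerDr.
have [L L0 GL] := lipschitz_nonlinearity G_ge0 G0 G_incr G_lip (`|N| * C).
have C0 : 0 <= C by rewrite addr_ge0.
have step n : forall r y, 0 <= r <= s -> D y ->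
    `|u r y - v r y| <= C * 2^-1 ^+ n * expR (2 * L * r).
  elim: n => [|n IH] r y rs Dy.
    rewrite expr0 mulr1; apply: (@le_trans _ _ C).
      have := uB _ _ rs Dy; have := vB _ _ rs Dy.
      by move=> /andP[? ?] /andP[? ?]; rewrite ler_norml; apply/andP; split; lra.
    rewrite ler_peMr// -expR0 ler_expR; case/andP : rs => r0 _.
    by rewrite mulr_ge0// mulr_ge0// ltW.
  have a0 : 0 <= C * 2^-1 ^+ n by rewrite mulr_ge0// exprn_ge0.
  have IH' r' y' : 0 <= r' <= s -> D y' ->
      `|v r' y' - u r' y'| <= C * 2^-1 ^+ n * expR (2 * L * r').
    by rewrite distrC; exact: IH.
  have h1 := mild_contraction solu solv sT L0 GL (bound _ uB) (bound _ vB)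
    a0 IH rs Dy.
  have h2 := mild_contraction solv solu sT L0 GL (bound _ vB) (bound _ uB)
    a0 IH' rs Dy.
  by rewrite exprSr mulrA ler_norml; apply/andP; split; lra.
have cz : C * 2^-1 ^+ n * expR (2 * L * s) @[n --> \oo] --> (0 : R).
  rewrite -[X in _ --> X](mul0r (expR (2 * L * s))).
  apply: cvgM; last exact: cvg_cst.
  by apply: cvg_geometric; rewrite gtr0_norm// invf_lt1// ltr1n.
have ss : 0 <= s <= s by rewrite s0 lexx.
apply/eqP; rewrite -subr_eq0 -normr_le0.
rewrite -(cvg_lim _ cz)//; apply: limr_ge; first by apply: cvgP; exact: cz.
by apply: nearW => n; exact: step.
Qed.

End uniqueness.

(** * The condition on the path *)

Section threshold.
Context {R : realType}.
Variables (W : R -> R) (kappa beta lam Lambda K eta s Y : R).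
Hypotheses (Lambda_gt0 : 0 < Lambda) (beta_gt0 : 0 < beta) (K_gt0 : 0 < K).
Hypotheses (s_ge0 : 0 <= s) (Y_gt0 : 0 < Y) (KsY : K * s <= Y).
Hypothesis cW : continuous (fun r : R => W (Num.max 0 r)).
Local Notation leb := (@lebesgue_measure R).
Hypothesis noise_lt :
  (\int[leb]_(r in `[0%R, +oo[)
     (expR (kappa * beta * W r - (lam + kappa ^+ 2 / 2) * beta * r))%:E <
   (expR (lam * beta * eta) / (Lambda * beta * Y `^ beta))%:E)%E.

(** Since K s <= Y, the hypothesis makes beta c0 times the integral of the noise
    over [0, +oo[ smaller than 1, for the constant c0 of the Bernoulli equation
    of the barrier. *)
Lemma noise_threshold : exists2 theta : R, theta < 1 & forall t : R,
  beta * (Lambda * (K * expR (- lam * eta) * s) `^ beta) *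
  (\int[leb]_(r in `[0, t]) noise W kappa beta lam r)%R <= theta.
Proof.
have cN : continuous (noise W kappa beta lam) by exact: continuous_noise.
have mN : measurable_fun setT (EFin \o noise W kappa beta lam).
  by apply/measurable_EFinP; exact: continuous_measurable_fun.
pose J := (\int[leb]_(r in `[0%R, +oo[) (noise W kappa beta lam r)%:E)%E.
have N0 r : (0 <= (noise W kappa beta lam r)%:E)%E by rewrite lee_fin expR_ge0.
have J0 : (0 <= J)%E by apply: integral_ge0.
have Jlt : (J < (expR (lam * beta * eta) / (Lambda * beta * Y `^ beta))%:E)%E.
  apply: le_lt_trans noise_lt; rewrite le_eqVlt; apply/orP; left; apply/eqP.
  apply: eq_integral => r; rewrite inE/= in_itv/= andbT => r0.
  by rewrite /noise max_r.
have Jfin : J \is a fin_num by rewrite ge0_fin_numE// (lt_trans Jlt)// ltry.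
have JtJ (t : R) : (\int[leb]_(r in `[0%R, t]) (noise W kappa beta lam r)%:E <= J)%E.
  apply: ge0_subset_integral => //.
    exact: measurable_funTS.
  by move=> r; rewrite /= !in_itv/= andbT => /andP[].
exists (beta * (Lambda * (K * expR (- lam * eta) * s) `^ beta) * fine J).
  have : (K * expR (- lam * eta) * s) `^ beta <=
      Y `^ beta * expR (- (lam * beta * eta)).
    have -> : expR (- (lam * beta * eta)) = expR (- lam * eta) `^ beta.
      by rewrite -expRM; congr expR; ring.
    rewrite -powRM ?expR_ge0 ?(ltW Y_gt0)//.
    apply: ge0_ler_powR; rewrite ?nnegrE ?(ltW beta_gt0)//.
    - by rewrite !mulr_ge0 ?expR_ge0// ltW.
    - by rewrite mulr_ge0 ?expR_ge0// ltW.
    - by rewrite mulrAC ler_wpM2r ?expR_ge0.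
  move: Jlt; rewrite -(fineK Jfin) lte_fin /=.
  rewrite expRN ltr_pdivlMr; last by rewrite mulr_gt0 ?powR_gt0// mulr_gt0.
  have : 0 <= fine J by exact: fine_ge0.
  have := expR_gt0 (lam * beta * eta).
  move: (fine J) (expR (lam * _ * _)) (Y `^ _) ((K * _ * _) `^ beta) => j e y a e0 j0 jlt.
  rewrite ler_pdivlMr// => ae.
  have := ler_wpM2l (mulr_ge0 j0 (mulr_ge0 (ltW Lambda_gt0) (ltW beta_gt0))) ae.
  move=> h; rewrite -(ltr_pM2r e0) mul1r.
  by apply: le_lt_trans jlt; move: h; rewrite le_eqVlt; nra.
move=> t; rewrite ler_wpM2l//.
  by rewrite mulr_ge0 ?(ltW beta_gt0)// mulr_ge0 ?powR_ge0// ltW.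
apply: fine_le => //; rewrite ge0_fin_numE ?integral_ge0//.
by apply: le_lt_trans (JtJ t) _; rewrite ltey_eq Jfin.
Qed.

End threshold.

(** * Global existence and uniqueness *)

Theorem theorem7 (R : realType) (d : nat) (d_gt0 : (0 < d)%N)
    (D : set 'rV[R]_d) (alpha : R) (alpha_gt0 : 0 < alpha)
    (domD : bounded_C1_holder_domain alpha D)
    (Lambda beta kappa : R) (Lambda_gt0 : 0 < Lambda) (beta_gt0 : 0 < beta)
    (kappa_neq0 : kappa != 0)
    (G : R -> R)
    (G_ge0 : forall z : R, 0 <= z -> 0 <= G z)
    (G_lip : forall z : R, 0 <= z -> exists r : R, exists L : R, 0 < r /\
      forall x y : R, 0 <= x -> 0 <= y -> `|x - z| < r -> `|y - z| < r ->
        `|G x - G y| <= L * `|x - y|)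
    (G0 : G 0 = 0)
    (G_incr : forall x y : R, 0 < x -> x <= y -> G x / x <= G y / y)
    (G_le : forall z : R, 0 < z -> G z <= Lambda * z `^ (1 + beta))
    (dW : measure_display) (OmegaW : measurableType dW)
    (PW : probability OmegaW R) (W : R -> OmegaW -> R)
    (bmW : brownian_motion PW (fun t w => const_mx (W t w) : 'rV[R]_1))
    (dB : measure_display) (OmegaB : measurableType dB)
    (PB : probability OmegaB R) (B : R -> OmegaB -> 'rV[R]_d)
    (bmB : brownian_motion PB B)
    (p : R -> 'rV[R]_d -> 'rV[R]_d -> R)
    (hp : dirichlet_heat_kernel PB B D p)
    (f : 'rV[R]_d -> R)
    (f_ge0 : forall x, D x -> 0 <= f x)
    (f_C2 : C2_on D f)
    (f_neq0 : exists2 x, D x & f x != 0)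
    (lam1 lam2 : R) (hlam : first_two_dirichlet_eigenvalues D lam1 lam2)
    (psi : 'rV[R]_d -> R)
    (psi_eigen : dirichlet_eigenfunction D lam1 psi)
    (psi_gt0 : forall x, D x -> 0 < psi x)
    (psi_norm : (\int[lebesgue_rV d]_(x in D) ((psi x) ^+ 2)%:E = 1)%E)
    (c : R) (c_gt0 : 0 < c)
    (hc : heat_kernel_bound D p psi lam1 lam2 c)
    (eta K : R) (eta_gt0 : 0 < eta) (K_gt0 : 0 < K)
    (f_le : forall y, D y ->
      ((f y)%:E <= K%:E * killed_semigroup PB B D eta psi y)%E)
    (w : OmegaW)
    (hw : (\int[lebesgue_measure]_(r in `[0%R, +oo[)
             (expR (kappa * beta * W r w
                    - (lam1 + kappa ^+ 2 / 2) * beta * r))%:E <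
           (expR (lam1 * beta * eta) /
            (Lambda * beta *
             (K * (1 + c) * (sup (psi @` D)) ^+ 2 *
              \int[lebesgue_rV d]_(y in D) psi y) `^ beta))%:E)%E) :
  exists v : R -> 'rV[R]_d -> R,
    mild_solution PB B D kappa G (W^~ w) f +oo%E v /\
    forall (T : R) (u : R -> 'rV[R]_d -> R), 0 < T ->
      mild_solution PB B D kappa G (W^~ w) f T%:E u ->
      forall (t : R) x, 0 <= t < T -> D x -> u t x = v t x.
Proof.
have [D0 oD _ bD _] := domD.
have [C2psi cpsi _ eigen_psi _] := psi_eigen.
have mpsi := measurable_C2 oD C2psi; have mf := measurable_C2 oD f_C2.
have [_ _ cWpath _ _] := bmW.
have cW : continuous (fun r : R => W (Num.max 0 r) w).
  have h := continuous_comp_max0 (cWpath w) => r.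
  rewrite (_ : (fun r : R => W (Num.max 0 r) w) = (fun r : R =>
    (const_mx (W (Num.max 0 r) w) : 'rV[R]_1) ord0 ord0)); last first.
    by apply/funext => x; rewrite mxE.
  apply: (@continuous_comp _ _ _
    (fun s : R => const_mx (W (Num.max 0 s) w) : 'rV[R]_1)
    (fun v : 'rV[R]_1 => v ord0 ord0)); first exact: h.
  exact: coord_continuous.
pose s := sup (psi @` D).
have s0 : 0 < s := sup_image_gt0 D0 bD cpsi psi_gt0.
have psi_s x : D x -> psi x <= s by exact: le_sup_image.
have decay (t : R) x : 0 <= t -> D x ->
    (killed_semigroup PB B D t psi x <= (expR (- lam1 * t) * psi x)%:E)%E.
  move=> t0 Dx.
  exact: (killed_semigroup_decay bmB oD bD C2psi psi_gt0 eigen_psi).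
pose I := \int[lebesgue_rV d]_(y in D) psi y.
have sI : 1 <= s * I := sup_integral_ge1 D0 oD bD cpsi psi_gt0 mpsi psi_norm.
(* The hypothesis bounds the noise in terms of a larger constant than K s, as
   1 <= (1 + c) (s I). *)
have KsY : K * s <= K * (1 + c) * s ^+ 2 * I.
  have -> : K * (1 + c) * s ^+ 2 * I = K * s * ((1 + c) * (s * I)) by ring.
  rewrite ler_peMr//; first by rewrite mulr_ge0// ltW.
  by rewrite -[leLHS]mul1r ler_pM// lerDl ltW.
have Y0 : 0 < K * (1 + c) * s ^+ 2 * I by apply: lt_le_trans KsY; rewrite mulr_gt0.
have [theta theta1 noise_le] :=
  noise_threshold Lambda_gt0 beta_gt0 K_gt0 (ltW s0) Y0 KsY cW hw.
have A0 : 0 < K * expR (- lam1 * eta) by rewrite mulr_gt0 ?expR_gt0.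
have fA y : D y -> f y <= K * expR (- lam1 * eta) * psi y.
  move=> Dy; rewrite -lee_fin; apply: le_trans (f_le _ Dy) _.
  rewrite -mulrA EFinM lee_wpmul2l ?lee_fin ?(ltW K_gt0)//.
  by apply: decay => //; exact: ltW.
have sol := picard_limit_mild_solution bmB oD G_ge0 G0 G_incr G_lip cW
  Lambda_gt0 beta_gt0 G_le mpsi psi_gt0 psi_s decay mf f_ge0 A0 fA theta1 noise_le.
eexists; split; first exact: sol.
move=> T u T0 solu t x /andP[t0 tT] Dx.
have solT := mild_solution_restrict oD (leey T%:E) sol.
by apply: (mild_solution_unique bmB oD G_ge0 G0 G_incr G_lip cW solu solT);
  rewrite ?lte_fin.
Qed.
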